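(* Let $E=\bigcup_{j=1}^N I^j\subset\mathbb{R}$ be a finite union of bounded intervals, let $\Lambda\subset\mathbb{C}$, and let $\{e_\lambda\}_{\lambda\in\Lambda}$, $e_\lambda(t)=e^{i\lambda t}$, be a complete and minimal system in $L^2(E)$. Then $$\mathcal{D}_+(\Lambda)=\limsup_{R\to\infty}\frac{\#(\Lambda\cap B(0,R))}{2R}\le\frac{|E|}{2\pi}.$$
   Context: $|E|$ denotes the Lebesgue measure of $E$ and $B(0,R)$ is the disk in $\mathbb{C}$ of radius $R$ centered at $0$. A system in a Hilbert space is complete if its closed linear span is the whole space, and minimal if no element belongs to the closed linear span of the others. *)

(* Defs.v *)
From HB Require Import structures.
From mathcomp Require Import all_boot all_order all_algebra.
From mathcomp Require Import all_classical all_reals all_analysis.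
From mathcomp Require Import complex.

Set Implicit Arguments.
Unset Strict Implicit.
Unset Printing Implicit Defensive.

Import Order.TTheory GRing.Theory Num.Theory.
Import numFieldNormedType.Exports.

Local Open Scope classical_set_scope.
Local Open Scope ring_scope.
Local Open Scope complex_scope.

Definition cexp (R : realType) (z : R[i]) : R[i] :=
  (expR (complex.Re z))%:C * (cos (complex.Im z) +i* sin (complex.Im z)).

Definition expfun (R : realType) (l : R[i]) : R -> R[i] :=
  fun t => cexp ('i%C * l * t%:C).

(* Elements of L^2(E) are handled through representatives: functions on the
   whole line of which only the restriction to E matters. The norm below is
   thus a seminorm, whose null functions are those vanishing a.e. on E. *)
Definition L2norm (R : realType) (E : set R) (f : R -> R[i]) : \bar R :=
  Lnorm (@lebesgue_measure R) 2%:E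
    (((fun t => (Normc.normc (f t))%:E) : R -> \bar R) \_ E).

Definition L2 (R : realType) (E : set R) : set (R -> R[i]) :=
  [set f : R -> R[i] | [/\ measurable_fun E (fun t : R => complex.Re (f t)),
               measurable_fun E (fun t : R => complex.Im (f t)) &
               (L2norm E f < +oo)%E]].

Definition linear_span (R : realType) (I : choiceType) (A : set I)
    (e : I -> R -> R[i]) : set (R -> R[i]) :=
  [set g | exists (s : seq I) (c : I -> R[i]),
     [set` s] `<=` A /\ g = (fun t => \sum_(k <- s) c k * e k t)].

Definition closed_span (R : realType) (E : set R) (I : choiceType) (A : set I)
    (e : I -> R -> R[i]) : set (R -> R[i]) :=
  [set f | L2 E f /\ forall eps : R, 0 < eps ->
     exists2 g, linear_span A e g &
       (L2norm E (fun t => f t - g t)%R < eps%:E)%E].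

Definition complete_system (R : realType) (E : set R) (I : choiceType)
    (A : set I) (e : I -> R -> R[i]) : Prop :=
  closed_span E A e = L2 E.

Definition minimal_system (R : realType) (E : set R) (I : choiceType)
    (A : set I) (e : I -> R -> R[i]) : Prop :=
  forall k, A k -> ~ closed_span E (A `\ k) e (e k).

Definition disk (R : realType) (r : R) : set R[i] :=
  [set z | Normc.normc z < r].

(* The cardinality is extended-real-valued: it is +oo on infinite sets. *)
Definition upper_density (R : realType) (L : set R[i]) : \bar R :=
  limf_esup (fun r : R => (counting (L `&` disk r) * ((2 * r)^-1)%:E)%E)
            (pinfty_nbhs R).

(* Main.v *)
Require Import Defs.
From mathcomp Require Import all_boot all_order all_algebra.
From mathcomp Require Import all_classical all_reals all_analysis.
From mathcomp Require Import complex perm.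
From mathcomp Require Import ring lra zify.
Import Order.TTheory GRing.Theory Num.Theory.
Import numFieldNormedType.Exports.
Set Implicit Arguments.
Unset Strict Implicit.
Unset Printing Implicit Defensive.
Local Open Scope classical_set_scope.
Local Open Scope ring_scope.

(** Put s = - i l, so that the exponential with
    frequency l is exp(- s t). Minimality gives, for every l0 in Lambda, a
    bounded functional on L^2(E) that kills the exponentials of the other
    frequencies but not that of l0 ([minimal_functional]). Its transform, the
    function of s obtained by applying it to exp(- s t), therefore vanishes at
    - i l for every l in Lambda other than l0.

    If E were a segment, this transform would be a function of exponential type
    |E| and the density theorem for the zeros of such functions would conclude.
    For several intervals its type is the length of the convex hull of E, which
    is too large. The remedy is to cover E by M disjoint cells of one length d
    with M d <= |E| + eps ([grid_cover]). Cutting the functional of l0 to the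
    j-th cell and moving this cell to the origin gives functions f_{l0,j} of
    type d only, and the sum over j of exp(- s x_j) f_{l0,j}(s) is the full
    transform. Take frequencies l_1, ..., l_r for which the matrix f_{l_i,j}(s)
    has the largest rank r <= M that occurs, and a minor of order r that is not
    identically 0. It is a function of type r d <= |E| + eps. It vanishes at
    every other frequency l: otherwise, at s = - i l, the r rows would be
    independent and orthogonal to the vector exp(- s x_j), while the row of l
    is not orthogonal to it, so that rank r + 1 would occur
    ([determinant_function]). A nonzero function of type w has at most
    (w / pi + eps) T zeros in the disk of radius T, for T large
    ([zeros_count]). Dividing by 2 T and letting eps tend to 0 gives the bound.

    The zeros are counted without holomorphic functions. A function F belongs to
    the Hardy space H^2 of the right half-plane, with norm at most A, exactly
    when |sum_i c_i F(s_i)|^2 <= A^2 sum_{i,j} c_i conj(c_j) / (s_i + conj(s_j))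
    for all finite families, and this inequality is all that is ever known of F.
    It is stable under division by the Blaschke factors of the zeros, by pure
    algebra ([hardy_div_blaschke]), whence |F(p)| is at most a constant times
    the product of the |b_z(p)| over the zeros z ([hardy_zeros_bound]). This
    bounds the number of zeros as soon as F is not too small at p. Such points
    exist in every segment of length comparable to T of the line Re s = H T, up
    to replacing F(s) by exp(al s) F(s) with al as large as possible
    ([pw_good_points]): were the function tiny on arbitrarily long such
    segments, interpolating it at about c T of their points and dividing by
    the corresponding Blaschke product, which is close to a unimodular constant
    times exp(- gam s), would show that a further factor exp(gam s) is allowed
    ([tiny_segments_gain]). One point p suffices to see that there are o(T)
    zeros in a sector away from the imaginary axis ([sector_count]). For the
    zeros near the axis, the bound is averaged over a grid of points p on a line
    close to the axis: the Poisson kernels then add up to nearly pi per zero,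
    and the constant w / pi appears ([flat_count]). *)

(** * The Szego kernel of a half-plane *)

Section SzegoKernel.
Variable C : numClosedFieldType.
Implicit Types (s t a c : C) (v : seq (C * C)).

Definition rhp s : bool := 0 < s + s^*.

(** The Gram form of the reproducing kernel 1 / (s + conj t) of the Hardy space
    of the right half-plane, on a family v of pairs (coefficient, point). *)
Definition kform v : C :=
  \sum_(p <- v) \sum_(q <- v) p.1 * (q.1)^* / (p.2 + (q.2)^*).

Definition reweight (g : C -> C) v := [seq (p.1 * g p.2, p.2) | p <- v].

Definition blaschke a s := (s - a) / (s + a^*).

Definition kpair a v := \sum_(p <- v) p.1 / (p.2 + a^*).

Lemma rhp_neq0 s t : rhp s -> rhp t -> s + t^* != 0.
Proof.
rewrite /rhp => hs ht; apply/eqP => /eqP; rewrite addr_eq0 => /eqP e.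
have := addr_gt0 hs ht; rewrite e rmorphN /= conjCK.
by rewrite (_ : _ + _ = 0) ?ltxx //; ring.
Qed.

Lemma kpairC a v : (kpair a v)^* = \sum_(q <- v) (q.1)^* / (a + (q.2)^*).
Proof.
rewrite /kpair rmorph_sum; apply: eq_bigr => q _.
by rewrite fmorph_div rmorphD /= conjCK addrC.
Qed.

Lemma kform_cons c a v :
  kform ((c, a) :: v) = c * c^* / (a + a^*) + c * (kpair a v)^*
                        + c^* * kpair a v + kform v.
Proof.
rewrite /kform big_cons big_cons /= kpairC /kpair !mulr_sumr -!addrA.
congr (_ + (_ + _)); first by apply: eq_bigr => q _; rewrite mulrA.
under [X in X = _]eq_bigr => p _ do rewrite big_cons /=.
rewrite big_split /=; congr (_ + _).
by apply: eq_bigr => p _; rewrite mulrA [c^* * _]mulrC.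
Qed.

(** The kernel and its multiple by a Blaschke factor differ by a kernel of rank
    one. Everything that is needed about the Hardy space follows from this
    identity. *)
Lemma blaschke_kernel a s t : rhp a -> rhp s -> rhp t ->
  blaschke a s * (blaschke a t)^* / (s + t^*) =
  (s + t^*)^-1 - (a + a^*) / ((s + a^*) * (a + t^*)).
Proof.
move=> ha hs ht; rewrite /blaschke fmorph_div !rmorphD rmorphN /= conjCK.
have st := rhp_neq0 hs ht; have sa := rhp_neq0 hs ha.
have ta := rhp_neq0 ha ht.
have ta2 : t^* + a != 0 by rewrite addrC.
by field; rewrite ?st ?sa ?ta ?ta2.
Qed.

Lemma kform_reweight_blaschke a v : rhp a -> {in v, forall p, rhp p.2} ->
  kform (reweight (blaschke a) v) =
  kform v - kpair a v * (kpair a v)^* * (a + a^*).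
Proof.
move=> ha hv; rewrite kpairC /kpair /kform /reweight big_map.
rewrite mulrAC 2!mulr_suml raddf_sum -big_split /=.
rewrite big_seq [RHS]big_seq; apply: eq_bigr => p /hv hp.
rewrite big_map mulr_sumr raddf_sum -big_split /=.
rewrite big_seq [RHS]big_seq; apply: eq_bigr => q /hv hq.
have e := blaschke_kernel ha hp hq; rewrite rmorphM /=.
have -> : p.1 * blaschke a p.2 * (q.1^* * (blaschke a q.2)^*) / (p.2 + q.2^*) =
  p.1 * q.1^* * (blaschke a p.2 * (blaschke a q.2)^* / (p.2 + q.2^*)) by ring.
rewrite e; have st := rhp_neq0 hp hq; have sa := rhp_neq0 hp ha.
have ta := rhp_neq0 ha hq.
by field; rewrite ?st ?sa ?ta.
Qed.

(** Completing the square in the coefficient of one more point. Iterating it is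
    the Cholesky decomposition of the Gram matrix, hence its positivity. *)
Lemma kform_cons_blaschke c a v : rhp a -> {in v, forall p, rhp p.2} ->
  kform ((c, a) :: v) =
  `|c + kpair a v * (a + a^*)| ^+ 2 / (a + a^*)
  + kform (reweight (blaschke a) v).
Proof.
move=> ha hv; rewrite kform_cons kform_reweight_blaschke // normCK.
rewrite rmorphD rmorphM rmorphD /= conjCK.
have aa := rhp_neq0 ha ha; field; exact: aa.
Qed.

(** The value of the Gram form for the coefficient that minimizes it. This is
    why a zero at a of a function can be removed: the point a may be added to a
    family with this coefficient, and the function does not see it. *)
Lemma kform_cons_opt a v : rhp a -> {in v, forall p, rhp p.2} ->
  kform ((- (kpair a v * (a + a^*)), a) :: v) = kform (reweight (blaschke a) v).
Proof.
by move=> ha hv; rewrite kform_cons_blaschke // addNr normr0 expr0n mul0r add0r.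
Qed.

Lemma reweight_in g v (P : C -> bool) :
  {in v, forall p, P p.2} -> {in reweight g v, forall p, P p.2}.
Proof. by move=> h p /mapP[q /h hq ->]. Qed.

Lemma kform_ge0 v : {in v, forall p, rhp p.2} -> 0 <= kform v.
Proof.
elim: {v}_.+1 {-2}v (ltnSn (size v)) => // n IH [|[c a] v] /= sv hv.
  by rewrite /kform big_nil.
have ha : rhp a by exact: (hv (c, a) (mem_head _ _)).
have hv' : {in v, forall p, rhp p.2} by move=> p pv; apply: hv; rewrite in_cons pv orbT.
rewrite kform_cons_blaschke // addr_ge0 //.
  by rewrite divr_ge0 // ?exprn_ge0 // ltW.
by apply: IH; [rewrite size_map -ltnS | exact: reweight_in].
Qed.

Lemma kpair_le a v : rhp a -> {in v, forall p, rhp p.2} ->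
  `|kpair a v| ^+ 2 * (a + a^*) <= kform v.
Proof.
move=> ha hv; rewrite -subr_ge0 normCK -kform_reweight_blaschke //.
by apply: kform_ge0; exact: reweight_in.
Qed.

Lemma kform_blaschke_le a v : rhp a -> {in v, forall p, rhp p.2} ->
  kform (reweight (blaschke a) v) <= kform v.
Proof.
move=> ha hv; rewrite kform_reweight_blaschke // lerBlDr lerDl.
by rewrite -normCK mulr_ge0 ?exprn_ge0 // ltW.
Qed.

End SzegoKernel.

(** * The modulus of a complex number *)

Section RealNorm.
Variable R : realType.
Implicit Types z w : R[i].
Local Notation nm := Normc.normc.

Lemma nmE z : `|z| = (nm z)%:C%C.
Proof. by case: z. Qed.

Lemma nm_ge0 z : 0 <= nm z :> R.
Proof. by case: z => a b; exact: sqrtr_ge0. Qed.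

Lemma nmD z w : nm (z + w) <= nm z + nm w :> R.
Proof. by rewrite -lecR rmorphD /= -!nmE ler_normD. Qed.

Lemma nmN z : nm (- z) = nm z :> R.
Proof. by apply: complexI; rewrite -!nmE normrN. Qed.

Lemma nmB z w : nm (z - w) <= nm z + nm w :> R.
Proof. by rewrite -(nmN w) nmD. Qed.

Lemma nm_sqr z : nm z ^+ 2 = complex.Re z ^+ 2 + complex.Im z ^+ 2 :> R.
Proof. by case: z => a b /=; rewrite sqr_sqrtr // addr_ge0 ?sqr_ge0. Qed.

Lemma nm_real (x : R) : nm x%:C%C = `|x|.
Proof. by rewrite /= expr0n /= addr0 sqrtr_sqr. Qed.

Lemma nm_conj z : nm z^* = nm z :> R.
Proof. by apply: complexI; rewrite -!nmE norm_conjC. Qed.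

Lemma nm_eq0 z : (nm z == 0 :> R) = (z == 0).
Proof.
apply/eqP/eqP => [/Normc.eq0_normc //|->]; exact: Normc.normc0.
Qed.

Lemma nm_gt0 z : (0 < nm z :> R) = (z != 0).
Proof. by rewrite lt_def nm_ge0 andbT nm_eq0. Qed.

Lemma nm_sum (I : Type) (r : seq I) (P : pred I) (F : I -> R[i]) :
  nm (\sum_(i <- r | P i) F i) <= \sum_(i <- r | P i) nm (F i) :> R.
Proof.
elim/big_ind2 : _ => [|z1 x1 z2 x2 h1 h2|//]; first by rewrite Normc.normc0.
by rewrite (le_trans (nmD _ _)) // lerD.
Qed.

Lemma nm_prod (I : Type) (r : seq I) (P : pred I) (F : I -> R[i]) :
  nm (\prod_(i <- r | P i) F i) = \prod_(i <- r | P i) nm (F i) :> R.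
Proof. exact: (big_morph _ (@Normc.normcM R) (Normc.normc1 R)). Qed.

Lemma Re_le_nm z : `|complex.Re z| <= nm z :> R.
Proof.
by rewrite -(ler_pXn2r (ltn0Sn 1)) ?nnegrE ?nm_ge0 // nm_sqr real_normK ?num_real // lerDl sqr_ge0.
Qed.

Lemma nm_Im_le z : `|complex.Im z| <= nm z :> R.
Proof.
by rewrite -(ler_pXn2r (ltn0Sn 1)) ?nnegrE ?nm_ge0 // nm_sqr real_normK ?num_real // lerDr sqr_ge0.
Qed.

Lemma nm_le_ReIm z : nm z <= `|complex.Re z| + `|complex.Im z| :> R.
Proof.
have h : 0 <= `|complex.Re z| + `|complex.Im z| by rewrite addr_ge0.
rewrite -(ler_pXn2r (ltn0Sn 1)) ?nnegrE ?nm_ge0 // nm_sqr sqrrD !real_normK ?num_real //.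
by rewrite lerD2r lerDl mulrn_wge0 // mulr_ge0.
Qed.

Lemma rhpE z : rhp z = (0 < complex.Re z).
Proof.
case: z => a b; rewrite /rhp ltcE /= subrr eqxx /= -mulr2n.
by rewrite pmulrn_lgt0.
Qed.

Lemma addC_conj z : z + z^* = (2 * complex.Re z)%:C%C.
Proof. by case: z => a b; apply/eqP; rewrite eq_complex /= subrr mulr2n mulrDl mul1r !eqxx. Qed.

End RealNorm.

(** * The Hardy space of the right half-plane *)

Section Hardy.
Variable R : realType.
Local Notation C := R[i].
Local Notation nm := (@Normc.normc R).
Implicit Types (a c s : C) (v : seq (C * C)) (F G : C -> C) (U : C -> Prop).

Definition pairing F v := \sum_(p <- v) p.1 * F p.2.

Definition vnorm v : R := Num.sqrt (complex.Re (kform v)).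

(** F belongs to the Hardy space with norm at most A, as far as its values at
    the points of U are concerned. By duality with the span of the kernels this
    inequality is equivalent to the existence of an element of norm at most A
    that agrees with F on U, and it replaces holomorphy. *)
Definition hardy U (A : R) F :=
  forall v, {in v, forall p, U p.2} -> nm (pairing F v) <= A * vnorm v.

Lemma vnorm_ge0 v : 0 <= vnorm v. Proof. exact: sqrtr_ge0. Qed.

Lemma kform_vnorm v : {in v, forall p, rhp p.2} -> kform v = (vnorm v ^+ 2)%:C%C.
Proof.
move=> hv; have := kform_ge0 hv; rewrite /vnorm; case: (kform v) => a b.
by rewrite lecE /= => /andP[/eqP -> h]; rewrite sqr_sqrtr.
Qed.

Lemma vnorm_le v v' : {in v, forall p, rhp p.2} -> {in v', forall p, rhp p.2} ->
  kform v <= kform v' -> vnorm v <= vnorm v'.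
Proof.
move=> h h'; rewrite !kform_vnorm // lecR ler_pXn2r // nnegrE; exact: vnorm_ge0.
Qed.

Lemma pairing_reweight F g v : pairing F (reweight g v) = pairing (fun s => g s * F s) v.
Proof. by rewrite /pairing big_map; apply: eq_bigr => p _; rewrite mulrA. Qed.

Lemma eq_pairing F G v : {in v, forall p, F p.2 = G p.2} -> pairing F v = pairing G v.
Proof.
move=> h; rewrite /pairing big_seq [RHS]big_seq.
by apply: eq_bigr => p /h ->.
Qed.

Lemma hardyW U A B F : A <= B -> hardy U A F -> hardy U B F.
Proof. by move=> AB h v /h /le_trans -> //; rewrite ler_wpM2r ?vnorm_ge0. Qed.

Lemma hardy_sub U U' A F : (forall s, U' s -> U s) -> hardy U A F -> hardy U' A F.
Proof. by move=> UU h v hv; apply: h => p /hv /UU. Qed.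

Lemma eq_hardy U A F G : (forall s, U s -> F s = G s) -> hardy U A F -> hardy U A G.
Proof.
move=> FG h v hv; rewrite -(@eq_pairing F); first exact: h.
by move=> p /hv /FG.
Qed.

Lemma hardyD U A B F G : hardy U A F -> hardy U B G ->
  hardy U (A + B) (fun s => F s + G s).
Proof.
move=> hF hG v hv; rewrite /pairing mulrDl.
under eq_bigr do rewrite mulrDr.
by rewrite big_split (le_trans (nmD _ _)) // lerD // ?hF ?hG.
Qed.

Lemma hardyZ U A F c : hardy U A F -> hardy U (nm c * A) (fun s => c * F s).
Proof.
move=> hF v hv; rewrite /pairing.
under eq_bigr do rewrite mulrCA.
by rewrite -mulr_sumr Normc.normcM -mulrA ler_wpM2l ?nm_ge0 ?hF.
Qed.

Lemma hardy0 U : hardy U 0 (fun=> 0).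
Proof.
move=> v _; rewrite /pairing big1 ?Normc.normc0 ?mul0r // => p _.
by rewrite mulr0.
Qed.

Lemma hardy_sum U (I : eqType) (r : seq I) (A : I -> R) (F : I -> C -> C) :
  {in r, forall i, hardy U (A i) (F i)} ->
  hardy U (\sum_(i <- r) A i) (fun s => \sum_(i <- r) F i s).
Proof.
elim: r => [_|i r IH h].
  rewrite big_nil; apply: eq_hardy (@hardy0 U) => s _; by rewrite big_nil.
rewrite big_cons; apply: (@eq_hardy _ _ (fun s => F i s + \sum_(j <- r) F j s)).
  by move=> s _; rewrite big_cons.
apply: hardyD; first by apply: h; rewrite mem_head.
by apply: IH => j jr; apply: h; rewrite in_cons jr orbT.
Qed.

Lemma hardy_kernel a : rhp a ->
  hardy (fun s => rhp s) (Num.sqrt (2 * complex.Re a))^-1 (fun s => (s + a^*)^-1).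
Proof.
move=> ha v hv; have := kpair_le ha hv.
have a0 : 0 < 2 * complex.Re a by rewrite mulr_gt0 // -rhpE.
rewrite addC_conj kform_vnorm // nmE -rmorphXn -rmorphM lecR => h.
rewrite -(ler_pXn2r (ltn0Sn 1)) ?nnegrE ?nm_ge0 //; last first.
  by rewrite mulr_ge0 ?vnorm_ge0 // invr_ge0 sqrtr_ge0.
by rewrite exprMn exprVn sqr_sqrtr ?(ltW a0) // mulrC ler_pdivlMr.
Qed.

(** Multiplication by a Blaschke factor is a contraction because the rank one
    kernel of [blaschke_kernel] is positive. *)
Lemma hardy_mul_blaschke U A F a : rhp a -> (forall s, U s -> rhp s) -> 0 <= A ->
  hardy U A F -> hardy U A (fun s => blaschke a s * F s).
Proof.
move=> ha hU A0 hF v hv; rewrite -pairing_reweight.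
have hv' : {in v, forall p, rhp p.2} by move=> p /hv /hU.
have hw : {in reweight (blaschke a) v, forall p, U p.2}.
  by move=> p /mapP[q /hv hq ->].
apply: (le_trans (hF _ hw)); apply: ler_wpM2l => //; apply: vnorm_le => //.
  by move=> p /hw /hU.
exact: kform_blaschke_le.
Qed.

Lemma blaschke_neq0 a s : rhp a -> rhp s -> s != a -> blaschke a s != 0.
Proof. by move=> ha hs sa; rewrite mulf_neq0 ?subr_eq0 // invr_eq0 rhp_neq0. Qed.

Lemma reweight_comp (g h : C -> C) v :
  reweight g (reweight h v) = reweight (fun s => h s * g s) v.
Proof. by rewrite /reweight -map_comp; apply: eq_map => p /=; rewrite mulrA. Qed.

(** Since F a = 0, the point a can be added to a family without changing the
    pairing; with the coefficient of [kform_cons_opt], the Gram form of the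
    enlarged family is that of the family reweighted by the Blaschke factor. The
    quotient is not controlled at a itself, where its value is a junk one. *)
Lemma hardy_div_blaschke U A F a : rhp a -> (forall s, U s -> rhp s) ->
  U a -> F a = 0 -> hardy U A F ->
  hardy (fun s => U s /\ s != a) A (fun s => F s / blaschke a s).
Proof.
move=> ha hU Ua Fa hF v hv.
pose w := reweight (fun s => (blaschke a s)^-1) v.
have hw : {in w, forall p, U p.2} by move=> p /mapP[q /hv [hq _] ->].
have hw' : {in w, forall p, rhp p.2} by move=> p /hw /hU.
pose d := - (kpair a w * (a + a^*)).
have := hF ((d, a) :: w); rewrite /vnorm kform_cons_opt // {2}/w reweight_comp.
have -> : reweight (fun s => (blaschke a s)^-1 * blaschke a s) v = v.
  rewrite /reweight -[RHS]map_id; apply/eq_in_map => p /hv[/hU hp pa].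
  by rewrite mulVf ?mulr1 ?blaschke_neq0 // -surjective_pairing.
have -> : pairing F ((d, a) :: w) = pairing (fun s => F s / blaschke a s) v.
  rewrite /pairing big_cons /= Fa mulr0 add0r big_map; apply: eq_bigr => p _ /=.
  by rewrite -mulrA [_^-1 * _]mulrC.
apply=> p; rewrite in_cons => /orP[/eqP -> //|]; exact: hw.
Qed.

Lemma hardy_div_prod A F (zs : seq C) U : (forall s, U s -> rhp s) ->
  uniq zs -> {in zs, forall z, U z} -> {in zs, forall z, F z = 0} ->
  hardy U A F ->
  hardy (fun s => U s /\ s \notin zs) A (fun s => F s / \prod_(z <- zs) blaschke z s).
Proof.
elim: zs F U => [|a zs IH] F U hU /=.
  move=> _ _ _ hF; apply: (@eq_hardy _ _ F) => [s _|].
    by rewrite big_nil divr1.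
  by apply: hardy_sub hF => s [].
move=> /andP[azs uzs] hz hF0 hF.
have Ua : U a by apply: hz; rewrite mem_head.
have ha := hU _ Ua.
have hF1 := hardy_div_blaschke ha hU Ua (hF0 _ (mem_head _ _)) hF.
have := IH (fun s => F s / blaschke a s) (fun s => U s /\ s != a).
have H1 : {in zs, forall z, U z /\ z != a}.
  move=> z zzs; split; first by apply: hz; rewrite in_cons zzs orbT.
  by apply: contraNneq azs => <-.
have H2 : {in zs, forall z, F z / blaschke a z = 0}.
  by move=> z zzs; rewrite hF0 ?mul0r // in_cons zzs orbT.
move=> /(_ (fun s Hs => hU s Hs.1) uzs H1 H2 hF1) H.
apply: (@eq_hardy _ _ (fun s => F s / blaschke a s / \prod_(z <- zs) blaschke z s)).
  by move=> s _; rewrite big_cons -[LHS]mulrA -[X in _ * X = _]invfM.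
by apply: hardy_sub H => s [Us]; rewrite in_cons negb_or => /andP[].
Qed.

Lemma hardy_eval U A F (p : C) : rhp p -> U p -> hardy U A F ->
  nm (F p) <= A / Num.sqrt (2 * complex.Re p).
Proof.
move=> hp Up /(_ [:: (1, p)]); rewrite /pairing big_seq1 mul1r.
have -> : vnorm [:: (1, p)] = (Num.sqrt (2 * complex.Re p))^-1.
  rewrite /vnorm /kform !big_seq1 /= rmorph1 mulr1 addC_conj mul1r -fmorphV /=.
  by rewrite sqrtrV // mulr_ge0 // ltW // -rhpE.
by apply=> q; rewrite inE => /eqP ->.
Qed.

(** The quotient of F by the Blaschke factors of its zeros has no larger norm,
    and point evaluation at p has norm 1 / sqrt (2 Re p). *)
Lemma hardy_zeros_bound A F (zs : seq C) (p : C) : uniq zs -> {in zs, forall z, rhp z} ->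
  {in zs, forall z, F z = 0} -> hardy (fun s => rhp s) A F -> rhp p ->
  nm (F p) <= A / Num.sqrt (2 * complex.Re p) * \prod_(z <- zs) nm (blaschke z p).
Proof.
move=> uzs hz hF0 hF hp; case: (boolP (p \in zs)) => [pz|pz].
  have b0 : blaschke p p = 0 by rewrite /blaschke subrr mul0r.
  rewrite hF0 // Normc.normc0 (perm_big _ (perm_to_rem pz)) /= big_cons b0.
  by rewrite Normc.normc0 mul0r mulr0.
have H := hardy_div_prod (fun s => id) uzs hz hF0 hF.
have := hardy_eval hp (conj hp pz) H.
rewrite Normc.normcM Normc.normcV ler_pdivrMr ?nm_prod //.
rewrite -nm_prod nm_gt0 prodf_seq_neq0; apply/allP => z zz /=.
apply: blaschke_neq0 => //; first exact: hz.
by apply: contraNneq pz => ->.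
Qed.

End Hardy.

(** * The complex exponential *)

Section ComplexExponential.
Variable R : realType.
Implicit Types (z w : R[i]) (t : R).
Local Notation nm := (@Normc.normc R).

Lemma cexpE (a b : R) : cexp (Complex a b) = Complex (expR a * cos b) (expR a * sin b).
Proof. by rewrite /cexp /=; apply/eqP; rewrite eq_complex /= !mul0r subr0 addr0 !eqxx. Qed.

Lemma cexp0 : cexp 0 = 1 :> R[i].
Proof. by rewrite -[0]/(Complex 0 0) cexpE expR0 cos0 sin0 mulr1 mulr0. Qed.

Lemma cexpD z w : cexp (z + w) = cexp z * cexp w.
Proof.
case: z w => a b [c d]; rewrite -[Complex a b + Complex c d]/(Complex (a + c) (b + d)).
rewrite !cexpE expRD cosD sinD.
by apply/eqP; rewrite eq_complex /=; apply/andP; split; apply/eqP; ring.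
Qed.

Lemma nm_cexp z : nm (cexp z) = expR (complex.Re z).
Proof.
case: z => a b; rewrite cexpE /= !exprMn -mulrDr cos2Dsin2 mulr1 sqrtr_sqr.
by rewrite ger0_norm // expR_ge0.
Qed.

Lemma cexp_neq0 z : cexp z != 0.
Proof. by rewrite -nm_gt0 nm_cexp expR_gt0. Qed.

Lemma cexp_conj z : (cexp z)^* = cexp z^*.
Proof.
case: z => a b; rewrite -[(Complex a b)^*]/(Complex a (- b)) !cexpE cosN sinN mulrN.
by [].
Qed.

Lemma cexp_real t : cexp t%:C%C = (expR t)%:C%C.
Proof. by rewrite -[t%:C%C]/(Complex t 0) cexpE cos0 sin0 mulr1 mulr0. Qed.

Lemma is_derive_Re_cexp w z (e b t : R) :
  is_derive t 1 (fun t => complex.Re (w * cexp (z * (e * t + b)%:C%C)))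
    (complex.Re (e%:C%C * (z * w) * cexp (z * (e * t + b)%:C%C))).
Proof.
case: w z => u v [x y].
have E s : complex.Re (Complex u v * cexp (Complex x y * (e * s + b)%:C%C)) =
   expR (x * (e * s + b)) * (u * cos (y * (e * s + b)) - v * sin (y * (e * s + b))).
  rewrite (_ : Complex x y * _ = Complex (x * (e * s + b)) (y * (e * s + b))).
    by rewrite cexpE /=; ring.
  by apply/eqP; rewrite eq_complex /=; apply/andP; split; apply/eqP; ring.
under eq_fun do rewrite E.
apply: is_derive_eq.
rewrite (_ : Complex x y * (e * t + b)%:C%C = Complex (x * (e * t + b)) (y * (e * t + b))); last first.
  by apply/eqP; rewrite eq_complex /=; apply/andP; split; apply/eqP; ring.
rewrite cexpE /= /GRing.scale /=; ring.
Qed.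

End ComplexExponential.

(** * Exponential sums and their energy *)

Section Energy.
Variable R : realType.
Local Notation C := R[i].
Local Notation nm := (@Normc.normc R).
Local Notation mu := (@lebesgue_measure R).
Implicit Types (v : seq (C * C)) (s u z : C) (t h : R).

Definition expsum v t : C := \sum_(p <- v) p.1 * cexp (- (p.2 * t%:C%C)).

(** The action on families dual to the multiplication of functions by exp(- t
    s). *)
Definition shiftw t v := reweight (fun s => cexp (- (s * t%:C%C))) v.

Lemma rhp_shiftw t v : {in v, forall p, rhp p.2} -> {in shiftw t v, forall p, rhp p.2}.
Proof. by move=> h p /mapP[q /h hq ->]. Qed.

Lemma kform_shiftw t v : kform (shiftw t v) =
  \sum_(p <- v) \sum_(q <- v)
     (p.1 * (q.1)^* / (p.2 + (q.2)^*)) * cexp (- (p.2 + (q.2)^*) * t%:C%C).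
Proof.
rewrite /kform /shiftw /reweight big_map; apply: eq_bigr => p _.
rewrite big_map; apply: eq_bigr => q _ /=.
rewrite mulNr mulrDl opprD cexpD rmorphM /= cexp_conj rmorphN rmorphM /=.
have -> : (t%:C%C)^* = t%:C%C by apply: conjc_real.
ring.
Qed.

Lemma Re_sum (I : Type) (r : seq I) (f : I -> C) :
  complex.Re (\sum_(i <- r) f i) = \sum_(i <- r) complex.Re (f i).
Proof. by elim/big_rec2 : _ => // i x [a b] _ <-; case: (f i). Qed.

Lemma is_derive_sum_seq (I : Type) (r : seq I) (f : I -> R -> R) (df : I -> R) t :
  (forall i, is_derive t 1 (f i) (df i)) ->
  is_derive t 1 (fun t => \sum_(i <- r) f i t) (\sum_(i <- r) df i).
Proof.
move=> H; elim: r => [|i r IH].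
  rewrite big_nil; under eq_fun do rewrite big_nil; exact: is_derive_cst.
rewrite big_cons; under eq_fun do rewrite big_cons.
exact: is_deriveD.
Qed.

Lemma nm_sqrC z : (nm z ^+ 2)%:C%C = z * z^*.
Proof. by rewrite rmorphXn /= -nmE normCK. Qed.

(** The Gram form of v is the integral over t >= 0 of |expsum v t|^2, and shiftw
    t v has for Gram form the part of this integral beyond t. Differentiating in
    t states this without improper integrals. *)
Lemma is_derive_kform v (e b t : R) : {in v, forall p, rhp p.2} ->
  is_derive t 1 (fun t => complex.Re (kform (shiftw (e * t + b) v)))
     (- (e * nm (expsum v (e * t + b)) ^+ 2)).
Proof.
move=> hv; under eq_fun do rewrite kform_shiftw Re_sum.
under eq_fun do under eq_bigr do rewrite Re_sum.
apply: is_derive_eq; first apply: is_derive_sum_seq => p.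
  apply: is_derive_sum_seq => q; apply: is_derive_Re_cexp.
rewrite -(mulrN e).
under eq_bigr do rewrite -Re_sum.
rewrite -Re_sum -[RHS]/(complex.Re (e * - nm (expsum v (e * t + b)) ^+ 2)%:C%C).
congr complex.Re; rewrite rmorphM rmorphN /= nm_sqrC /expsum rmorph_sum /= mulr_suml.
rewrite -sumrN mulr_sumr big_seq [RHS]big_seq; apply: eq_bigr => p /hv hp.
rewrite mulr_sumr -sumrN mulr_sumr big_seq [RHS]big_seq; apply: eq_bigr => q /hv hq.
rewrite rmorphM /= cexp_conj rmorphN rmorphM /=.
have -> : ((e * t + b)%:C%C)^* = (e * t + b)%:C%C by apply: conjc_real.
set X := (e * t + b)%:C%C.
have -> : cexp (- (p.2 + (q.2)^*) * X) = cexp (- (p.2 * X)) * cexp (- ((q.2)^* * X)).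
  by rewrite -cexpD; congr cexp; ring.
have pq := rhp_neq0 hp hq.
by field.
Qed.

Lemma kform_shiftw0 v : kform (shiftw 0 v) = kform v.
Proof.
rewrite /shiftw /reweight; congr kform; rewrite -[RHS]map_id; apply: eq_map => p.
by rewrite mulr0 oppr0 cexp0 mulr1 -surjective_pairing.
Qed.

Lemma derivable_continuous (f : R -> R) (df : R -> R) :
  (forall t : R, is_derive t 1 f (df t)) -> continuous f.
Proof.
by move=> H t; apply/differentiable_continuous/derivable1_diffP; case: (H t).
Qed.

(** By [is_derive_kform] the form decreases in t. *)
Lemma vnorm_shiftw v t : {in v, forall p, rhp p.2} -> 0 <= t ->
  vnorm (shiftw t v) <= vnorm v.
Proof.
move=> hv t0; apply: vnorm_le => //; first exact: rhp_shiftw.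
pose f t := complex.Re (kform (shiftw (1 * t + 0) v)).
have df x : is_derive x (1 : R) f (- (1 * nm (expsum v (1 * x + 0)) ^+ 2)).
  exact: is_derive_kform.
have h : f t <= f 0.
  apply: (@ler0_derive1_nincry _ f 0) => //.
  - move=> x _; rewrite derive1E; case: (df x) => _ ->.
    by rewrite mul1r oppr_le0 sqr_ge0.
  - by apply: continuous_subspaceT; exact: derivable_continuous df.
have E x : (f x)%:C%C = kform (shiftw x v).
  rewrite /f mul1r addr0 -[RHS]RRe_real // ger0_real // kform_ge0 //.
  exact: rhp_shiftw.
by rewrite -(kform_shiftw0 v) -!E lecR.
Qed.

Lemma continuous_expsum_sqr v (e b : R) :
  continuous (fun t => nm (expsum v (e * t + b)) ^+ 2).
Proof.
pose w t := \sum_(p <- v) \sum_(q <- v)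
  complex.Re ((p.1 * (q.1)^*) * cexp (- (p.2 + (q.2)^*) * (e * t + b)%:C%C)).
have -> : (fun t => nm (expsum v (e * t + b)) ^+ 2) = w.
  apply/funext => t; rewrite -[LHS]/(complex.Re (_%:C%C)) nm_sqrC /w.
  under eq_bigr do rewrite -Re_sum.
  rewrite -Re_sum; congr complex.Re; rewrite /expsum rmorph_sum mulr_suml.
  apply: eq_bigr => p _; rewrite mulr_sumr; apply: eq_bigr => q _.
  rewrite rmorphM /= cexp_conj rmorphN rmorphM /=.
  have -> : ((e * t + b)%:C%C)^* = (e * t + b)%:C%C by apply: conjc_real.
  set X := (e * t + b)%:C%C.
  have -> : cexp (- (p.2 + (q.2)^*) * X) = cexp (- (p.2 * X)) * cexp (- ((q.2)^* * X)).
    by rewrite -cexpD; congr cexp; ring.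
  ring.
apply: derivable_continuous => t.
apply: is_derive_sum_seq => p; apply: is_derive_sum_seq => q.
exact: is_derive_Re_cexp.
Qed.

(** Integration of [is_derive_kform]. The condition on e leaves e = 1 and e =
    -1, so the segment may also be run through backwards. *)
Lemma energy_bound v (e x d b : R) : 0 < d -> e ^+ 2 = 1 ->
  {in v, forall p, rhp p.2} ->
  0 <= e * x + b -> 0 <= e * (x + d) + b ->
  \int[mu]_(t in `[x, x + d]) (nm (expsum v (e * t + b)) ^+ 2) <= vnorm v ^+ 2.
Proof.
move=> d0 e1 hv h1 h2; pose f t := complex.Re (kform (shiftw (e * t + b) v)).
have df := is_derive_kform e b _ hv.
have dF t : is_derive t (1 : R) (fun t => - e * f t) (nm (expsum v (e * t + b)) ^+ 2).
  have H := is_deriveZ (- e) (df t).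
  apply: (is_derive_eq H).
  by rewrite /GRing.scale /= mulrNN mulrA -expr2 e1 mul1r.
have cF := derivable_continuous dF.
have vE t : 0 <= e * t + b -> f t <= vnorm v ^+ 2 /\ 0 <= f t.
  move=> t0; have H := @rhp_shiftw (e * t + b) v hv.
  have E : f t = vnorm (shiftw (e * t + b) v) ^+ 2 by rewrite /f kform_vnorm.
  rewrite E sqr_ge0; split => //.
  by rewrite ler_pXn2r ?nnegrE ?vnorm_ge0 // vnorm_shiftw.
rewrite /Rintegral (@continuous_FTC2 _ _ (fun t => - e * f t)).
- rewrite -EFinB /= -mulrBr.
  have [f1 f10] := vE _ h1; have [f2 f20] := vE _ h2.
  move: e1 f1 f10 f2 f20 => /eqP; rewrite sqrf_eq1.
  move: (f x) (f (x + d)) (vnorm v ^+ 2) => y1 y2 y3.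
  by case/orP => /eqP ->; rewrite ?opprK ?mul1r ?mulN1r => *; lra.
- by rewrite ltrDl.
- by apply: continuous_subspaceT; exact: continuous_expsum_sqr.
- split.
  + by move=> t _; case: (dF t).
  + by apply: cvg_at_right_filter; exact: cF.
  + by apply: cvg_at_left_filter; exact: cF.
- by move=> t _; rewrite derive1E; case: (dF t) => _ ->.
Qed.

End Energy.

(** * Functions of exponential type *)

Section PaleyWiener.
Variable R : realType.
Local Notation C := R[i].
Local Notation nm := (@Normc.normc R).
Local Notation mu := (@lebesgue_measure R).
Implicit Types (v : seq (C * C)) (s u z : C) (t h w d : R) (F G f g : C -> C).

Lemma vnormZ (k : C) v : {in v, forall p, rhp p.2} ->
  vnorm (reweight (fun=> k) v) = nm k * vnorm v.
Proof.
move=> hv; have E : kform (reweight (fun=> k) v) = (nm k ^+ 2 * vnorm v ^+ 2)%:C%C.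
  rewrite rmorphM /= -kform_vnorm // nm_sqrC /kform /reweight big_map mulr_sumr.
  apply: eq_bigr => p _; rewrite big_map mulr_sumr; apply: eq_bigr => q _ /=.
  by rewrite rmorphM /=; ring.
by rewrite {1}/vnorm E /= -exprMn sqrtr_sqr ger0_norm // mulr_ge0 ?nm_ge0 ?vnorm_ge0.
Qed.

(** The Paley-Wiener class of type w, without holomorphy: moving the half-plane
    by h to the left costs at most a factor exp(w h). *)
Definition pw w F := exists A : R, 0 <= A /\ forall h, 0 <= h ->
  hardy (fun u => rhp u) (A * expR (w * h)) (fun u => F (u - h%:C%C)).

(** The transforms of square integrable densities on a segment of length d,
    brought to [0, d] by t |-> e t + b: the last condition is the Cauchy-Schwarz
    inequality for such a transform, and stating it alone spares the density.
    Both signs of e occur because the reflection in the imaginary axis reverses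
    the segment. *)
Definition piece d f := exists A x e b : R, [/\ 0 <= A, e ^+ 2 = 1,
  forall t, x <= t -> t <= x + d -> 0 <= e * t + b <= d &
  forall v, nm (pairing f v) ^+ 2 <=
    A * \int[mu]_(t in `[x, x + d]) (nm (expsum v (e * t + b)) ^+ 2)].

Lemma integrable_expsum v (e b x y : R) :
  mu.-integrable `[x, y] (EFin \o (fun t => nm (expsum v (e * t + b)) ^+ 2)).
Proof.
apply: continuous_compact_integrable; first exact: segment_compact.
by apply: continuous_subspaceT; exact: continuous_expsum_sqr.
Qed.

Lemma integrable_cst_itv (k x y : R) : mu.-integrable `[x, y] (EFin \o (fun=> k)).
Proof.
apply: continuous_compact_integrable; first exact: segment_compact.
by apply: continuous_subspaceT; exact: cst_continuous.
Qed.

Definition unshift h v : seq (C * C) := [seq (p.1, p.2 - h%:C%C) | p <- v].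

Lemma pairing_unshift h F v :
  pairing (fun u => F (u - h%:C%C)) v = pairing F (unshift h v).
Proof. by rewrite /pairing big_map. Qed.

Lemma expsum_unshift h v t : expsum (unshift h v) t = (expR (h * t))%:C%C * expsum v t.
Proof.
rewrite /expsum big_map mulr_sumr; apply: eq_bigr => p _ /=.
have -> : - ((p.2 - h%:C%C) * t%:C%C) = (h * t)%:C%C + - (p.2 * t%:C%C).
  by rewrite rmorphM /=; ring.
by rewrite cexpD cexp_real; ring.
Qed.

Lemma Rintegral_le_cst (f : R -> R) (k x d : R) : 0 < d ->
  mu.-integrable `[x, x + d] (EFin \o f) ->
  (forall t, x <= t -> t <= x + d -> f t <= k) ->
  \int[mu]_(t in `[x, x + d]) f t <= k * d.
Proof.
move=> d0 intf h.
have -> : k * d = \int[mu]_(t in `[x, x + d]) (cst k t).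
  rewrite Rintegral_cst //= lebesgue_measure_itv /= lte_fin ltrDl d0.
  by rewrite -EFinD /= [x + d]addrC addrK.
apply: le_Rintegral => //; first exact: integrable_cst_itv.
by move=> t /=; rewrite in_itv /= => /andP[]; exact: h.
Qed.

Lemma expR_le_shift h t d : 0 <= h -> t <= d -> expR (h * t) <= expR (h * d).
Proof. by move=> h0 td; rewrite ler_expR ler_wpM2l. Qed.

Lemma piece_pw d f : 0 < d -> piece d f -> pw d f.
Proof.
move=> d0 [A [x [e [b [A0 e1 hb hf]]]]].
exists (Num.sqrt A); split; first exact: sqrtr_ge0.
move=> h h0 v hv; rewrite pairing_unshift.
rewrite -(ler_pXn2r (ltn0Sn 1)) ?nnegrE ?nm_ge0 //; last first.
  by rewrite !mulr_ge0 ?sqrtr_ge0 ?expR_ge0 ?vnorm_ge0.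
apply: (le_trans (hf _)); rewrite !exprMn sqr_sqrtr // -mulrA ler_wpM2l //.
apply: (@le_trans _ _ (expR (d * h) ^+ 2 *
   \int[mu]_(t in `[x, x + d]) (nm (expsum v (e * t + b)) ^+ 2))).
  rewrite -RintegralZl //; last exact: integrable_expsum.
  apply: le_Rintegral => //.
  - exact: integrable_expsum.
  - apply: continuous_compact_integrable; first exact: segment_compact.
    apply: continuous_subspaceT => t; apply: cvgM; first exact: cvg_cst.
    exact: continuous_expsum_sqr.
  - move=> t /=; rewrite in_itv /= => /andP[t1 t2].
    rewrite expsum_unshift Normc.normcM exprMn ler_wpM2r ?sqr_ge0 //.
    rewrite nm_real ger0_norm ?expR_ge0 // ler_pXn2r ?nnegrE ?expR_ge0 //.
    by rewrite mulrC [d * h]mulrC mulrC expR_le_shift //; case/andP: (hb _ t1 t2).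
rewrite ler_wpM2l ?sqr_ge0 // energy_bound //.
- by have /andP[] := hb x (lexx x) (ltW (ltr_pwDr d0 (lexx x))).
- by have /andP[] := hb (x + d) (ltW (ltr_pwDr d0 (lexx x))) (lexx _).
Qed.

Lemma reweight_cst_comp (k : C) (g : C -> C) v :
  reweight (fun s => k * g s) v = reweight (fun=> k) (reweight g v).
Proof. by rewrite reweight_comp; apply: eq_map => p; rewrite [k * _]mulrC. Qed.

(** In the integral that bounds the piece, g is paired at time t with a family
    shifted by exp(- t s), a contraction for t >= 0, and the translation by h
    costs exp(h t) <= exp(h d). Hence types add, although a product of two
    elements of the Hardy space need not belong to it. *)
Lemma pw_mul_piece w d f g : 0 < d -> pw w g -> piece d f ->
  pw (w + d) (fun s => f s * g s).
Proof.
move=> d0 [B [B0 hg]] [A [x [e [b [A0 e1 hb hf]]]]].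
exists (Num.sqrt (A * d) * B); split; first by rewrite mulr_ge0 ?sqrtr_ge0.
move=> h h0 v hv.
pose v' := [seq (p.1 * g (p.2 - h%:C%C), p.2 - h%:C%C) | p <- v].
have -> : pairing (fun u => f (u - h%:C%C) * g (u - h%:C%C)) v = pairing f v'.
  by rewrite /pairing big_map; apply: eq_bigr => p _ /=; ring.
have Ad : 0 <= A * d by rewrite mulr_ge0 // ltW.
rewrite -(ler_pXn2r (ltn0Sn 1)) ?nnegrE ?nm_ge0 //; last first.
  by rewrite !mulr_ge0 ?sqrtr_ge0 ?expR_ge0 ?vnorm_ge0.
apply: (le_trans (hf _)).
rewrite mulrDl expRD; set ew := expR (w * h); set ed := expR (d * h).
rewrite (_ : Num.sqrt (A * d) * B * (ew * ed) * vnorm v =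
  Num.sqrt (A * d) * (B * ew * (ed * vnorm v))); last by ring.
rewrite [leRHS]exprMn sqr_sqrtr // -[leRHS]mulrA ler_wpM2l // [leRHS]mulrC.
apply: Rintegral_le_cst => //; first exact: integrable_expsum.
move=> t t1 t2; rewrite ler_pXn2r ?nnegrE ?nm_ge0 //; last first.
  by rewrite !mulr_ge0 ?expR_ge0 ?vnorm_ge0.
set th := e * t + b.
have -> : expsum v' th = pairing (fun u => g (u - h%:C%C))
    (reweight (fun s => (expR (h * th))%:C%C * cexp (- (s * th%:C%C))) v).
  rewrite /expsum /pairing !big_map; apply: eq_bigr => p _ /=.
  rewrite -cexp_real -cexpD.
  have -> : (h * th)%:C%C + - (p.2 * th%:C%C) = - ((p.2 - h%:C%C) * th%:C%C).
    by rewrite rmorphM /=; ring.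
  by ring.
rewrite reweight_cst_comp -/(shiftw th v).
have hv1 := @rhp_shiftw _ th v hv.
have /andP[th0 thd] := hb _ t1 t2.
apply: (le_trans (hg h h0 _ _)).
  by move=> p /mapP[q /hv1 hq ->].
rewrite vnormZ // ler_wpM2l ?mulr_ge0 ?expR_ge0 // nm_real ger0_norm ?expR_ge0 //.
apply: ler_pM; rewrite ?expR_ge0 ?vnorm_ge0 //; last exact: vnorm_shiftw.
by rewrite /ed [d * h]mulrC expR_le_shift.
Qed.

Lemma pw_sum w (I : eqType) (r : seq I) (F : I -> C -> C) :
  {in r, forall i, pw w (F i)} -> pw w (fun s => \sum_(i <- r) F i s).
Proof.
elim: r => [_|i r IH h].
  exists 0; split => // h h0; rewrite mul0r.
  apply: (eq_hardy _ (@hardy0 _ _)) => s _; by rewrite big_nil.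
have [A [A0 hA]] := h i (mem_head _ _).
have [|B [B0 hB]] := IH; first by move=> j jr; apply: h; rewrite in_cons jr orbT.
exists (A + B); split; first exact: addr_ge0.
move=> t t0; rewrite mulrDl; apply: (eq_hardy _ (hardyD (hA t t0) (hB t t0))).
by move=> s _; rewrite big_cons.
Qed.

Lemma pwZ w k F : pw w F -> pw w (fun s => k * F s).
Proof.
move=> [A [A0 hA]]; exists (nm k * A); split; first by rewrite mulr_ge0 ?nm_ge0.
by move=> h h0; rewrite -mulrA; exact: hardyZ (hA h h0).
Qed.

Lemma eq_pw w F G : F =1 G -> pw w F -> pw w G.
Proof.
move=> FG [A [A0 hA]]; exists A; split => // h /hA H.
by apply: eq_hardy H => s _; rewrite FG.
Qed.

Lemma pw_prod_piece d n (f : 'I_n.+1 -> C -> C) : 0 < d ->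
  (forall i, piece d (f i)) -> pw (n.+1%:R * d) (fun s => \prod_i f i s).
Proof.
move=> d0; elim: n f => [|n IH] f hf.
  rewrite mul1r; apply: (@eq_pw _ (f ord0)) => [s|]; first by rewrite big_ord1.
  exact: piece_pw.
apply: (@eq_pw _ (fun s => f ord0 s * \prod_i f (lift ord0 i) s)) => [s|].
  by rewrite [RHS]big_ord_recl.
rewrite -[n.+2%:R]natr1 mulrDl mul1r; apply: pw_mul_piece => //.
exact: IH.
Qed.

Lemma pw_det d n (f : 'I_n.+1 -> 'I_n.+1 -> C -> C) : 0 < d ->
  (forall i j, piece d (f i j)) ->
  pw (n.+1%:R * d) (fun s => \det (\matrix_(i, j) f i j s)).
Proof.
move=> d0 hf; apply: pw_sum => sg _.
apply: pwZ; apply: (@eq_pw (n.+1%:R * d) (fun s => \prod_i f i (fun_of_perm sg i) s)).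
  by move=> s; apply: eq_bigr => i _; rewrite mxE.
by apply: pw_prod_piece.
Qed.

End PaleyWiener.

(** * Elementary estimates *)

Section Estimates.
Variable R : realType.
Local Notation C := R[i].
Local Notation nm := (@Normc.normc R).

Lemma mean_value_0 (f df : R -> R) (y : R) : (forall t : R, is_derive t 1 f (df t)) ->
  exists2 c : R, `|c| <= `|y| & f y - f 0 = df c * y.
Proof.
move=> H; have cf := derivable_continuous H.
have [y0|y0] := leP 0 y.
  have [c + E] := @MVT_segment _ f df 0 y y0 (fun x _ => H x) (continuous_subspaceT cf).
  rewrite in_itv /= => /andP[c0 cy]; exists c; first by rewrite !ger0_norm.
  by rewrite E subr0.
have [c + E] := @MVT_segment _ f df y 0 (ltW y0) (fun x _ => H x) (continuous_subspaceT cf).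
rewrite in_itv /= => /andP[c0 cy]; exists c.
  by rewrite !ler0_norm ?lerN2 // ltW.
by apply: oppr_inj; rewrite opprB E; ring.
Qed.

Lemma abs_sin_le (y : R) : `|sin y| <= `|y|.
Proof.
have [c _] := @mean_value_0 sin cos y (fun t => is_derive_sin t).
by rewrite sin0 subr0 => ->; rewrite normrM ler_piMl // cos_max.
Qed.

Lemma cos_half (y : R) : 1 - cos y = 2 * sin (y / 2) ^+ 2.
Proof.
have {1}-> : y = y / 2 + y / 2 by field.
by rewrite cosD -!expr2; have := cos2Dsin2 (y / 2); lra.
Qed.

Lemma one_sub_cos_ge0 (y : R) : 0 <= 1 - cos y.
Proof. by rewrite subr_ge0 cos_le1. Qed.

Lemma one_sub_cos_le_sqr (y : R) : 1 - cos y <= y ^+ 2.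
Proof.
rewrite cos_half -(real_normK (num_real (sin _))).
have h := abs_sin_le (y / 2).
apply: (@le_trans _ _ (2 * `|y / 2| ^+ 2)).
  by rewrite ler_wpM2l // ler_pXn2r ?nnegrE.
by rewrite real_normK ?num_real // expr_div_n; have := sqr_ge0 y; lra.
Qed.

Lemma one_sub_cos_le_abs (y : R) : 1 - cos y <= `|y|.
Proof.
rewrite cos_half -(real_normK (num_real (sin _))).
have h := abs_sin_le (y / 2); have h1 := sin_max (y / 2).
apply: (@le_trans _ _ (2 * `|y / 2|)).
  by rewrite ler_wpM2l // expr2 (le_trans _ h) // ler_piMl.
by rewrite normrM [`|2^-1|]ger0_norm //; lra.
Qed.

Lemma abs_sub_sin_le (y : R) : `|y - sin y| <= y ^+ 2.
Proof.
have H t : is_derive t (1 : R) (fun t => t - sin t) (1 - cos t).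
  exact: is_deriveB.
have [c cy] := mean_value_0 y H; rewrite sin0 !subr0 => ->.
rewrite normrM -(real_normK (num_real y)) expr2 ler_wpM2r //.
rewrite ger0_norm ?one_sub_cos_ge0 //.
exact: le_trans (one_sub_cos_le_abs c) cy.
Qed.

Lemma expRN_quad (x : R) : 0 <= x -> 0 <= expR (- x) - 1 + x <= x ^+ 2.
Proof.
move=> x0; apply/andP; split; first by have := expR_ge1Dx (- x); lra.
have h := expR_ge1Dx x; have h0 : 0 < 1 + x by lra.
have : expR (- x) <= (1 + x)^-1 by rewrite expRN lef_pV2 // posrE expR_gt0.
move=> e; apply: (@le_trans _ _ ((1 + x)^-1 - 1 + x)); first by rewrite lerD2r lerD2r.
have -> : (1 + x)^-1 - 1 + x = x ^+ 2 / (1 + x) by field; lra.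
by rewrite ler_piMr ?sqr_ge0 // invf_le1 //; lra.
Qed.

Lemma cexp_quad (z : C) : 0 <= complex.Re z -> nm (cexp (- z) - 1 + z) <= 3 * nm z ^+ 2.
Proof.
rewrite nm_sqr; case: z => x y.
rewrite [complex.Re _]/= [complex.Im _]/= => x0.
have -> : - (Complex x y : C) = Complex (- x) (- y) by [].
rewrite cexpE cosN sinN.
have -> : Complex (expR (- x) * cos y) (expR (- x) * - sin y) - 1 + Complex x y =
  Complex ((expR (- x) - 1 + x) - expR (- x) * (1 - cos y))
          ((y - sin y) + (1 - expR (- x)) * sin y).
  by apply/eqP; rewrite eq_complex /=; apply/andP; split; apply/eqP; ring.
apply: (le_trans (nm_le_ReIm _)) => /=.
have /andP[a0 a1] := expRN_quad x0.
have e0 := expR_ge0 (- x).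
have e1 : expR (- x) <= 1 by rewrite expR_le1 oppr_le0.
have c0 := one_sub_cos_ge0 y; have c1 := one_sub_cos_le_sqr y.
have s0 := abs_sub_sin_le y; have s1 := abs_sin_le y.
have h1 : `|expR (- x) - 1 + x - expR (- x) * (1 - cos y)| <= x ^+ 2 + y ^+ 2.
  apply: (le_trans (ler_normB _ _)); rewrite ger0_norm // lerD //.
  by rewrite normrM !ger0_norm // (le_trans _ c1) // ler_piMl.
have h2 : `|(y - sin y) + (1 - expR (- x)) * sin y| <= y ^+ 2 + x * `|y|.
  apply: (le_trans (ler_normD _ _)); rewrite lerD // normrM ler_pM //.
  by rewrite ger0_norm; lra.
apply: (le_trans (lerD h1 h2)).
have : 2 * (x * `|y|) <= x ^+ 2 + y ^+ 2.
  rewrite -[in leRHS](real_normK (num_real y)).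
  by have := sqr_ge0 (x - `|y|); rewrite sqrrB; lra.
by have := sqr_ge0 x; have := sqr_ge0 y; lra.
Qed.

Lemma nm_blaschke_le1 (a u : C) : rhp a -> rhp u -> nm (blaschke a u) <= 1.
Proof.
move=> ha hu; have ua := rhp_neq0 hu ha.
rewrite Normc.normcM Normc.normcV ler_pdivrMr ?nm_gt0 // mul1r.
rewrite -(ler_pXn2r (ltn0Sn 1)) ?nnegrE ?nm_ge0 // !nm_sqr.
move: ha hu; rewrite !rhpE; case: (a) (u) => [a1 a2] [u1 u2] /= ha hu.
have -> : (u1 - a1) ^+ 2 + (u2 - a2) ^+ 2 =
  (u1 + a1) ^+ 2 + (u2 + - a2) ^+ 2 - 4 * (a1 * u1) by ring.
by rewrite lerBlDr lerDl mulr_ge0 // mulr_ge0 // ltW.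
Qed.

Lemma prod_sub_le (I : eqType) (r : seq I) (f g : I -> C) :
  {in r, forall i, nm (f i) <= 1} -> {in r, forall i, nm (g i) <= 1} ->
  nm (\prod_(i <- r) f i - \prod_(i <- r) g i) <= \sum_(i <- r) nm (f i - g i).
Proof.
elim: r => [|i r IH] hf hg; first by rewrite !big_nil subrr Normc.normc0.
rewrite !big_cons.
have -> : f i * \prod_(j <- r) f j - g i * \prod_(j <- r) g j =
  f i * (\prod_(j <- r) f j - \prod_(j <- r) g j) + (f i - g i) * \prod_(j <- r) g j.
  by ring.
apply: (le_trans (nmD _ _)); rewrite addrC !Normc.normcM; apply: lerD.
  rewrite ler_piMr ?nm_ge0 // nm_prod big_seq; apply: prodr_ile1 => j jr.
  by rewrite nm_ge0 /= hg // in_cons jr orbT.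
apply: (@le_trans _ _ (nm (\prod_(j <- r) f j - \prod_(j <- r) g j))).
  by rewrite ler_piMl ?nm_ge0 // hf // mem_head.
by apply: IH => j jr; [apply: hf | apply: hg]; rewrite in_cons jr orbT.
Qed.

(** Seen from afar a Blaschke factor is a unimodular constant times an
    exponential: its value at 0 is - a / conj a and its logarithmic derivative
    there is - 2 Re a / |a|^2. *)
Lemma blaschke_cexp (a u : C) (rho : R) : rhp a -> rhp u ->
  0 < rho -> rho <= complex.Re a ->
  nm (blaschke a u - (- (a / a^*)) * cexp (- ((2 * complex.Re a / nm a ^+ 2)%:C%C * u)))
   <= 14 * nm u ^+ 2 / rho ^+ 2.
Proof.
move=> ha hu rho0 rhoa.
have nma : rho <= nm a.
  by apply: (le_trans rhoa); apply: le_trans (Re_le_nm a); exact: ler_norm.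
have a0 : a != 0 by rewrite -nm_gt0 (lt_le_trans rho0).
have ac0 : a^* != 0 by rewrite conjC_eq0.
have uac := rhp_neq0 hu ha.
set g : R := 2 * complex.Re a / nm a ^+ 2.
have gE : g%:C%C = (a + a^*) / (a * a^*).
  by rewrite /g rmorphM fmorphV /= nm_sqrC addC_conj.
have om : nm (- (a / a^*)) = 1.
  by rewrite nmN Normc.normcM Normc.normcV nm_conj divff // gt_eqF // nm_gt0.
have g0 : 0 <= g by rewrite /g divr_ge0 ?sqr_ge0 // mulr_ge0 // ltW // -rhpE.
have g1 : g <= 2 / rho.
  rewrite /g ler_pdivrMr ?exprn_gt0 ?(lt_le_trans rho0) //.
  have := Re_le_nm a; move/(le_trans (ler_norm _)) => h.
  apply: (@le_trans _ _ (2 / rho * (rho * nm a))).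
    by rewrite mulrA divfK ?gt_eqF // ler_wpM2l.
  by rewrite expr2 ler_wpM2l ?divr_ge0 ?(ltW rho0) // ler_wpM2r ?nm_ge0.
have nu : rho <= nm (u + a^*).
  apply: le_trans (Re_le_nm _); apply: le_trans (ler_norm _); move: rhoa hu; rewrite rhpE.
  by case: (a) (u) => [a1 a2] [u1 u2] /=; lra.
pose t := u ^+ 2 * (a + a^*) / (a * a^* * (u + a^*)).
have -> : blaschke a u - - (a / a^*) * cexp (- (g%:C%C * u)) =
   - (a / a^*) * (t - (cexp (- (g%:C%C * u)) - 1 + g%:C%C * u)).
  by rewrite gE /blaschke /t; set E := cexp _; field; rewrite a0 ac0 uac.
rewrite Normc.normcM om mul1r; apply: (le_trans (nmB _ _)).
have -> : 14 * nm u ^+ 2 / rho ^+ 2 = 2 * nm u ^+ 2 / rho ^+ 2 + 12 * nm u ^+ 2 / rho ^+ 2.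
  by field; rewrite gt_eqF.
apply: lerD.
  have -> : t = u ^+ 2 * g%:C%C / (u + a^*).
    by rewrite /t gE; field; rewrite a0 ac0 uac.
  rewrite !Normc.normcM Normc.normcV nm_real ger0_norm // -expr2.
  have -> : 2 * nm u ^+ 2 / rho ^+ 2 = nm u ^+ 2 * (2 / rho) / rho.
    by field; rewrite gt_eqF.
  apply: ler_pM.
  - by rewrite mulr_ge0 // sqr_ge0.
  - by rewrite invr_ge0 nm_ge0.
  - by rewrite ler_wpM2l ?sqr_ge0.
  by rewrite lef_pV2 ?posrE // (lt_le_trans rho0).
apply: (le_trans (cexp_quad _)).
  case: (u) hu => u1 u2; rewrite rhpE /= => hu; rewrite mul0r subr0 mulr_ge0 //.
  exact: ltW.
rewrite Normc.normcM nm_real ger0_norm // exprMn.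
have -> : 12 * nm u ^+ 2 / rho ^+ 2 = 3 * ((2 / rho) ^+ 2 * nm u ^+ 2).
  by field; rewrite gt_eqF.
rewrite ler_wpM2l // ler_wpM2r ?sqr_ge0 // ler_pXn2r ?nnegrE //.
by rewrite divr_ge0 // ltW.
Qed.

Lemma pow_fact_le (M : R) n : 0 <= M ->
  \prod_(0 <= j < n) (M / j.+1%:R) <= expR M.
Proof.
move=> M0; case: n => [|n]; first by rewrite big_nil (le_trans _ (expR_ge1Dx _)) // lerDl.
apply: le_trans (expR_ge1Dxn n M0); apply: ler_wpDl => //.
rewrite le_eqVlt; apply/orP; left; apply/eqP.
elim: n => [|n IH]; first by rewrite big_nat1.
rewrite big_nat_recr //= IH [in RHS]exprSr [in RHS]factS [in RHS]natrM.
by rewrite mulrACA -invfM [_%:R * _%:R]mulrC.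
Qed.

(** The distances from the k-th of m equally spaced nodes to the others are, in
    units of the step, the integers 1, ..., k and 1, ..., m - k - 1; by
    [pow_fact_le] the product of the m / j over each of these ranges is at most
    exp m. *)
Lemma prod_dist_le (m k : nat) (f : nat -> R) (rho : R) : 0 < rho ->
  (k < m)%N -> (forall l, (l < m)%N -> l != k ->
     0 <= f l <= m%:R / (rho * `|(k%:R - l%:R)|)) -> rho <= 1 ->
  \prod_(0 <= l < m | l != k) f l <= (expR m%:R ^+ 2) / rho ^+ m.
Proof.
move=> rho0 km hf rho1.
pose g l := (m%:R : R) / `|k%:R - l%:R|.
have M0 : 0 <= m%:R :> R by [].
have h1 : \prod_(0 <= l < m | l != k) f l <= \prod_(0 <= l < m | l != k) (g l / rho).
  rewrite big_nat_cond [leRHS]big_nat_cond; apply: ler_prod => l /andP[/andP[_ lm] lk].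
  have := hf l lm lk; rewrite /g invfM; move=> /andP[-> h] /=.
  by rewrite (le_trans h) // mulrA mulrAC.
apply: (le_trans h1); rewrite big_split /=; apply: ler_pM.
- by apply: prodr_ge0 => l _; rewrite /g divr_ge0.
- by apply: prodr_ge0 => l _; rewrite invr_ge0 ltW.
- rewrite (@big_cat_nat _ _ _ k 0%N m) //=; last exact: ltnW.
  rewrite [X in _ * X]big_ltn_cond // eqxx /= expr2.
  apply: ler_pM; try by apply: prodr_ge0 => l _; rewrite /g divr_ge0.
    apply: le_trans (pow_fact_le k M0).
    rewrite le_eqVlt; apply/orP; left; apply/eqP.
    rewrite big_nat_rev /= add0n big_nat_cond [RHS]big_nat_cond.
    apply: eq_big => l.
      by rewrite andbT; case: ltnP => //= lk; lia.
    case/andP => /andP[_ lk] _; rewrite /g; congr (_ / _).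
    rewrite -natrB; last by lia.
    by rewrite ger0_norm //; congr (_%:R); lia.
  apply: le_trans (pow_fact_le (m - k.+1) M0).
  rewrite le_eqVlt; apply/orP; left; apply/eqP.
  rewrite -{1}[k.+1]add0n big_addn big_nat_cond [RHS]big_nat_cond.
  apply: eq_big => l.
    by rewrite andbT; case: ltnP => //= lk; lia.
  case/andP => /andP[_ lk] _; rewrite /g; congr (_ / _).
  rewrite distrC -natrB; last by lia.
  by rewrite ger0_norm //; congr (_%:R); lia.
- rewrite -exprVn -[m in X in _ <= X]subn0 -prodr_const_nat.
  rewrite [leRHS](bigID (fun l => l != k)) /=.
  have hV : 1 <= rho^-1 by rewrite invf_ge1.
  rewrite ler_peMr //; first by apply: prodr_ge0 => l _; rewrite invr_ge0 ltW.
  by elim/big_ind : _ => // x y x1 y1; rewrite mulr_ege1.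
Qed.

End Estimates.

(** * Interpolation in the Hardy space *)

Section Interpolation.
Variable R : realType.
Local Notation C := R[i].
Local Notation nm := (@Normc.normc R).
Implicit Types (v : seq (C * C)) (u : C) (G : C -> C).

Lemma hardy_prod_blaschke (I : eqType) (r : seq I) (P : pred I) (a : I -> C) A G : 0 <= A ->
  {in r, forall i, rhp (a i)} -> hardy (fun u => rhp u) A G ->
  hardy (fun u => rhp u) A (fun u => \prod_(i <- r | P i) blaschke (a i) u * G u).
Proof.
move=> A0; elim: r => [|i r IH] hr hG.
  by apply: eq_hardy hG => u _; rewrite big_nil mul1r.
have {}IH := IH (fun j jr => hr j (mem_behead (s := i :: r) jr)) hG.
case: (boolP (P i)) => Pi; last first.
  by apply: eq_hardy IH => u _; rewrite big_cons (negbTE Pi).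
have hi := hr i (mem_head _ _).
apply: eq_hardy (hardy_mul_blaschke hi (fun _ h => h) A0 IH) => u _.
by rewrite big_cons Pi mulrA.
Qed.

Lemma blaschke_self u : blaschke u u = 0.
Proof. by rewrite /blaschke subrr mul0r. Qed.

Variables (m : nat) (a : nat -> C).
Hypothesis a_rhp : forall k, (k < m)%N -> rhp (a k).
Hypothesis a_inj : forall k l, (k < m)%N -> (l < m)%N -> a k = a l -> k = l.

(** The interpolation formula of the Hardy space: the basis function of the node
    a_k is the kernel at a_k, normalized, times the Blaschke factors of the
    other nodes. *)
Definition lagrange G u : C := \sum_(0 <= k < m)
  (G (a k) * (2 * complex.Re (a k))%:C%C * \prod_(0 <= l < m | l != k) (blaschke (a l) (a k))^-1)
   * (\prod_(0 <= l < m | l != k) blaschke (a l) u * (u + (a k)^*)^-1).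

Definition lagrange_norm G : R := \sum_(0 <= k < m)
  nm (G (a k)) * Num.sqrt (2 * complex.Re (a k))
    * \prod_(0 <= l < m | l != k) (nm (blaschke (a l) (a k)))^-1.

Lemma mem_iota0 k : (k \in index_iota 0 m) = (k < m)%N.
Proof. by rewrite mem_index_iota. Qed.

Lemma hardy_lagrange G : hardy (fun u => rhp u) (lagrange_norm G) (lagrange G).
Proof.
apply: hardy_sum => k; rewrite mem_iota0 => km; have hk := a_rhp km.
have k0 : 0 < 2 * complex.Re (a k) by rewrite mulr_gt0 // -rhpE.
set c := G (a k) * _ * _.
have H : hardy (fun u => rhp u) (Num.sqrt (2 * complex.Re (a k)))^-1
   (fun u => \prod_(0 <= l < m | l != k) blaschke (a l) u * (u + (a k)^*)^-1).
  apply: hardy_prod_blaschke; first by rewrite invr_ge0 sqrtr_ge0.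
    by move=> l; rewrite mem_iota0; exact: a_rhp.
  exact: hardy_kernel.
have := hardyZ c H; apply: hardyW.
rewrite /c !Normc.normcM nm_prod nm_real ger0_norm ?(ltW k0) //.
under eq_bigr do rewrite Normc.normcV.
set q := \prod_(_ <= _ < _ | _) _; rewrite -{1}(sqr_sqrtr (ltW k0)).
have s0 : Num.sqrt (2 * complex.Re (a k)) != 0 by rewrite gt_eqF // sqrtr_gt0.
by rewrite le_eqVlt; apply/orP; left; apply/eqP; field.
Qed.

Lemma lagrange_node G j : (j < m)%N -> lagrange G (a j) = G (a j).
Proof.
move=> jm; rewrite /lagrange (bigD1_seq j) ?mem_iota0 ?iota_uniq //=.
rewrite [X in _ + X]big_seq_cond [X in _ + X]big1 ?addr0; last first.
  move=> k /andP[]; rewrite mem_iota0 => km kj.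
  rewrite [X in _ * (X * _)](big_rem j) ?mem_iota0 //= eq_sym kj.
  by rewrite blaschke_self !mul0r mulr0.
have hj := a_rhp jm; have jj := rhp_neq0 hj hj.
rewrite -addC_conj prodfV.
have P0 : \prod_(0 <= l < m | l != j) blaschke (a l) (a j) != 0.
  rewrite prodf_seq_neq0; apply/allP => l; rewrite mem_iota0 => lm; apply/implyP => lj.
  apply: blaschke_neq0 => //; first exact: a_rhp.
  by apply: contraNneq lj => /a_inj ->.
by move: P0 jj; set P := \prod_(_ <= _ < _ | _) _; set s := a j + _ => P0 jj;
   field; rewrite P0 jj.
Qed.

Definition nodes := [seq a k | k <- index_iota 0 m].

Lemma uniq_nodes : uniq nodes.
Proof.
rewrite map_inj_in_uniq ?iota_uniq // => k l; rewrite !mem_iota0; exact: a_inj.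
Qed.

Lemma nodes_rhp : {in nodes, forall z, rhp z}.
Proof. by move=> z /mapP[k]; rewrite mem_iota0 => /a_rhp ? ->. Qed.

Lemma hardy_quotient A G : hardy (fun u => rhp u) A G ->
  hardy (fun u => rhp u /\ u \notin nodes) (A + lagrange_norm G)
    (fun u => (G u - lagrange G u) / \prod_(z <- nodes) blaschke z u).
Proof.
move=> hG; apply: hardy_div_prod => //.
- exact: uniq_nodes.
- exact: nodes_rhp.
- by move=> z /mapP[k]; rewrite mem_iota0 => km ->; rewrite lagrange_node ?subrr.
apply: eq_hardy (hardyD hG (hardyW _ (hardyZ (-1) (hardy_lagrange G)))).
  by move=> s _; rewrite mulN1r.
by rewrite nmN Normc.normc1 mul1r.
Qed.

Lemma prod_blaschke_cexp (rho : R) u : 0 < rho ->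
  (forall k, (k < m)%N -> rho <= complex.Re (a k)) -> rhp u ->
  nm (\prod_(z <- nodes) blaschke z u -
      (\prod_(z <- nodes) - (z / z^*)) *
       cexp (- ((\sum_(z <- nodes) 2 * complex.Re z / nm z ^+ 2)%:C%C * u)))
  <= m%:R * (14 * nm u ^+ 2 / rho ^+ 2).
Proof.
move=> rho0 hrho hu.
set g := fun z : C => 2 * complex.Re z / nm z ^+ 2.
have -> : cexp (- ((\sum_(z <- nodes) g z)%:C%C * u)) =
          \prod_(z <- nodes) cexp (- ((g z)%:C%C * u)).
  elim: nodes => [|z zs IH]; first by rewrite !big_nil mul0r oppr0 cexp0.
  by rewrite !big_cons -IH -cexpD rmorphD /=; congr cexp; ring.
rewrite -big_split /=.
have hn z : z \in nodes -> rhp z /\ rho <= complex.Re z.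
  by move=> /mapP[k]; rewrite mem_iota0 => km ->; split; [exact: a_rhp | exact: hrho].
apply: (le_trans (prod_sub_le _ _)).
- by move=> z /hn[hz _]; exact: nm_blaschke_le1.
- move=> z /hn[hz _]; rewrite Normc.normcM.
  have z0 : nm z != 0.
    by rewrite nm_eq0; apply: contraTneq hz => ->; rewrite rhpE ltxx.
  rewrite nmN Normc.normcM Normc.normcV nm_conj divff // mul1r nm_cexp expR_le1.
  have -> : complex.Re (- ((g z)%:C%C * u)) = - (g z * complex.Re u).
    by case: (u) => u1 u2 /=; rewrite mul0r subr0.
  rewrite oppr_le0 mulr_ge0 //; last by rewrite ltW // -rhpE.
  by rewrite /g divr_ge0 ?sqr_ge0 // mulr_ge0 // ltW // -rhpE.
apply: (@le_trans _ _ (\sum_(z <- nodes) 14 * nm u ^+ 2 / rho ^+ 2)).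
  by rewrite big_seq [leRHS]big_seq; apply: ler_sum => z /hn[hz hr]; exact: blaschke_cexp.
by rewrite big_map sumr_const_nat subn0 [leRHS]mulr_natl.
Qed.

(** exp(gam u) G(u) is the sum of exp(gam u) times the interpolant, which is
    small when G is small at the nodes, of a unimodular constant times exp(- (g
    - gam) u) times the quotient of [hardy_quotient], where g >= gam is the
    exponent of [prod_blaschke_cexp], and of an error which tends to 0 when the
    nodes go to infinity. *)
Lemma node_estimate A G (rho gam : R) v : 0 <= A -> 0 < rho ->
  (forall k, (k < m)%N -> rho <= complex.Re (a k)) ->
  hardy (fun u => rhp u) A G ->
  gam <= \sum_(0 <= k < m) 2 * complex.Re (a k) / nm (a k) ^+ 2 ->
  {in v, forall p, rhp p.2 /\ complex.Re p.2 < rho} ->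
  nm (pairing (fun u => cexp (gam%:C%C * u) * G u) v) <=
    lagrange_norm G * vnorm (reweight (fun u => cexp (gam%:C%C * u)) v)
    + (A + lagrange_norm G) * (vnorm v + m%:R / rho ^+ 2 *
       \sum_(p <- v) nm p.1 * expR (gam * complex.Re p.2) * (14 * nm p.2 ^+ 2)
          / Num.sqrt (2 * complex.Re p.2)).
Proof.
move=> A0 rho0 hrho hG hgam hv.
have eta0 : 0 <= lagrange_norm G.
  apply: sumr_ge0 => k _; rewrite !mulr_ge0 ?nm_ge0 ?sqrtr_ge0 //.
  by apply: prodr_ge0 => l _; rewrite invr_ge0 nm_ge0.
have hv1 : {in v, forall p, rhp p.2} by move=> p /hv[].
have hvn : {in v, forall p, rhp p.2 /\ p.2 \notin nodes}.
  move=> p /hv[hp pr]; split => //; apply/negP => /mapP[k]; rewrite mem_iota0 => km E.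
  by have := hrho k km; rewrite -E leNgt pr.
pose B u := \prod_(z <- nodes) blaschke z u.
pose G1 u := (G u - lagrange G u) / B u.
pose om := \prod_(z <- nodes) - (z / z^*).
pose gR := \sum_(z <- nodes) 2 * complex.Re z / nm z ^+ 2.
have gRE : gR = \sum_(0 <= k < m) 2 * complex.Re (a k) / nm (a k) ^+ 2 by rewrite /gR big_map.
have hG1 : hardy (fun u => rhp u /\ u \notin nodes) (A + lagrange_norm G) G1.
  exact: hardy_quotient.
have B0 p : p \in v -> B p.2 != 0.
  move=> /hvn[hp pn]; rewrite prodf_seq_neq0; apply/allP => z zn /=.
  apply: blaschke_neq0 => //; first exact: nodes_rhp.
  by apply: contraNneq pn => ->.
pose g0 u := om * cexp (- ((gR - gam)%:C%C * u)).
pose E u := cexp (gam%:C%C * u) * (B u - om * cexp (- (gR%:C%C * u))).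
have -> : pairing (fun u => cexp (gam%:C%C * u) * G u) v =
  pairing (lagrange G) (reweight (fun u => cexp (gam%:C%C * u)) v)
  + pairing G1 (reweight g0 v) + pairing (fun u => E u * G1 u) v.
  rewrite !pairing_reweight /pairing -!big_split /= big_seq [RHS]big_seq.
  apply: eq_bigr => p /B0; rewrite /G1 /g0 /E; set b := B _ => b0.
  have -> : cexp (- ((gR - gam)%:C%C * p.2)) =
     cexp (- (gR%:C%C * p.2)) * cexp (gam%:C%C * p.2).
    by rewrite -cexpD rmorphB /=; congr cexp; ring.
  by field.
apply: (le_trans (nmD _ _)); apply: (le_trans (lerD (nmD _ _) (lexx _))).
rewrite -addrA mulrDr; apply: lerD.
  by apply: hardy_lagrange => p /mapP[q /hv[hq _] ->].
apply: lerD.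
  have -> : reweight g0 v = reweight (fun=> om) (shiftw (gR - gam) v).
    rewrite /g0 reweight_cst_comp; congr reweight.
    by apply: eq_map => p; rewrite [p.2 * _]mulrC.
  apply: (le_trans (hG1 _ _)).
    by move=> p /mapP[q /mapP[q' /hvn hq -> ->]].
  rewrite ler_wpM2l ?addr_ge0 // vnormZ; last exact: rhp_shiftw.
  have -> : nm om = 1.
    rewrite nm_prod big_seq big1 // => z /nodes_rhp hz.
    have z0 : nm z != 0.
      by rewrite nm_eq0; apply: contraTneq hz => ->; rewrite rhpE ltxx.
    by rewrite nmN Normc.normcM Normc.normcV nm_conj divff.
  by rewrite mul1r vnorm_shiftw // subr_ge0 gRE.
apply: (le_trans (nm_sum _ _ _)); rewrite mulrA mulr_sumr big_seq [leRHS]big_seq.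
apply: ler_sum => p pv; have [hp hpr] := hv p pv.
have h1 := hardy_eval hp (hvn _ pv) hG1.
have h2 := prod_blaschke_cexp rho0 hrho hp.
have s0 : 0 < Num.sqrt (2 * complex.Re p.2).
  by rewrite sqrtr_gt0 mulr_gt0 // -rhpE.
rewrite Normc.normcM [nm (E _ * _)]Normc.normcM [nm (E _)]Normc.normcM nm_cexp.
have -> : complex.Re (gam%:C%C * p.2) = gam * complex.Re p.2.
  by case: (p.2) => x y /=; rewrite mul0r subr0.
apply: (@le_trans _ _ (nm p.1 * (expR (gam * complex.Re p.2) *
   (m%:R * (14 * nm p.2 ^+ 2 / rho ^+ 2)) *
   ((A + lagrange_norm G) / Num.sqrt (2 * complex.Re p.2))))).
  rewrite ler_wpM2l ?nm_ge0 //; apply: ler_pM => //.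
  - by rewrite mulr_ge0 ?expR_ge0 ?nm_ge0.
  - exact: nm_ge0.
  - by rewrite ler_wpM2l ?expR_ge0.
rewrite le_eqVlt; apply/orP; left; apply/eqP.
by field; rewrite !gt_eqF.
Qed.

End Interpolation.

(** * Segments on which a function is tiny *)

Section GoodPoints.
Variable R : realType.
Local Notation C := R[i].
Local Notation nm := (@Normc.normc R).
Implicit Types (v : seq (C * C)) (u : C) (F G : C -> C).

Lemma expRN_cube (x : R) : 0 < x -> expR (- x) <= 6 / x ^+ 3.
Proof.
move=> x0; rewrite expRN -[leRHS]invrK lef_pV2 ?posrE ?expR_gt0 ?invr_gt0 ?divr_gt0 ?exprn_gt0 //.
rewrite invf_div; apply: le_trans (expR_ge1Dxn 2 (ltW x0)); rewrite ler_wpDl //.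
Qed.

Lemma sqrt_le_1D (x : R) : 0 <= x -> Num.sqrt x <= 1 + x.
Proof.
move=> x0; have h := sqr_ge0 (Num.sqrt x - 1); have := sqr_sqrtr x0.
move: h; rewrite sqrrB expr1n mulr1; have := sqrtr_ge0 x.
by move: (Num.sqrt x) => y; rewrite -mulr_natl => *; nra.
Qed.

Variables (kap sig H L c3 h : R).
Hypotheses (kap0 : 0 < kap) (sig0 : 0 < sig) (H0 : 0 < H) (L0 : 0 < L)
  (c30 : 0 < c3) (h0 : 0 <= h).

(** The modulus of the Blaschke factor of one node at another is at least this
    constant times their distance measured in numbers of nodes, divided by m
    ([nm_blaschke_node]). *)
Definition node_ratio : R := sig / (2 * (H + 1) + sig).
Hypothesis c3_small : c3 * ln (expR 2 / node_ratio) <= kap / 2.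

(** A lower bound, independent of T, for the exponent 2 Re a / |a|^2 of
    [blaschke_cexp] summed over about c3 T nodes at distance of order T. *)
Definition node_gain : R := c3 * H / ((H + 1) ^+ 2 + (L + sig) ^+ 2).

Lemma node_ratio_gt0 : 0 < node_ratio.
Proof. by rewrite divr_gt0 // addr_gt0 // mulr_gt0 // addr_gt0. Qed.

Lemma node_ratio_le1 : node_ratio <= 1.
Proof.
rewrite ler_pdivrMr; first by rewrite mul1r lerDr mulr_ge0 // addr_ge0 // ltW.
by rewrite addr_gt0 // mulr_gt0 // addr_gt0.
Qed.

Definition node (T x0 : R) (m k : nat) : C :=
  Complex (H * T + h) (x0 + k%:R * (sig * T / m%:R)).

Section OneScale.
Variables (T x0 : R) (m : nat).
Hypotheses (T1 : 1 <= T) (hT : h <= T) (m0 : (0 < m)%N) (mT : m%:R <= c3 * T)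
  (mT2 : c3 * T / 2 <= m%:R) (x0L : `|x0| <= L * T).
Let T0 : 0 < T. Proof. exact: lt_le_trans ltr01 T1. Qed.
Let m0R : 0 < m%:R :> R. Proof. by rewrite ltr0n. Qed.
Let step0 : 0 < sig * T / m%:R. Proof. by rewrite divr_gt0 // mulr_gt0. Qed.
Local Notation a := (node T x0 m).

Lemma node_rhp k : rhp (a k).
Proof. by rewrite rhpE /= ltr_pwDl // mulr_gt0. Qed.

Lemma node_inj k l : a k = a l -> k = l.
Proof.
case=> /addrI /(mulIf _) E; apply/eqP; rewrite -(eqr_nat R); apply/eqP; apply: E.
by rewrite gt_eqF.
Qed.

Lemma nm_blaschke_node k l : (k < m)%N -> (l < m)%N -> l != k ->
  0 <= (nm (blaschke (a l) (a k)))^-1 <= m%:R / (node_ratio * `|k%:R - l%:R|).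
Proof.
move=> km lm lk; rewrite invr_ge0 nm_ge0 andTb.
have kl0 : 0 < `|k%:R - l%:R| :> R by rewrite normr_gt0 subr_eq0 eqr_nat eq_sym.
have kl1 : `|k%:R - l%:R| <= m%:R :> R.
  rewrite ler_norml; have : (k%:R <= m%:R :> R) by rewrite ler_nat ltnW.
  have : (l%:R <= m%:R :> R) by rewrite ler_nat ltnW.
  have : 0 <= k%:R :> R by []. have : 0 <= l%:R :> R by [].
  move: (k%:R) (l%:R) (m%:R) => x y z; lra.
rewrite Normc.normcM Normc.normcV invf_div.
have -> : nm (a k - a l) = `|k%:R - l%:R| * (sig * T / m%:R).
  rewrite /node /= subrr expr0n add0r sqrtr_sqr.
  rewrite (_ : _ - _ = (k%:R - l%:R) * (sig * T / m%:R)); last by ring.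
  by rewrite normrM [X in _ * X]ger0_norm // ltW.
have num : nm (a k + (a l)^*) <= (2 * (H + 1) + sig) * T.
  apply: (le_trans (nm_le_ReIm _)); rewrite /node /=.
  have -> : x0 + k%:R * (sig * T / m%:R) - (x0 + l%:R * (sig * T / m%:R)) =
     (k%:R - l%:R) * (sig * T / m%:R) by ring.
  rewrite [leRHS]mulrDl; apply: lerD.
    rewrite (_ : 2 * (H + 1) * T = 2 * (H * T) + 2 * T); last by ring.
    by rewrite ger0_norm; move: hT h0 (mulr_gt0 H0 T0); move: (H * T) => y; lra.
  rewrite normrM [X in _ * X]ger0_norm ?(ltW step0) //.
  by rewrite mulrA ler_pdivrMr // mulrC ler_wpM2l // mulr_ge0 // ltW.
have d0 : 0 < 2 * (H + 1) + sig by rewrite addr_gt0 // mulr_gt0 // addr_gt0.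
have ks0 := mulr_gt0 kl0 step0.
rewrite /node_ratio ler_pdivrMr //; apply: (le_trans num).
rewrite le_eqVlt; apply/orP; left; apply/eqP.
by field; rewrite !gt_eqF.
Qed.

Lemma lagrange_norm_le G :
  (forall k, (k < m)%N -> nm (G (a k)) <= expR (- (kap * T))) ->
  lagrange_norm m a G <= c3 * (3 + 2 * H) * 48 / kap ^+ 3 / T.
Proof.
move=> hG; have d0 : 0 < expR 2 / node_ratio by rewrite divr_gt0 ?expR_gt0 ?node_ratio_gt0.
have ln0 : 0 <= ln (expR 2 / node_ratio).
  apply: ln_ge0; rewrite ler_pdivlMr ?node_ratio_gt0 // mul1r.
  apply: (le_trans node_ratio_le1); by rewrite -expR0 ler_expR.
have hP k : (k < m)%N -> \prod_(0 <= l < m | l != k) (nm (blaschke (a l) (a k)))^-1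
    <= expR (kap * T / 2).
  move=> km; apply: (le_trans (prod_dist_le node_ratio_gt0 km _ node_ratio_le1)).
    by move=> l lm lk; exact: nm_blaschke_node.
  have -> : expR m%:R ^+ 2 = expR 2 ^+ m :> R by rewrite -2!expRM_natl mulrC.
  rewrite -expr_div_n.
  rewrite -[expR 2 / _]lnK ?posrE // -expRM_natl ler_expR.
  apply: (@le_trans _ _ (c3 * T * ln (expR 2 / node_ratio))); first by rewrite ler_wpM2r.
  by rewrite mulrAC [kap * T / 2]mulrAC ler_wpM2r // ltW.
have hs k : Num.sqrt (2 * complex.Re (a k)) <= (3 + 2 * H) * T.
  have HT := mulr_gt0 H0 T0.
  apply: (le_trans (sqrt_le_1D _)); first by rewrite mulr_ge0 //= addr_ge0 // ltW.
  rewrite (_ : (3 + 2 * H) * T = 3 * T + 2 * (H * T)) /=; last by ring.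
  by move: HT hT T1 h0; move: (H * T) => y; lra.
apply: (@le_trans _ _ (\sum_(0 <= k < m)
   (expR (- (kap * T)) * ((3 + 2 * H) * T) * expR (kap * T / 2)))).
  rewrite /lagrange_norm big_nat_cond [leRHS]big_nat_cond; apply: ler_sum => k.
  rewrite andbT => /andP[_ km]; apply: ler_pM.
  - by rewrite mulr_ge0 ?nm_ge0 ?sqrtr_ge0.
  - by apply: prodr_ge0 => l _; rewrite invr_ge0 nm_ge0.
  - by apply: ler_pM; rewrite ?nm_ge0 ?sqrtr_ge0 ?hG.
  - exact: hP.
rewrite sumr_const_nat subn0 -[leLHS]mulr_natl.
have kT : 0 < kap * T / 2 by rewrite divr_gt0 // mulr_gt0.
have -> : expR (- (kap * T)) * ((3 + 2 * H) * T) * expR (kap * T / 2) =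
   (3 + 2 * H) * T * expR (- (kap * T / 2)).
  have -> : - (kap * T) = - (kap * T / 2) - kap * T / 2 by field.
  rewrite expRD [expR (- (kap * T / 2))]expRN.
  by have := expR_gt0 (kap * T / 2); move: (expR _) => y y0; field; rewrite gt_eqF.
have P0 : 0 <= (3 + 2 * H) * T by rewrite mulr_ge0 // ?addr_ge0 ?mulr_ge0 // ltW.
apply: (@le_trans _ _ (c3 * T * ((3 + 2 * H) * T * (6 / (kap * T / 2) ^+ 3)))).
  apply: ler_pM => //; first by rewrite mulr_ge0 ?expR_ge0.
  by rewrite ler_wpM2l // expRN_cube.
rewrite le_eqVlt; apply/orP; left; apply/eqP; field.
by rewrite !gt_eqF.
Qed.

Lemma node_gain_le : node_gain <=
  \sum_(0 <= k < m) 2 * complex.Re (a k) / nm (a k) ^+ 2.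
Proof.
set Q := (H + 1) ^+ 2 + (L + sig) ^+ 2.
have Q0 : 0 < Q by rewrite addr_gt0 // exprn_gt0 // addr_gt0.
apply: (@le_trans _ _ (\sum_(0 <= k < m) 2 * (H * T) / (Q * T ^+ 2))).
  rewrite sumr_const_nat subn0 -[leRHS]mulr_natl.
  apply: (@le_trans _ _ (c3 * T / 2 * (2 * (H * T) / (Q * T ^+ 2)))).
    rewrite le_eqVlt; apply/orP; left; apply/eqP; rewrite /node_gain -/Q; field.
    by rewrite !gt_eqF.
  by rewrite ler_wpM2r // divr_ge0 // ltW // ?mulr_gt0 ?exprn_gt0.
rewrite big_nat_cond [leRHS]big_nat_cond; apply: ler_sum => k.
rewrite andbT => /andP[_ km].
have HT := mulr_gt0 H0 T0.
have n0 : 0 < nm (a k) ^+ 2.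
  rewrite exprn_gt0 // nm_gt0; have := node_rhp k; apply: contraTneq => ->.
  by rewrite rhpE ltxx.
apply: ler_pM.
- by rewrite mulr_ge0 // ltW.
- by rewrite invr_ge0 ltW // mulr_gt0 // exprn_gt0.
- by rewrite ler_wpM2l //= lerDl.
rewrite lef_pV2 ?posrE // ?mulr_gt0 ?exprn_gt0 // nm_sqr /= mulrDl -!exprMn.
apply: lerD.
  rewrite ler_pXn2r ?nnegrE //.
  - by rewrite mulrDl mul1r lerD2l.
  - by rewrite addr_ge0 // ltW.
  - by rewrite mulr_ge0 // ?addr_ge0 // ltW.
rewrite -[leLHS](real_normK (num_real _)) ler_pXn2r ?nnegrE //.
  apply: (le_trans (ler_normD _ _)); rewrite mulrDl lerD // ger0_norm.
    rewrite mulrA ler_pdivrMr // mulrC ler_wpM2l // ?mulr_ge0 ?(ltW sig0) ?(ltW T0) //.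
    by rewrite ler_nat ltnW.
  by rewrite mulr_ge0 // ltW.
by rewrite mulr_ge0 // ?addr_ge0 // ltW.
Qed.

End OneScale.

(** Apply [node_estimate] to about c3 T nodes on a segment where G is at most
    exp(- kap T). The constant c3 is so small that the basis functions of the
    interpolation are only exp(kap T / 2) large; hence all error terms tend to 0
    as T grows and the norm A of G survives, although G is now multiplied by an
    exponential that increases to the right. *)
Lemma tiny_segments_gain A G : 0 <= A -> hardy (fun u => rhp u) A G ->
  (forall T0 : R, exists2 T, T0 <= T & exists2 x0, `|x0| <= L * T &
     forall y, x0 <= y -> y <= x0 + sig * T ->
       nm (G (Complex (H * T + h) y)) <= expR (- (kap * T))) ->
  hardy (fun u => rhp u) A (fun u => cexp (node_gain%:C%C * u) * G u).
Proof.
move=> A0 hG bad v hv; apply/ler_addgt0Pr => eps eps0.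
set V1 := vnorm (reweight (fun u => cexp (node_gain%:C%C * u)) v).
pose V2 := \sum_(p <- v) nm p.1 * expR (node_gain * complex.Re p.2) * (14 * nm p.2 ^+ 2)
          / Num.sqrt (2 * complex.Re p.2).
pose C1 := c3 * (3 + 2 * H) * 48 / kap ^+ 3.
pose C2 := c3 / H ^+ 2.
pose K := C1 * V1 + C1 * vnorm v + (A + C1) * C2 * V2.
pose M0 := \sum_(p <- v) nm p.2.
have V10 : 0 <= V1 := vnorm_ge0 _.
have V00 := vnorm_ge0 v.
have V20 : 0 <= V2.
  apply: sumr_ge0 => p _; rewrite divr_ge0 ?sqrtr_ge0 //.
  by rewrite !mulr_ge0 ?nm_ge0 ?expR_ge0 ?sqr_ge0.
have M00 : 0 <= M0 by apply: sumr_ge0 => p _; exact: nm_ge0.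
have C10 : 0 <= C1.
  by rewrite /C1 divr_ge0 // ?mulr_ge0 // ?addr_ge0 ?mulr_ge0 ?exprn_ge0 // ltW.
have C20 : 0 <= C2 by rewrite /C2 divr_ge0 ?sqr_ge0 // ltW.
have K0 : 0 <= K.
  rewrite /K; apply: addr_ge0; first by apply: addr_ge0; apply: mulr_ge0.
  by apply: mulr_ge0 => //; apply: mulr_ge0 => //; apply: addr_ge0.
have [T] := bad (1 + h + 2 / c3 + (M0 + 1) / H + K / eps).
have t1 : 0 <= 2 / c3 by rewrite divr_ge0 // ltW.
have t2 : 0 <= (M0 + 1) / H by rewrite divr_ge0 ?addr_ge0 // ltW.
have t3 : 0 <= K / eps by rewrite divr_ge0 // ltW.
move=> TT [x0 x0L hsmall].
have [T1 hT cT MT KT] : [/\ 1 <= T, h <= T, 2 / c3 <= T, (M0 + 1) / H <= T & K / eps <= T].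
  move: t1 t2 t3 TT; move: (2 / c3) ((M0 + 1) / H) (K / eps) => y1 y2 y3.
  by move: h0 => *; split; lra.
have T0 : 0 < T by exact: lt_le_trans ltr01 T1.
have cT0 : 0 <= c3 * T by rewrite mulr_ge0 // ltW.
have cT2 : 2 <= c3 * T by rewrite mulrC -ler_pdivrMr.
pose m := Num.truncn (c3 * T).
have /andP[mT] := truncn_itv cT0; rewrite -/m -natr1 => mT'.
have mT2 : c3 * T / 2 <= m%:R by move: mT' cT2; move: (c3 * T) (m%:R) => y z; lra.
have m0 : (0 < m)%N.
  by rewrite -(ltr0n R); move: mT' cT2; move: (c3 * T) (m%:R) => y z; lra.
have m0R : 0 < m%:R :> R by rewrite ltr0n.
have hr k : rhp (node T x0 m k) by exact: node_rhp.
have HT := mulr_gt0 H0 T0.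
have hv' : {in v, forall p, rhp p.2 /\ complex.Re p.2 < H * T}.
  move=> p pv; split; first exact: hv.
  have h1 : nm p.2 <= M0.
    rewrite /M0 (big_rem p) //= lerDl; apply: sumr_ge0 => q _; exact: nm_ge0.
  have := le_trans (le_trans (ler_norm _) (Re_le_nm p.2)) h1.
  move: MT; rewrite ler_pdivrMr // [T * H]mulrC.
  by move: (complex.Re p.2) (H * T) => x y; lra.
have hrho k : (k < m)%N -> H * T <= complex.Re (node T x0 m k) by move=> _ /=; rewrite lerDl.
have := @node_estimate _ m (node T x0 m) (fun k _ => hr k) (fun k l _ _ => @node_inj T x0 m T1 m0 k l)
  A G (H * T) node_gain v A0 HT hrho hG (node_gain_le T1 hT m0 mT2 x0L) hv'.
rewrite -/V1 -/V2 => /le_trans; apply.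
have eta0 : lagrange_norm m (node T x0 m) G <= C1 / T.
  apply: lagrange_norm_le => // k km; apply: hsmall.
    by rewrite lerDl mulr_ge0 // divr_ge0 // mulr_ge0 // ltW.
  rewrite lerD2l mulrA ler_pdivrMr // mulrC ler_wpM2l ?mulr_ge0 ?(ltW sig0) ?(ltW T0) //.
  by rewrite ler_nat ltnW.
have eta1 : 0 <= lagrange_norm m (node T x0 m) G.
  apply: sumr_ge0 => k _; rewrite !mulr_ge0 ?nm_ge0 ?sqrtr_ge0 //.
  by apply: prodr_ge0 => l _; rewrite invr_ge0 nm_ge0.
move: eta0 eta1; set eta := lagrange_norm _ _ _ => eta0 eta1.
have mC : m%:R / (H * T) ^+ 2 <= C2 / T.
  apply: (@le_trans _ _ (c3 * T / (H * T) ^+ 2)).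
    by rewrite ler_wpM2r // invr_ge0 sqr_ge0.
  rewrite le_eqVlt; apply/orP; left; apply/eqP; rewrite /C2; field.
  by rewrite !gt_eqF.
have mC0 : 0 <= m%:R / (H * T) ^+ 2 by rewrite divr_ge0 ?sqr_ge0.
have CT1 : C1 / T <= C1 by rewrite ler_pdivrMr // ler_peMr.
have KT' : K / T <= eps by rewrite ler_pdivrMr // mulrC -ler_pdivrMr.
apply: (@le_trans _ _ (C1 / T * V1 + (A * vnorm v + C1 / T * vnorm v + (A + C1) * (C2 / T * V2)))).
  apply: lerD; first by rewrite ler_wpM2r.
  rewrite mulrDr; apply: lerD.
    by rewrite mulrDl lerD2l ler_wpM2r.
  apply: ler_pM.
  - exact: addr_ge0.
  - exact: mulr_ge0.
  - by rewrite lerD2l (le_trans eta0).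
  - by rewrite ler_wpM2r.
apply: (@le_trans _ _ (A * vnorm v + K / T)); last by apply: lerD.
rewrite le_eqVlt; apply/orP; left; apply/eqP; rewrite /K; field.
by rewrite gt_eqF.
Qed.

End GoodPoints.

(** * Points where a function is not small *)

Section GoodPointsExist.
Variable R : realType.
Local Notation C := R[i].
Local Notation nm := (@Normc.normc R).
Implicit Types (u s : C) (F : C -> C).

Definition expmul (al : R) F s : C := cexp (al%:C%C * s) * F s.

Definition pw_shift (w : R) F (A al : R) := forall h, 0 <= h ->
  hardy (fun u => rhp u) (A * expR ((w - al) * h)) (fun u => expmul al F (u - h%:C%C)).

(** With al > w the translates of exp(al s) F to the left would tend to 0 in
    norm, which the value at s0 forbids. *)
Lemma pw_shift_le w F A al s0 : 0 <= A -> F s0 != 0 -> pw_shift w F A al -> al <= w.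
Proof.
move=> A0 Fs0 hP; rewrite leNgt; apply/negP => wal.
have d0 : 0 < al - w by rewrite subr_gt0.
set X := nm (expmul al F s0).
have X0 : 0 < X by rewrite nm_gt0 mulf_neq0 // cexp_neq0.
(* with this h the bound A exp(- (al - w) h) is smaller than X, by exp x > x *)
pose h := `|complex.Re s0| + 1 + A / (X * (al - w)).
have t0 : 0 <= A / (X * (al - w)) by rewrite divr_ge0 // mulr_ge0 // ltW.
have h0 : 0 <= h by rewrite /h !addr_ge0.
have hre : 1 <= complex.Re s0 + h.
  have := ler_norm (- complex.Re s0); rewrite normrN /h.
  move: t0; move: (complex.Re s0) (`|complex.Re s0|) (A / (X * (al - w))) => x y z z0 xy.
  rewrite (_ : x + (y + 1 + z) = 1 + ((y + x) + z)); last by ring.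
  by rewrite lerDl addr_ge0 // -lerBlDr sub0r.
have ReE : complex.Re (s0 + h%:C%C) = complex.Re s0 + h by case: (s0).
have hp : rhp (s0 + h%:C%C) by rewrite rhpE ReE; exact: lt_le_trans ltr01 hre.
have := hardy_eval hp hp (hP h h0); rewrite addrK -/X ReE.
have q1 : 1 <= Num.sqrt (2 * (complex.Re s0 + h)).
  rewrite -[leLHS]sqrtr1 ler_wsqrtr // (le_trans hre) // ler_peMl ?ler1n //.
  exact: le_trans ler01 hre.
move=> hX; suff : A * expR ((w - al) * h) / Num.sqrt (2 * (complex.Re s0 + h)) < X.
  by rewrite ltNge hX.
rewrite ltr_pdivrMr ?(lt_le_trans ltr01) //.
apply: (@lt_le_trans _ _ X); last by rewrite ler_peMr // ltW.
have -> : (w - al) * h = - ((al - w) * h) by ring.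
rewrite expRN ltr_pdivrMr ?expR_gt0 //.
apply: (@lt_le_trans _ _ (X * (1 + (al - w) * h))); last first.
  by rewrite ler_wpM2l ?(ltW X0) // expR_ge1Dx.
apply: (@le_lt_trans _ _ (X * ((al - w) * h))); last by rewrite ltr_pM2l // ltrDr.
rewrite mulrA /h mulrDr -[leLHS]add0r lerD //.
  apply: mulr_ge0; last exact: addr_ge0.
  by apply: mulr_ge0; exact: ltW.
by rewrite mulrC divfK // gt_eqF // mulr_gt0.
Qed.

Lemma pw_shift0 w F A : 0 <= A ->
  (forall h, 0 <= h -> hardy (fun u => rhp u) (A * expR (w * h)) (fun u => F (u - h%:C%C))) ->
  pw_shift w F A 0.
Proof.
move=> A0 hF h /hF; rewrite subr0; apply: eq_hardy => u _.
by rewrite /expmul mul0r cexp0 mul1r.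
Qed.

Lemma exists_last_shift w F A gam s0 : 0 <= A -> 0 < gam -> F s0 != 0 ->
  pw_shift w F A 0 ->
  exists n : nat, pw_shift w F A (n%:R * gam) /\ ~ pw_shift w F A (n.+1%:R * gam).
Proof.
move=> A0 g0 Fs0 h0; apply: contrapT => H.
have all n : pw_shift w F A (n%:R * gam).
  elim: n => [|n IH]; first by rewrite mul0r.
  by apply: contrapT => Hn; apply: H; exists n.
have w0 : 0 <= w by exact: pw_shift_le Fs0 h0.
have := pw_shift_le A0 Fs0 (all (Num.truncn (w / gam)).+1).
rewrite leNgt; apply/negP; rewrite negbK -ltr_pdivrMr //.
exact: truncnS_gt.
Qed.

(** Take for al the last multiple of the gain of [tiny_segments_gain] that F
    admits. Without the announced points y that lemma would provide one multiple
    more. *)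
Lemma pw_good_points w F s0 (kap sig H L : R) :
  0 < kap -> 0 < sig -> 0 < H -> 0 < L -> F s0 != 0 -> pw w F ->
  exists A al : R, [/\ 0 <= A, 0 <= al, pw_shift w F A al &
    exists T0 : R, forall T x0, T0 <= T -> `|x0| <= L * T ->
      exists y, [/\ x0 <= y, y <= x0 + sig * T &
        expR (- (kap * T)) < nm (expmul al F (Complex (H * T) y))]].
Proof.
move=> kap0 sig0 H0 L0 Fs0 [A [A0 hF]].
have r0 := node_ratio_gt0 sig0 H0; have r1 := node_ratio_le1 sig0 H0.
pose E := ln (expR 2 / node_ratio sig H).
have E0 : 0 <= E.
  apply: ln_ge0; rewrite ler_pdivlMr // mul1r (le_trans r1) //.
  by rewrite -expR0 ler_expR.
have E1 : 0 < 1 + E by rewrite ltr_pwDl.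
pose c3 := kap / 2 / (1 + E).
have c30 : 0 < c3 by rewrite !divr_gt0.
have c3E : c3 * E <= kap / 2.
  rewrite /c3 -mulrA ler_piMr ?divr_ge0 // ?(ltW kap0) //.
  by rewrite mulrC ler_pdivrMr // mul1r lerDr.
pose gam := node_gain sig H L c3.
have gam0 : 0 < gam.
  apply: divr_gt0; first exact: mulr_gt0.
  by apply: addr_gt0; apply: exprn_gt0; apply: addr_gt0.
have [n [Pn Pn1]] := exists_last_shift A0 gam0 Fs0 (pw_shift0 A0 hF).
exists A, (n%:R * gam); split => //; first by rewrite mulr_ge0 // ltW.
apply: contrapT => bad; apply: Pn1 => h h0.
set al := n%:R * gam.
pose G u := expmul al F (u - h%:C%C).
have A'0 : 0 <= A * expR ((w - al) * h) by rewrite mulr_ge0 ?expR_ge0.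
have hG : hardy (fun u => rhp u) (A * expR ((w - al) * h)) (fun u => cexp (gam%:C%C * u) * G u).
  apply: (@tiny_segments_gain R kap sig H L c3 h kap0 sig0 H0 L0 c30 h0 c3E _ G A'0 (Pn h h0)).
  move=> T0; apply: contrapT => nobad; apply: bad; exists T0 => T x0 TT xL.
  apply: contrapT => noy; apply: nobad; exists T => //; exists x0 => // y y1 y2.
  rewrite leNgt; apply/negP => lt; apply: noy; exists y; split => //.
  rewrite (_ : Complex _ _ = Complex (H * T + h) y - h%:C%C) //.
  by apply/eqP; rewrite eq_complex /= addrK subr0 !eqxx.
have := hardyZ (cexp (- (gam * h)%:C%C)) hG.
rewrite nm_cexp /= => H1.
apply: (@eq_hardy _ _ _ (fun u => cexp (- (gam * h)%:C%C) * (cexp (gam%:C%C * u) * G u))).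
  move=> u _; rewrite /G /expmul mulrA -cexpD mulrA -cexpD; congr (cexp _ * _).
  by rewrite /al -natr1 mulrDl mul1r rmorphD !rmorphM /=; ring.
apply: hardyW H1; rewrite mulrCA ler_wpM2l // -expRD ler_expR.
by rewrite -natr1 /al; lra.
Qed.

End GoodPointsExist.

(** * Zeros in a sector *)

Section Counting.
Variable R : realType.
Local Notation C := R[i].
Local Notation nm := (@Normc.normc R).
Implicit Types (u s z p : C) (F G : C -> C) (zs : seq C).

Lemma nm_blaschke_sqr (a p : C) : rhp a -> rhp p ->
  nm (blaschke a p) ^+ 2 = 1 - 4 * complex.Re a * complex.Re p / nm (p + a^*) ^+ 2.
Proof.
move=> ha hp; have pa := rhp_neq0 hp ha.
have n0 : nm (p + a^*) ^+ 2 != 0 by rewrite expf_neq0 // nm_eq0.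
apply: (mulIf n0); rewrite mulrBl mul1r divfK // Normc.normcM Normc.normcV exprMn exprVn divfK //.
by rewrite !nm_sqr; case: (a) (p) => [a1 a2] [p1 p2] /=; ring.
Qed.

Lemma nm_blaschke_expR (a p : C) : rhp a -> rhp p ->
  nm (blaschke a p) <= expR (- (2 * complex.Re a * complex.Re p / nm (p + a^*) ^+ 2)).
Proof.
move=> ha hp; rewrite -(ler_pXn2r (ltn0Sn 1)) ?nnegrE ?nm_ge0 ?expR_ge0 //.
rewrite nm_blaschke_sqr // -expRM_natl; apply: le_trans (expR_ge1Dx _).
rewrite le_eqVlt; apply/orP; left; apply/eqP; field.
by rewrite nm_eq0 rhp_neq0.
Qed.

(** The logarithm of [hardy_zeros_bound] at a point p where G is not smaller
    than exp(- X). *)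
Lemma zeros_sum_bound A B X G zs p : 0 <= A -> A <= expR B -> 1 <= 2 * complex.Re p ->
  hardy (fun u => rhp u) A G -> uniq zs -> {in zs, forall z, rhp z} ->
  {in zs, forall z, G z = 0} -> expR (- X) < nm (G p) ->
  \sum_(z <- zs) 2 * complex.Re z * complex.Re p / nm (p + z^*) ^+ 2 <= X + B.
Proof.
move=> A0 AB hp hG uzs hz hz0 hX.
have pR : rhp p by rewrite rhpE -(pmulr_rgt0 _ (ltr0Sn _ 1)) (lt_le_trans ltr01).
have := hardy_zeros_bound uzs hz hz0 hG pR.
move=> /(lt_le_trans hX) h.
have s1 : 1 <= Num.sqrt (2 * complex.Re p) by rewrite -[leLHS]sqrtr1 ler_wsqrtr.
have h2 : A / Num.sqrt (2 * complex.Re p) <= expR B.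
  by rewrite ler_pdivrMr ?(lt_le_trans ltr01) // (le_trans AB) // ler_peMr ?expR_ge0.
set S := \sum_(z <- zs) _.
have h3 : \prod_(z <- zs) nm (blaschke z p) <= expR (- S).
  rewrite /S -sumrN expR_sum big_seq [leRHS]big_seq; apply: ler_prod => z zzs.
  by rewrite nm_ge0 /= nm_blaschke_expR // hz.
have : expR (- X) < expR (B - S).
  rewrite expRD; apply: (lt_le_trans h); apply: ler_pM => //.
    by rewrite divr_ge0 // sqrtr_ge0.
  by apply: prodr_ge0 => z _; exact: nm_ge0.
by rewrite ltr_expR; move: (S) => y h'; rewrite ltW //; lra.
Qed.

(** At a point p of modulus comparable to T, a zero of modulus at most T in the
    sector contributes at least a fixed amount to the sum in [zeros_sum_bound],
    which is at most kap T plus a constant, and kap may be taken as small as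
    needed. *)
Lemma sector_count w F s0 (eta eps : R) : 0 < eta -> 0 < eps -> F s0 != 0 -> pw w F ->
  exists T0 : R, forall T zs, T0 <= T -> uniq zs ->
    {in zs, forall z, [/\ F z = 0, nm z <= T & eta * T <= complex.Re z]} ->
    (size zs)%:R <= eps * T.
Proof.
move=> eta0 eps0 Fs0 hF.
(* |p + conj z| <= 3 T for the point p and the zeros z below, whence the 9 *)
pose kap := eps * eta / 9.
have kap0 : 0 < kap by rewrite divr_gt0 // mulr_gt0.
have [A [al [A0 al0 hP [T0 good]]]] := pw_good_points kap0 ltr01 ltr01 ltr01 Fs0 hF.
have k2 : 0 <= A / kap by rewrite divr_ge0 // ltW.
exists (`|T0| + 1 + A / kap) => T zs TT uzs hzs.
have [TT0 T1 TA] : [/\ T0 <= T, 1 <= T & A / kap <= T].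
  have := ler_norm T0; have := normr_ge0 T0; move: k2 TT; move: (A / kap) (`|T0|) => x y.
  by split; lra.
have Tp : 0 < T by exact: lt_le_trans ltr01 T1.
have [|y [y0 y1 hy]] := good T 0 TT0.
  by rewrite normr0 mul1r ltW.
move: y1 hy; rewrite add0r !mul1r => y1 hy.
have hz z : z \in zs -> rhp z.
  by move=> /hzs[_ _]; rewrite rhpE; apply: lt_le_trans; rewrite mulr_gt0.
have H0 : hardy (fun u => rhp u) A (expmul al F).
  have := hP 0 (lexx _); rewrite mulr0 expR0 mulr1; apply: eq_hardy => u _.
  by rewrite subr0.
have AA : A <= expR A by rewrite (le_trans _ (expR_ge1Dx _)) // lerDr.
have pT : 1 <= 2 * complex.Re (Complex T y) by rewrite /= (le_trans T1) // ler_peMl ?ler1n // ltW.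
have hz0 : {in zs, forall z, expmul al F z = 0}.
  by move=> z /hzs[Fz _ _]; rewrite /expmul Fz mulr0.
have hS := zeros_sum_bound A0 AA pT H0 uzs hz hz0 hy.
have : (size zs)%:R * (2 * eta / 9) <= kap * T + A.
  apply: le_trans hS.
  rewrite -sum1_size natr_sum mulr_suml big_seq [leRHS]big_seq; apply: ler_sum => z zzs.
  have [_ zT zre] := hzs z zzs.
  have n9 : nm (Complex T y + z^*) ^+ 2 <= 9 * T ^+ 2.
    rewrite (_ : 9 * T ^+ 2 = (T + T + T) ^+ 2); last by ring.
    rewrite ler_pXn2r ?nnegrE ?nm_ge0 //; last by rewrite !addr_ge0 // ltW.
    apply: (le_trans (nmD _ _)); rewrite nm_conj lerD //.
    by apply: (le_trans (nm_le_ReIm _)); rewrite /= !ger0_norm ?lerD // ltW.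
  have n0 : 0 < nm (Complex T y + z^*) ^+ 2.
    by rewrite exprn_gt0 // nm_gt0; apply: rhp_neq0; [rewrite rhpE | exact: hz].
  rewrite mul1r (@le_trans _ _ (2 * (eta * T) * T / (9 * T ^+ 2))) //.
    by rewrite le_eqVlt; apply/orP; left; apply/eqP; field; rewrite gt_eqF.
  apply: ler_pM.
  - by rewrite !mulr_ge0 // ltW.
  - by rewrite invr_ge0 mulr_ge0 // sqr_ge0.
  - by rewrite ler_wpM2r ?(ltW Tp) // ler_wpM2l.
  - by rewrite lef_pV2 ?posrE // mulr_gt0 // exprn_gt0.
have AT : A <= kap * T by rewrite mulrC -ler_pdivrMr.
move=> h; have {}h : (size zs)%:R * (2 * eta / 9) <= (eps * T) * (2 * eta / 9).
  apply: (le_trans h); apply: (le_trans (lerD (lexx _) AT)).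
  by rewrite /kap le_eqVlt; apply/orP; left; apply/eqP; field.
by move: h; rewrite ler_pM2r // divr_gt0 // mulr_gt0.
Qed.

Lemma atan_cell (x v d : R) : 0 <= d -> x <= v -> v <= x + d ->
  (atan (x + d) - atan x) / (1 + d + d ^+ 2) <= d / (1 + v ^+ 2).
Proof.
move=> d0 xv vd.
have xd : x <= x + d by rewrite lerDl.
have cf : continuous (@atan R) by move=> t; exact: continuous_atan.
have [c + E] := @MVT_segment _ atan (fun c => (1 + c ^+ 2)^-1) x (x + d) xd
  (fun c _ => is_derive1_atan c) (continuous_subspaceT cf).
rewrite in_itv /= => /andP[xc cd]; rewrite E.
have p1 (b : R) : 0 < 1 + b ^+ 2 by rewrite ltr_pwDl // sqr_ge0.
have p2 : 0 < 1 + d + d ^+ 2 by rewrite ltr_pwDl ?sqr_ge0 // ltr_pwDl.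
have -> : x + d - x = d by ring.
rewrite mulrAC mulrC ler_wpM2l // -invfM lef_pV2 ?posrE // ?mulr_gt0 //.
have h1 : (v - c) ^+ 2 <= d ^+ 2.
  rewrite -(real_normK (num_real (v - c))) ler_pXn2r ?nnegrE // ler_norml.
  by apply/andP; split; lra.
have h2 : 2 * c * (v - c) <= (1 + c ^+ 2) * d.
  have vc : `|v - c| <= d by rewrite ler_norml; apply/andP; split; lra.
  apply: (le_trans (ler_norm _)); rewrite normrM; apply: ler_pM => //.
  rewrite normrM [`|2|]ger0_norm //.
  by rewrite -(real_normK (num_real c)); have := sqr_ge0 (`|c| - 1); rewrite sqrrB; lra.
have h3 : d ^+ 2 <= (1 + c ^+ 2) * d ^+ 2 by rewrite ler_peMl ?sqr_ge0 // lerDl sqr_ge0.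
have -> : 1 + v ^+ 2 = (1 + c ^+ 2) + 2 * c * (v - c) + (v - c) ^+ 2 by ring.
have -> : (1 + c ^+ 2) * (1 + d + d ^+ 2) = (1 + c ^+ 2) + (1 + c ^+ 2) * d + (1 + c ^+ 2) * d ^+ 2 by ring.
by rewrite lerD // ?lerD // (le_trans h1).
Qed.

(** A lower bound for a Riemann sum of 1 / (1 + v^2); the factor 1 + d + d^2
    bounds the ratio of the values of 1 + v^2 at two points of a cell of length
    d. *)
Lemma atan_grid (x d : R) (v : nat -> R) K : 0 <= d ->
  (forall k, (k < K)%N -> x + k%:R * d <= v k <= x + k.+1%:R * d) ->
  (atan (x + K%:R * d) - atan x) / (1 + d + d ^+ 2) <=
    \sum_(0 <= k < K) d / (1 + v k ^+ 2).
Proof.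
move=> d0 hv.
have -> : atan (x + K%:R * d) - atan x =
   \sum_(0 <= k < K) (atan (x + k.+1%:R * d) - atan (x + k%:R * d)).
  by rewrite telescope_sumr // mul0r addr0.
rewrite mulr_suml big_nat_cond [leRHS]big_nat_cond; apply: ler_sum => k.
rewrite andbT => /andP[_ kK]; have /andP[v1 v2] := hv k kK.
have E : x + k.+1%:R * d = x + k%:R * d + d by rewrite -natr1; ring.
by rewrite E; apply: atan_cell => //; rewrite -E.
Qed.

End Counting.

(** * Zeros near the imaginary axis *)

Section FlatCount.
Variable R : realType.
Local Notation C := R[i].
Local Notation nm := (@Normc.normc R).
Implicit Types (u s z p : C) (F G : C -> C) (zs : seq C).

(** As t tends to 0 the two sides tend to w and to w + eps pi, because 2 atan
    tends to pi. *)
Lemma flat_parameter (w eps : R) : 0 <= w -> 0 < eps ->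
  exists2 t : R, 0 < t <= 1 / 2 &
    (1 + t) ^+ 2 * (w + 2 * t) * (1 + t + t ^+ 2) <=
    (w / pi + eps) * (1 - t) * (2 * atan ((t * (1 + t) ^+ 2)^-1)).
Proof.
move=> w0 eps0; pose t n : R := n.+1%:R^-1.
have t_cvg : t n @[n --> \oo] --> (0 : R) by exact: cvg_harmonic.
have at_cvg : atan (n.+1%:R / 4 : R) @[n --> \oo] --> (pi / 2 : R).
  have h : (n.+1%:R / 4 : R) @[n --> \oo] --> +oo.
    apply/cvgryPge => M.
    exists (Num.truncn (`|M| * 4)).+1 => //= n /= hn.
    rewrite ler_pdivlMr //; apply: (@le_trans _ _ (`|M| * 4)).
      by rewrite ler_wpM2r // ler_norm.
    apply: ltW; apply: (lt_le_trans (truncnS_gt _)).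
    by rewrite ler_nat (leq_trans hn).
  exact: (cvg_comp _ _ h (@cvgy_atan R)).
pose f n := (w / pi + eps) * (1 - t n) * (2 * atan (n.+1%:R / 4)) -
  (1 + t n) ^+ 2 * (w + 2 * t n) * (1 + t n + t n ^+ 2).
have f_cvg : f n @[n --> \oo] --> (eps * pi).
  have -> : eps * pi = (w / pi + eps) * (1 - 0) * (2 * (pi / 2)) -
     (1 + 0) * (1 + 0) * (w + 2 * 0) * (1 + 0 + 0 * 0).
    have := pi_gt0 R; move: (pi : R) => y y0; field; exact: lt0r_neq0.
  have c1 (k : R) : (k : R) @[n --> \oo] --> k by exact: cvg_cst.
  have c1t : (1 + t n) @[n --> \oo] --> (1 + 0 : R) by exact: cvgD.
  rewrite /f; under eq_fun do rewrite !expr2.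
  apply: cvgB.
    by apply: cvgM; [apply: cvgM => //; apply: cvgB | apply: cvgM].
  apply: cvgM; last by apply: cvgD => //; apply: cvgM.
  apply: cvgM; first by apply: cvgM.
  by apply: cvgD => //; apply: cvgM.
have fpos : 0 < eps * pi by rewrite mulr_gt0 // pi_gt0.
have [N _ hN] := cvgr_gt _ f_cvg _ fpos.
have := hN N.+1 (leqnSn N); rewrite /= /f subr_gt0.
set s := t N.+1.
have s0 : 0 < s by rewrite invr_gt0.
have s1 : s <= 1 / 2 by rewrite div1r lef_pV2 ?posrE // ler_nat.
move=> h; exists s; first by rewrite s0.
apply: (le_trans (ltW h)).
have w1 : 0 <= w / pi + eps by rewrite addr_ge0 ?(ltW eps0) // divr_ge0 // pi_ge0.
have s2 : s <= 1 by rewrite (le_trans s1) // ler_pdivrMr // mul1r ler1n.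
rewrite ler_wpM2l ?mulr_ge0 ?subr_ge0 //.
rewrite ler_wpM2l // le_atan // invfM /s /t invrK ler_wpM2l //.
rewrite lef_pV2 ?posrE ?exprn_gt0 ?addr_gt0 //.
rewrite (_ : 4 = 2 ^+ 2 :> R); last by rewrite -natrX.
rewrite ler_pXn2r ?nnegrE ?addr_ge0 ?(ltW s0) //.
by move: s2; rewrite /s /t; move: (_^-1) => y; lra.
Qed.

(** Over a grid of step d, the Poisson kernels 2 Re z Re p / |p + conj z|^2 of a
    point z close to the axis add up to nearly 2 pi Re z / d at least, when the
    grid is much closer to the axis than it is long. All scales are powers of t:
    the grid lies at height t^2 T and has steps at most t^3 T, the zeros lie
    within t^4 T of the axis, and everything has been moved to the right by t^3
    T. *)
Lemma poisson_grid_sum (t T s tau xi : R) (y : nat -> R) K :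
  0 < t -> t <= 1 / 2 -> 0 < T -> 0 < s -> s <= t ^+ 3 ->
  s * K%:R = 2 * (1 + t) -> `|tau| <= t ^+ 4 * T -> `|xi| <= T ->
  (forall k, (k < K)%N -> - (1 + t) * T + k%:R * (s * T) <= y k <=
      - (1 + t) * T + k%:R * (s * T) + s * T) ->
  2 * t ^+ 3 * (1 - t) / ((1 + t) * s) *
    (2 * atan ((t * (1 + t) ^+ 2)^-1) / (1 + t + t ^+ 2)) <=
  \sum_(0 <= k < K) 2 * (tau + t ^+ 3 * T) * (t ^+ 2 * T + t ^+ 3 * T) /
     ((t ^+ 2 * T + t ^+ 3 * T + (tau + t ^+ 3 * T)) ^+ 2 + (y k - xi) ^+ 2).
Proof.
move=> t0 t1 T0 s0 st sK; rewrite !ler_norml => /andP[tau1 tau2] /andP[xi1 xi2] hy.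
have t1' : t <= 1 by rewrite (le_trans t1) // ler_pdivrMr // mul1r ler1n.
have p2 : 0 < t ^+ 2 * T by rewrite mulr_gt0 // exprn_gt0.
have p3 : 0 < t ^+ 3 * T by rewrite mulr_gt0 // exprn_gt0.
have p4 : 0 < t ^+ 4 * T by rewrite mulr_gt0 // exprn_gt0.
have p43 : t ^+ 4 * T <= t ^+ 3 * T by rewrite ler_wpM2r ?(ltW T0) // exprS ler_piMl // exprn_ge0 // ltW.
set Y := t ^+ 2 * T + t ^+ 3 * T + (tau + t ^+ 3 * T).
have Y1 : t ^+ 2 * T <= Y by rewrite /Y; lra.
have Y2 : Y <= t ^+ 2 * (1 + t) ^+ 2 * T.
  rewrite (_ : t ^+ 2 * (1 + t) ^+ 2 * T = t ^+ 2 * T + t ^+ 3 * T + t ^+ 3 * T + t ^+ 4 * T).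
    by rewrite /Y; lra.
  by ring.
have Y0 : 0 < Y := lt_le_trans p2 Y1.
pose d := s * T / Y; pose x := (- (1 + t) * T - xi) / Y.
pose v k := (y k - xi) / Y.
have d0 : 0 <= d by rewrite divr_ge0 ?mulr_ge0 // ltW.
have dt : d <= t.
  rewrite ler_pdivrMr //; apply: (@le_trans _ _ (t * (t ^+ 2 * T))).
    by rewrite mulrA -exprS ler_wpM2r // ltW.
  by rewrite ler_wpM2l // ltW.
have xk k : x + k%:R * d = (- (1 + t) * T + k%:R * (s * T) - xi) / Y.
  by rewrite /x /d; field; rewrite gt_eqF.
have hv k : (k < K)%N -> x + k%:R * d <= v k <= x + k.+1%:R * d.
  move=> /hy /andP[h1 h2]; rewrite !xk /v !ler_pM2r ?invr_gt0 // !lerD2r h1 /=.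
  by rewrite (le_trans h2) // -natr1 mulrDl mul1r addrA.
have hgrid := atan_grid d0 hv.
have -> : \sum_(0 <= k < K) 2 * (tau + t ^+ 3 * T) * (t ^+ 2 * T + t ^+ 3 * T) /
     (Y ^+ 2 + (y k - xi) ^+ 2) =
   2 * (tau + t ^+ 3 * T) * (t ^+ 2 * T + t ^+ 3 * T) / (Y * (s * T)) *
   \sum_(0 <= k < K) d / (1 + v k ^+ 2).
  rewrite mulr_sumr; apply: eq_bigr => k _; rewrite /d /v.
  have q : 0 < Y ^+ 2 + (y k - xi) ^+ 2 by rewrite ltr_pwDl ?exprn_gt0 // sqr_ge0.
  move: q Y0; move: (y k - xi) (tau + _) (t ^+ 2 * T + t ^+ 3 * T) => e f g q Y0.
  have q2 : 0 < 1 + (e / Y) ^+ 2 by rewrite ltr_pwDl // sqr_ge0.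
  by field; rewrite !gt_eqF.
have at0 : 0 <= atan ((t * (1 + t) ^+ 2)^-1).
  by rewrite -[X in X <= _]atan0 le_atan // invr_ge0 mulr_ge0 ?(ltW t0) // exprn_ge0 // addr_ge0 // ltW.
have bnd e : t * T <= e -> (t * (1 + t) ^+ 2)^-1 <= e / Y.
  move=> he; rewrite ler_pdivlMr //.
  apply: le_trans he; rewrite mulrC ler_pdivrMr; last by rewrite mulr_gt0 // exprn_gt0 // addr_gt0.
  by apply: (le_trans Y2); rewrite le_eqVlt; apply/orP; left; apply/eqP; ring.
have hup : atan ((t * (1 + t) ^+ 2)^-1) <= atan (x + K%:R * d).
  rewrite le_atan // xk; apply: bnd.
  rewrite (_ : K%:R * (s * T) = 2 * (1 + t) * T); last by rewrite -sK; ring.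
  rewrite (_ : _ - xi = t * T + (T - xi)); last by ring.
  by rewrite lerDl subr_ge0.
have hlo : atan x <= - atan ((t * (1 + t) ^+ 2)^-1).
  rewrite -atanN le_atan // lerNr /x -mulNr; apply: bnd.
  rewrite (_ : - (- (1 + t) * T - xi) = t * T + (T + xi)); last by ring.
  by rewrite lerDl -lerBlDl sub0r.
have dd : 1 + d + d ^+ 2 <= 1 + t + t ^+ 2.
  by rewrite !lerD // ler_pXn2r ?nnegrE // ltW.
have dd0 : 0 < 1 + d + d ^+ 2 by rewrite ltr_pwDl ?sqr_ge0 // ltr_pwDl.
apply: ler_pM.
- apply: divr_ge0; last by rewrite mulr_ge0 ?addr_ge0 // ltW.
  by rewrite mulr_ge0 ?subr_ge0 // mulr_ge0 // exprn_ge0 // ltW.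
- by rewrite divr_ge0 ?mulr_ge0 // (le_trans (ltW dd0)).
- rewrite ler_pdivrMr ?mulr_gt0 ?addr_gt0 //.
  rewrite [leRHS]mulrAC ler_pdivlMr ?mulr_gt0 //.
  apply: (@le_trans _ _ (2 * t ^+ 3 * (1 - t) * (t ^+ 2 * (1 + t) ^+ 2 * T * (s * T)))).
    apply: ler_wpM2l; last by rewrite ler_wpM2r // mulr_ge0 // ltW.
    by rewrite mulr_ge0 ?subr_ge0 // mulr_ge0 // exprn_ge0 // ltW.
  apply: (@le_trans _ _ (2 * ((t ^+ 3 - t ^+ 4) * T) * (t ^+ 2 * T + t ^+ 3 * T) * ((1 + t) * s))).
    by rewrite le_eqVlt; apply/orP; left; apply/eqP; ring.
  rewrite !ler_wpM2r // ?mulr_ge0 ?addr_ge0 ?(ltW p2) ?(ltW p3) ?(ltW t0) ?(ltW s0) //.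
  by rewrite ler_wpM2l // mulrBl; move: tau1; lra.
- apply: le_trans hgrid; apply: ler_pM => //.
  + by rewrite mulr_ge0.
  + by rewrite invr_ge0 (le_trans (ltW dd0)).
  + by move: hup hlo; move: (atan _) (atan _) (atan _) => *; lra.
  + by rewrite lef_pV2 ?posrE // (lt_le_trans dd0).
Qed.

(** Good points are chosen in the segments of a grid on the line Re s = t^2 T,
    and [zeros_sum_bound] is applied in the half-plane Re s > - t^3 T, which
    contains the zeros in question; there the norm of F costs a factor exp(w t^3
    T). Summing over the grid and using [poisson_grid_sum] for each zero leaves
    w / pi times T, up to the error controlled by [flat_parameter]. *)
Lemma flat_count w F s0 (eps : R) : 0 < eps -> F s0 != 0 -> pw w F ->
  exists2 eta : R, 0 < eta & exists T0 : R, forall T zs, T0 <= T -> uniq zs ->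
    {in zs, forall z, [/\ F z = 0, nm z <= T & `|complex.Re z| <= eta * T]} ->
    (size zs)%:R <= (w / pi + eps) * T.
Proof.
move=> eps0 Fs0 hF.
have w0 : 0 <= w.
  have [A [A0 hA]] := hF; exact: (pw_shift_le A0 Fs0 (pw_shift0 A0 hA)).
have [t /andP[t0 t1] hpar] := flat_parameter w0 eps0.
exists (t ^+ 4); first by rewrite exprn_gt0.
have t1' : t <= 1 by rewrite (le_trans t1) // ler_pdivrMr // mul1r ler1n.
(* K segments of length s T cover the ordinates between - (1 + t) T and (1 + t) T *)
pose K := (Num.truncn (2 * (1 + t) / t ^+ 3)).+1.
have K0 : 0 < K%:R :> R by rewrite ltr0n.
pose s := 2 * (1 + t) / K%:R.
have s0' : 0 < s by rewrite divr_gt0 // mulr_gt0 // addr_gt0.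
have sK : s * K%:R = 2 * (1 + t) by rewrite divfK // gt_eqF.
have st : s <= t ^+ 3.
  rewrite ler_pdivrMr // [leRHS]mulrC -ler_pdivrMr ?exprn_gt0 // ltW //; exact: truncnS_gt.
have L0 : 0 < 1 + t by rewrite addr_gt0.
have t2 : 0 < t ^+ 2 by rewrite exprn_gt0.
have t3 : 0 < t ^+ 3 by rewrite exprn_gt0.
have t4 : 0 < t ^+ 4 by rewrite exprn_gt0.
have [A [al [A0 al0 hP [T0 good]]]] := pw_good_points t4 s0' t2 L0 Fs0 hF.
have k1 : 0 <= A / t ^+ 4 by rewrite divr_ge0 // ltW.
have k2 : 0 <= 1 / t ^+ 2 by rewrite divr_ge0 // ltW.
exists (`|T0| + A / t ^+ 4 + 1 / t ^+ 2) => T zs TT uzs hzs.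
have [TT0 TA T2] : [/\ T0 <= T, A / t ^+ 4 <= T & 1 / t ^+ 2 <= T].
  have := ler_norm T0; have := normr_ge0 T0; move: k1 k2 TT.
  by move: (A / _) (1 / _) (`|T0|) => x y z; split; lra.
have Tp : 0 < T by rewrite (lt_le_trans _ T2) // divr_gt0.
have /choice[y hy] : forall k : nat, exists y, (k < K)%N ->
   [/\ - (1 + t) * T + k%:R * (s * T) <= y,
     y <= - (1 + t) * T + k%:R * (s * T) + s * T &
     expR (- (t ^+ 4 * T)) < nm (expmul al F (Complex (t ^+ 2 * T) y))].
  move=> k; have [kK|kK] := ltnP k K; last by exists 0.
  have [|y hy] := good T (- (1 + t) * T + k%:R * (s * T)) TT0; last by exists y.
  have q0 : 0 <= k%:R * (s * T) by rewrite mulr_ge0 // mulr_ge0 // ltW.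
  have q1 : k%:R * (s * T) <= 2 * ((1 + t) * T).
    have -> : 2 * ((1 + t) * T) = K%:R * (s * T) by rewrite mulrA -sK; ring.
    apply: ler_wpM2r; first by rewrite mulr_ge0 // ltW.
    by rewrite ler_nat ltnW.
  rewrite mulNr ler_norml; move: q0 q1; move: (k%:R * _) ((1 + t) * T) => a b *.
  by apply/andP; split; lra.
pose hh := t ^+ 3 * T.
have hh0 : 0 <= hh by rewrite mulr_ge0 // ltW.
pose G u := expmul al F (u - hh%:C%C).
have hG := hP hh hh0.
pose zs' := [seq z + hh%:C%C | z <- zs].
have uzs' : uniq zs' by rewrite map_inj_uniq //; exact: addIr.
have ReD z : complex.Re (z + hh%:C%C) = complex.Re z + hh by case: z.
have ImD z : complex.Im (z + hh%:C%C) = complex.Im z by case: z => a b /=; rewrite addr0.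
have p43 : t ^+ 4 * T < hh.
  rewrite ltr_pM2r // [X in X < _]exprS gtr_pMl //.
  by apply: (le_lt_trans t1); rewrite ltr_pdivrMr // mul1r ltr1n.
have hz' : {in zs', forall z, rhp z}.
  move=> z' /mapP[z /hzs[_ _ hz] ->]; rewrite rhpE ReD.
  by move: hz; rewrite ler_norml => /andP[hz _]; move: p43 hz; rewrite /hh; lra.
have hz0 : {in zs', forall z, G z = 0}.
  by move=> z' /mapP[z /hzs[Fz _ _] ->]; rewrite /G addrK /expmul Fz mulr0.
have AB : A * expR ((w - al) * hh) <= expR (A + w * hh).
  rewrite expRD; apply: ler_pM; rewrite ?expR_ge0 //.
    by rewrite (le_trans _ (expR_ge1Dx _)) // lerDr.
  by rewrite ler_expR ler_wpM2r // lerBlDr lerDl.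
have A'0 : 0 <= A * expR ((w - al) * hh) by rewrite mulr_ge0 ?expR_ge0.
have hsum k : (k < K)%N ->
  \sum_(z <- zs) 2 * (complex.Re z + hh) * (t ^+ 2 * T + hh) /
     ((t ^+ 2 * T + hh + (complex.Re z + hh)) ^+ 2 + (y k - complex.Im z) ^+ 2)
   <= t ^+ 4 * T + (A + w * hh).
  move=> kK; have [_ _ hk] := hy k kK.
  have pk : 1 <= 2 * complex.Re (Complex (t ^+ 2 * T + hh) (y k)).
    rewrite /=; have : 1 <= t ^+ 2 * T by rewrite mulrC -ler_pdivrMr.
    by move: hh0; move: (t ^+ 2 * T) => a; lra.
  have hk' : expR (- (t ^+ 4 * T)) < nm (G (Complex (t ^+ 2 * T + hh) (y k))).
    rewrite /G (_ : Complex _ _ - _ = Complex (t ^+ 2 * T) (y k)) //.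
    by apply/eqP; rewrite eq_complex /= addrK subr0 !eqxx.
  apply: le_trans (zeros_sum_bound A'0 AB pk hG uzs' hz' hz0 hk').
  rewrite big_map le_eqVlt; apply/orP; left; apply/eqP; apply: eq_bigr => z _.
  rewrite nm_sqr ReD; congr (_ / (_ ^+ 2 + _ ^+ 2)).
    by case: (z).
  by case: (z) => a b /=; rewrite addr0.
have Hs : \sum_(0 <= k < K) \sum_(z <- zs) 2 * (complex.Re z + hh) * (t ^+ 2 * T + hh) /
     ((t ^+ 2 * T + hh + (complex.Re z + hh)) ^+ 2 + (y k - complex.Im z) ^+ 2)
   <= K%:R * (t ^+ 4 * T + (A + w * hh)).
  apply: (@le_trans _ _ (\sum_(0 <= k < K) (t ^+ 4 * T + (A + w * hh)))).
    rewrite big_nat_cond [leRHS]big_nat_cond; apply: ler_sum => k.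
    by rewrite andbT => /andP[_]; exact: hsum.
  by rewrite sumr_const_nat subn0 [leRHS]mulr_natl.
pose Th := 2 * atan ((t * (1 + t) ^+ 2)^-1) / (1 + t + t ^+ 2).
have Hz : (size zs)%:R * (2 * t ^+ 3 * (1 - t) / ((1 + t) * s) * Th) <=
   K%:R * (t ^+ 4 * T + (A + w * hh)).
  apply: le_trans Hs; rewrite exchange_big /=.
  rewrite -sum1_size natr_sum mulr_suml big_seq [leRHS]big_seq; apply: ler_sum => z zzs.
  have [_ zT zre] := hzs z zzs.
  rewrite mul1r; apply: poisson_grid_sum => //.
    by rewrite (le_trans (nm_Im_le z)).
  by move=> k /hy[-> -> _].
have P0 : 0 < 1 + t + t ^+ 2 by rewrite addr_gt0.
have at0 : 0 < atan ((t * (1 + t) ^+ 2)^-1).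
  by rewrite -[X in X < _]atan0 lt_atan // invr_gt0 mulr_gt0 // exprn_gt0.
have t10 : 0 < 1 - t by rewrite subr_gt0 (le_lt_trans t1) // ltr_pdivrMr // mul1r ltr1n.
have Th0 : 0 < (1 - t) * Th by rewrite mulr_gt0 // divr_gt0 // mulr_gt0.
rewrite -(ler_pM2r Th0).
have h1 : (1 + t) ^+ 2 * (w + 2 * t) <= (w / pi + eps) * (1 - t) * Th.
  by rewrite /Th mulrA ler_pdivlMr.
apply: (@le_trans _ _ ((1 + t) ^+ 2 * (w + 2 * t) * T)); last first.
  have -> : (w / pi + eps) * T * ((1 - t) * Th) = (w / pi + eps) * (1 - t) * Th * T by ring.
  by rewrite ler_wpM2r // ltW.
have AT : A <= t ^+ 4 * T by rewrite mulrC -ler_pdivrMr.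
have KE : K%:R = 2 * (1 + t) / s by rewrite -sK mulrC mulKf // gt_eqF.
have c0 : 0 < 2 * t ^+ 3 / ((1 + t) * s) by rewrite divr_gt0 // mulr_gt0.
rewrite -(ler_pM2l c0).
have -> : 2 * t ^+ 3 / ((1 + t) * s) * ((size zs)%:R * ((1 - t) * Th)) =
  (size zs)%:R * (2 * t ^+ 3 * (1 - t) / ((1 + t) * s) * Th) by ring.
apply: (le_trans Hz); rewrite KE.
apply: (@le_trans _ _ (2 * (1 + t) / s * (t ^+ 4 * T + (t ^+ 4 * T + w * hh)))).
  apply: ler_wpM2l; first by rewrite divr_ge0 ?mulr_ge0 // ltW.
  by rewrite lerD2l lerD2r.
rewrite /hh le_eqVlt; apply/orP; left; apply/eqP.
by field; rewrite !gt_eqF.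
Qed.

End FlatCount.

(** * All the zeros *)

Lemma size_le_count3 (T : Type) (a1 a2 a3 : pred T) (r : seq T) :
  (forall z, [|| a1 z, a2 z | a3 z]) -> (size r <= count a1 r + count a2 r + count a3 r)%N.
Proof.
move=> h; elim: r => //= z r IH.
by have := h z; move: IH; case: (a1 z); case: (a2 z); case: (a3 z) => //=; lia.
Qed.

Section ZeroDensity.
Variable R : realType.
Local Notation C := R[i].
Local Notation nm := (@Normc.normc R).
Local Notation mu := (@lebesgue_measure R).
Implicit Types (u s z : C) (F G f : C -> C) (zs : seq C) (v : seq (C * C)).

(** The reflection of F in the imaginary axis. It has the type of F on the
    right; the exponential factor transfers this type to the left side. *)
Definition reflect_pw (w : R) F s : C := (F (- s^*))^* * cexp (- (w%:C%C * s)).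

Lemma conjNK s : - (- s^*)^* = s.
Proof. by rewrite rmorphN /= conjCK opprK. Qed.

Lemma ReNconj s : complex.Re (- s^*) = - complex.Re s.
Proof. by case: s. Qed.

(** A zero is near the imaginary axis, or in a sector on its right, or it is
    reflected to such a sector. *)
Lemma zeros_count w F s0 (eps : R) : 0 < eps -> F s0 != 0 ->
  pw w F -> pw w (reflect_pw w F) ->
  exists T0 : R, forall T zs, T0 <= T -> uniq zs ->
    {in zs, forall z, F z = 0 /\ nm z <= T} -> (size zs)%:R <= (w / pi + eps) * T.
Proof.
move=> eps0 Fs0 hF hF'.
have e3 : 0 < eps / 3 by rewrite divr_gt0.
have [eta eta0 [T1 flat]] := flat_count e3 Fs0 hF.
have [T2 sec] := sector_count eta0 e3 Fs0 hF.
have Fs0' : reflect_pw w F (- s0^*) != 0.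
  by rewrite mulf_neq0 ?cexp_neq0 // conjNK conjC_eq0.
have [T3 sec'] := sector_count eta0 e3 Fs0' hF'.
exists (`|T1| + `|T2| + `|T3|) => T zs TT uzs hzs.
have [TT1 TT2 TT3] : [/\ T1 <= T, T2 <= T & T3 <= T].
  have := ler_norm T1; have := ler_norm T2; have := ler_norm T3.
  have := normr_ge0 T1; have := normr_ge0 T2; have := normr_ge0 T3; move: TT.
  by move: (`|T1|) (`|T2|) (`|T3|) => x y z; split; lra.
pose a1 z := `|complex.Re z| <= eta * T.
pose a2 z := eta * T <= complex.Re z.
pose a3 z := complex.Re z <= - (eta * T).
have hcover z : [|| a1 z, a2 z | a3 z].
  rewrite /a1 /a2 /a3 ler_norml; move: (complex.Re z) (eta * T) => x y.
  by have [h|h] := leP y x; [rewrite orbT | have [h'|h'] := leP x (- y);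
     [rewrite !orbT | rewrite !(ltW h) !(ltW h')]].
have hc : (size zs <= size [seq z <- zs | a1 z] + size [seq z <- zs | a2 z]
      + size [seq z <- zs | a3 z])%N.
  by rewrite !size_filter; exact: size_le_count3.
have c1 := flat T [seq z <- zs | a1 z] TT1 (filter_uniq _ uzs).
have c2 := sec T [seq z <- zs | a2 z] TT2 (filter_uniq _ uzs).
have c3 := sec' T [seq - z^* | z <- [seq z <- zs | a3 z]] TT3.
have {}c1 : (size [seq z <- zs | a1 z])%:R <= (w / pi + eps / 3) * T.
  by apply: c1 => z; rewrite mem_filter => /andP[a1z /hzs[]].
have {}c2 : (size [seq z <- zs | a2 z])%:R <= eps / 3 * T.
  by apply: c2 => z; rewrite mem_filter => /andP[a2z /hzs[]].
have {}c3 : (size [seq z <- zs | a3 z])%:R <= eps / 3 * T.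
  rewrite -(size_map (fun z => - z^*)); apply: c3.
    rewrite map_inj_uniq ?filter_uniq // => x y /oppr_inj; exact: (can_inj conjCK).
  move=> z' /mapP[z]; rewrite mem_filter => /andP[a3z /hzs[Fz zT]] ->; split.
  - by rewrite /reflect_pw conjNK Fz conjC0 mul0r.
  - by rewrite nmN nm_conj.
  - by rewrite ReNconj lerNr.
have : (size zs)%:R <= (size [seq z <- zs | a1 z])%:R + (size [seq z <- zs | a2 z])%:R
      + (size [seq z <- zs | a3 z])%:R :> R by rewrite -!natrD ler_nat.
move=> /le_trans; apply; apply: (le_trans (lerD (lerD c1 c2) c3)).
rewrite le_eqVlt; apply/orP; left; apply/eqP; move: (w / pi) => y.
by field.
Qed.

Lemma expsum_reflect (d t : R) (v : seq (C * C)) :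
  expsum [seq ((p.1 * cexp (- (d%:C%C * p.2)))^*, - (p.2)^*) | p <- v] t =
  (expsum v (d - t))^*.
Proof.
rewrite /expsum big_map rmorph_sum; apply: eq_bigr => p _ /=.
have tE (x : R) : (x%:C%C)^* = x%:C%C :> C by exact: conjc_real.
rewrite [in LHS]rmorphM [in RHS]rmorphM /= !cexp_conj -mulrA -cexpD.
congr (_ * cexp _); rewrite !rmorphN /= !rmorphM /= !tE rmorphB /=; ring.
Qed.

(** The reflection replaces the density at t by its conjugate at d - t. *)
Lemma piece_reflect (d : R) f : piece d f -> piece d (reflect_pw d f).
Proof.
move=> [A [x [e [b [A0 e1 hb hf]]]]].
exists A, x, (- e), (d - b); split => //; first by rewrite sqrrN.
  move=> t t1 t2; have := hb t t1 t2; move: (e * t) (mulNr e t) => y ->.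
  by move=> /andP[h1 h2]; apply/andP; split; lra.
move=> v; pose v' := [seq ((p.1 * cexp (- (d%:C%C * p.2)))^*, - (p.2)^*) | p <- v].
have -> : pairing (reflect_pw d f) v = (pairing f v')^*.
  rewrite /pairing big_map rmorph_sum; apply: eq_bigr => p _ /=.
  by rewrite rmorphM /= conjCK /reflect_pw; ring.
rewrite nm_conj; apply: (le_trans (hf v')); rewrite ler_wpM2l //.
rewrite le_eqVlt; apply/orP; left; apply/eqP; apply: eq_Rintegral => t _.
rewrite expsum_reflect nm_conj; congr (nm (expsum v _) ^+ 2); ring.
Qed.

Lemma pw_det_reflect d n (f : 'I_n.+1 -> 'I_n.+1 -> C -> C) : 0 < d ->
  (forall i j, piece d (f i j)) ->
  pw (n.+1%:R * d) (reflect_pw (n.+1%:R * d) (fun s => \det (\matrix_(i, j) f i j s))).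
Proof.
move=> d0 hf.
have H := pw_det d0 (fun i j => piece_reflect (hf i j)).
apply: eq_pw H => s; rewrite /reflect_pw -det_map_mx.
have -> : cexp (- ((n.+1%:R * d)%:C%C * s)) = cexp (- (d%:C%C * s)) ^+ n.+1.
  elim: n.+1 => [|k IH]; first by rewrite !mul0r oppr0 cexp0 expr0.
  rewrite exprS -IH -cexpD; congr cexp.
  by rewrite -natr1 mulrDl mul1r rmorphD /=; ring.
rewrite [RHS]mulrC -detZ; congr (\det _); apply/matrixP => i j.
by rewrite !mxE mulrC.
Qed.

End ZeroDensity.

(** * The inner product of bounded functions *)

Section InnerProduct.
Variable R : realType.
Local Notation C := R[i].
Local Notation nm := (@Normc.normc R).
Local Notation mu := (@lebesgue_measure R).
Variable E : set R.
Hypotheses (mE : measurable E) (finE : (mu E < +oo)%E).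
Implicit Types (f g h : R -> C) (c : C).

Definition bmr (f : R -> R) := measurable_fun setT f /\
  exists M, forall t, E t -> `|f t| <= M.

Lemma bmr_integrable (f : R -> R) : bmr f -> mu.-integrable E (EFin \o f).
Proof.
move=> [mf [M hM]]; apply: measurable_bounded_integrable => //.
  exact: measurable_funS mf.
exists M; split; first exact: num_real.
by move=> x Mx t Et /=; apply: (le_trans (hM t Et)); exact: ltW.
Qed.

Lemma bmrD (f1 f2 : R -> R) : bmr f1 -> bmr f2 -> bmr (fun t => f1 t + f2 t).
Proof.
move=> [m1 [M1 h1]] [m2 [M2 h2]]; split; first exact: measurable_realfun.measurable_funD.
exists (M1 + M2) => t Et; apply: (le_trans (ler_normD _ _)).
by rewrite lerD ?h1 ?h2.
Qed.

Lemma bmrM (f1 f2 : R -> R) : bmr f1 -> bmr f2 -> bmr (fun t => f1 t * f2 t).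
Proof.
move=> [m1 [M1 h1]] [m2 [M2 h2]]; split; first exact: measurable_realfun.measurable_funM.
by exists (M1 * M2) => t Et; rewrite normrM ler_pM ?h1 ?h2.
Qed.

Lemma bmr_cst (k : R) : bmr (fun=> k).
Proof. by split; [exact: measurable_cst | exists `|k|]. Qed.

Lemma bmrN (f1 : R -> R) : bmr f1 -> bmr (fun t => - f1 t).
Proof.
move=> h; have := bmrM (bmr_cst (-1)) h.
by under eq_fun do rewrite mulN1r.
Qed.

Lemma bmrB (f1 f2 : R -> R) : bmr f1 -> bmr f2 -> bmr (fun t => f1 t - f2 t).
Proof. by move=> h1 h2; apply: bmrD => //; exact: bmrN. Qed.

(** Bounded measurable functions: they contain all the functions to which the
    functionals are applied, and they form an algebra and are integrable on E
    because E has finite measure. *)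
Definition bm f := bmr (fun t => complex.Re (f t)) /\ bmr (fun t => complex.Im (f t)).

Lemma bmD f g : bm f -> bm g -> bm (fun t => f t + g t).
Proof.
move=> [f1 f2] [g1 g2]; split.
  have -> : (fun t => complex.Re (f t + g t)) = (fun t => complex.Re (f t) + complex.Re (g t)).
    by apply/funext => t; case: (f t) (g t) => ? ? [].
  exact: bmrD.
have -> : (fun t => complex.Im (f t + g t)) = (fun t => complex.Im (f t) + complex.Im (g t)).
  by apply/funext => t; case: (f t) (g t) => ? ? [].
exact: bmrD.
Qed.

Lemma bmM f g : bm f -> bm g -> bm (fun t => f t * g t).
Proof.
move=> [f1 f2] [g1 g2]; split.
  have -> : (fun t => complex.Re (f t * g t)) = (fun t =>
     complex.Re (f t) * complex.Re (g t) - complex.Im (f t) * complex.Im (g t)).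
    by apply/funext => t; case: (f t) (g t) => ? ? [].
  by apply: bmrB; exact: bmrM.
have -> : (fun t => complex.Im (f t * g t)) = (fun t =>
   complex.Re (f t) * complex.Im (g t) + complex.Im (f t) * complex.Re (g t)).
  by apply/funext => t; case: (f t) (g t) => ? ? [].
by apply: bmrD; exact: bmrM.
Qed.

Lemma bm_cst c : bm (fun=> c).
Proof. by split; exact: bmr_cst. Qed.

Lemma bm_conj f : bm f -> bm (fun t => (f t)^*).
Proof.
move=> [f1 f2]; split.
  by have -> : (fun t => complex.Re (f t)^*) = (fun t => complex.Re (f t))
    by apply/funext => t; case: (f t).
have -> : (fun t => complex.Im (f t)^*) = (fun t => - complex.Im (f t)).
  by apply/funext => t; case: (f t).
exact: bmrN.
Qed.

Lemma bmZ c f : bm f -> bm (fun t => c * f t).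
Proof. by move=> hf; apply: bmM => //; exact: bm_cst. Qed.

Lemma bmB f g : bm f -> bm g -> bm (fun t => f t - g t).
Proof.
move=> hf hg; apply: bmD => //.
by have := bmZ (-1) hg; under eq_fun do rewrite mulN1r.
Qed.

Lemma bm_sum (J : Type) (r : seq J) (F : J -> R -> C) :
  (forall j, bm (F j)) -> bm (fun t => \sum_(j <- r) F j t).
Proof.
move=> hF; elim: r => [|j r IH].
  by under eq_fun do rewrite big_nil; exact: bm_cst.
by under eq_fun do rewrite big_cons; exact: bmD.
Qed.

Definition IR (f : R -> R) : R := \int[mu]_(t in E) f t.

Lemma IRD (f1 f2 : R -> R) : bmr f1 -> bmr f2 -> IR (fun t => f1 t + f2 t) = IR f1 + IR f2.
Proof. by move=> h1 h2; apply: RintegralD => //; exact: bmr_integrable. Qed.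

Lemma IRB (f1 f2 : R -> R) : bmr f1 -> bmr f2 -> IR (fun t => f1 t - f2 t) = IR f1 - IR f2.
Proof. by move=> h1 h2; apply: RintegralB => //; exact: bmr_integrable. Qed.

Lemma IRZ (k : R) (f1 : R -> R) : bmr f1 -> IR (fun t => k * f1 t) = k * IR f1.
Proof. by move=> h1; apply: RintegralZl => //; exact: bmr_integrable. Qed.

Lemma IR_ge0 (f : R -> R) : (forall t, 0 <= f t) -> 0 <= IR f.
Proof. by move=> h; apply: Rintegral_ge0. Qed.

Definition CI f : C := Complex (IR (fun t => complex.Re (f t))) (IR (fun t => complex.Im (f t))).

Lemma CID f g : bm f -> bm g -> CI (fun t => f t + g t) = CI f + CI g.
Proof.
move=> [f1 f2] [g1 g2]; apply/eqP; rewrite eq_complex /= -!IRD //.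
apply/andP; split; apply/eqP; congr IR; apply/funext => t;
  by case: (f t) (g t) => ? ? [].
Qed.

Lemma CIZ c f : bm f -> CI (fun t => c * f t) = c * CI f.
Proof.
move=> [f1 f2]; apply/eqP; case: c => c1 c2; rewrite eq_complex /= -!IRZ //.
rewrite -IRB -?IRD; try by apply: bmrM => //; exact: bmr_cst.
apply/andP; split; apply/eqP; congr IR; apply/funext => t; by case: (f t).
Qed.

Lemma CI_conj f : bm f -> CI (fun t => (f t)^*) = (CI f)^*.
Proof.
move=> [f1 f2]; rewrite -[RHS]/(Complex _ (- _)) /CI -mulN1r -IRZ //.
congr Complex; congr IR; apply/funext => t; case: (f t) => //= a b.
by rewrite mulN1r.
Qed.

Definition ip f g : C := CI (fun t => f t * (g t)^*).
Definition n2 f : R := IR (fun t => nm (f t) ^+ 2).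

Lemma n2_ge0 f : 0 <= n2 f.
Proof. by apply: IR_ge0 => t; exact: sqr_ge0. Qed.

Lemma bmr_sqr f : bm f -> bmr (fun t => nm (f t) ^+ 2).
Proof.
move=> [f1 f2]; under eq_fun do rewrite nm_sqr !expr2.
by apply: bmrD; exact: bmrM.
Qed.

Lemma ip_n2 f : bm f -> ip f f = (n2 f)%:C%C.
Proof.
move=> hf; rewrite /ip /CI /n2.
have -> : (fun t => complex.Re (f t * (f t)^*)) = (fun t => nm (f t) ^+ 2).
  by apply/funext => t; rewrite -nm_sqrC.
have -> : (fun t => complex.Im (f t * (f t)^*)) = (fun=> 0 : R).
  by apply/funext => t; rewrite -nm_sqrC.
by congr Complex; rewrite /IR Rintegral_cst // mul0r.
Qed.

Lemma ipDl f g h : bm f -> bm g -> bm h ->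
  ip (fun t => f t + g t) h = ip f h + ip g h.
Proof.
move=> hf hg hh; rewrite /ip -CID; try by apply: bmM => //; exact: bm_conj.
by congr CI; apply/funext => t; rewrite mulrDl.
Qed.

Lemma ipZl c f h : bm f -> bm h -> ip (fun t => c * f t) h = c * ip f h.
Proof.
move=> hf hh; rewrite /ip -CIZ; last by apply: bmM => //; exact: bm_conj.
by congr CI; apply/funext => t; rewrite mulrA.
Qed.

Lemma ipC f g : bm f -> bm g -> ip g f = (ip f g)^*.
Proof.
move=> hf hg; rewrite /ip -CI_conj; last by apply: bmM => //; exact: bm_conj.
by congr CI; apply/funext => t; rewrite rmorphM /= conjCK mulrC.
Qed.

Lemma ipBl f g h : bm f -> bm g -> bm h ->
  ip (fun t => f t - g t) h = ip f h - ip g h.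
Proof.
move=> hf hg hh.
have -> : (fun t => f t - g t) = (fun t => f t + (-1) * g t).
  by apply/funext => t; rewrite mulN1r.
by rewrite ipDl ?ipZl ?mulN1r //; exact: bmZ.
Qed.

Lemma ipBr f g h : bm f -> bm g -> bm h ->
  ip h (fun t => f t - g t) = ip h f - ip h g.
Proof.
move=> hf hg hh; rewrite ipC // ?ipBl //; last exact: bmB.
by rewrite rmorphB /= -!ipC.
Qed.

Lemma ipZr c f h : bm f -> bm h -> ip h (fun t => c * f t) = c^* * ip h f.
Proof.
move=> hf hh; rewrite ipC // ?ipZl //; last exact: bmZ.
by rewrite rmorphM /= -ipC.
Qed.

Lemma n2_sub c f g : bm f -> bm g ->
  (n2 (fun t => f t - c * g t))%:C%C =
  (n2 f)%:C%C - c^* * ip f g - c * (ip f g)^* + c * c^* * (n2 g)%:C%C.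
Proof.
move=> hf hg; have hc := bmZ c hg.
rewrite -!ip_n2 //; last exact: bmB.
rewrite ipBl //; last exact: bmB.
rewrite !ipBr // !ipZr // !ipZl // [ip g f]ipC //.
ring.
Qed.

(** The coefficient is that of the orthogonal projection of f to the line of g.
    *)
Lemma n2_sub_opt f g : bm f -> bm g -> n2 g != 0 ->
  n2 (fun t => f t - (ip f g / (n2 g)%:C%C) * g t) = n2 f - nm (ip f g) ^+ 2 / n2 g.
Proof.
move=> hf hg g0; apply: complexI; rewrite n2_sub //.
have -> : (n2 f - nm (ip f g) ^+ 2 / n2 g)%:C%C =
    (n2 f)%:C%C - ip f g * (ip f g)^* / (n2 g)%:C%C.
  by rewrite -nm_sqrC; move: (nm _ ^+ 2) => y; rewrite rmorphB fmorph_div.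
have g0' : (n2 g)%:C%C != 0 by apply: contra_neq g0 => /complexI.
have gE : ((n2 g)%:C%C)^* = (n2 g)%:C%C :> C by exact: conjc_real.
rewrite fmorph_div /= gE.
by field.
Qed.

(** The parallelogram law. *)
Lemma n2_sub1 f g : bm f -> bm g ->
  n2 (fun t => f t - g t) + n2 (fun t => f t + g t) = 2 * n2 f + 2 * n2 g.
Proof.
move=> hf hg; apply: complexI; rewrite !rmorphD !rmorphM /=.
have -> : (fun t => f t - g t) = (fun t => f t - 1 * g t).
  by apply/funext => t; rewrite mul1r.
have -> : (fun t => f t + g t) = (fun t => f t - (-1) * g t).
  by apply/funext => t; rewrite mulN1r opprK.
rewrite !n2_sub // rmorphN !rmorph1.
by rewrite (_ : 2%:C%C = 2 :> C); [ring | rewrite rmorphMn rmorph1].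
Qed.

Lemma n2Z c f : bm f -> n2 (fun t => c * f t) = nm c ^+ 2 * n2 f.
Proof.
move=> hf; rewrite /n2 -IRZ; last exact: bmr_sqr.
by congr IR; apply/funext => t; rewrite Normc.normcM exprMn.
Qed.

Lemma cauchy_schwarz f g : bm f -> bm g -> nm (ip f g) ^+ 2 <= n2 f * n2 g.
Proof.
move=> hf hg; have [g0|g0] := eqVneq (n2 g) 0; last first.
  have := n2_ge0 (fun t => f t - (ip f g / (n2 g)%:C%C) * g t).
  rewrite n2_sub_opt // subr_ge0 ler_pdivrMr // lt_def g0 n2_ge0 //.
(* when g is null, subtracting a multiple x <f, g> g from f changes the squared
   norm of f linearly in x *)
have H (x : R) : 0 <= n2 f - 2 * x * nm (ip f g) ^+ 2.
  have := n2_ge0 (fun t => f t - (x%:C%C * ip f g) * g t).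
  suff -> : n2 (fun t => f t - (x%:C%C * ip f g) * g t) = n2 f - 2 * x * nm (ip f g) ^+ 2 by [].
  apply: complexI; rewrite n2_sub // g0 mulr0 addr0.
  have -> : (n2 f - 2 * x * nm (ip f g) ^+ 2)%:C%C =
     (n2 f)%:C%C - 2 * x%:C%C * (ip f g * (ip f g)^*).
    rewrite -nm_sqrC; move: (nm _ ^+ 2) => y.
    by rewrite rmorphB !rmorphM /= rmorphMn rmorph1.
  have xE : (x%:C%C)^* = x%:C%C :> C by exact: conjc_real.
  rewrite rmorphM /= xE; ring.
rewrite g0 mulr0 leNgt; apply/negP => h.
have := H ((n2 f + 1) / (2 * nm (ip f g) ^+ 2)).
have -> : 2 * ((n2 f + 1) / (2 * nm (ip f g) ^+ 2)) * nm (ip f g) ^+ 2 = n2 f + 1.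
  by field; rewrite gt_eqF // -(ltr_pXn2r (ltn0Sn 1)) ?nnegrE ?nm_ge0 // expr0n.
by rewrite opprD addrA subrr add0r oppr_ge0 ler10.
Qed.

End InnerProduct.

(** * Annihilating functionals *)

Section Projection.
Variable R : realType.
Local Notation C := R[i].
Local Notation nm := (@Normc.normc R).
Local Notation mu := (@lebesgue_measure R).
Variable E : set R.
Hypotheses (mE : measurable E) (finE : (mu E < +oo)%E).
Implicit Types (f g h : R -> C) (c : C).
Local Notation bm := (@bm R E).
Local Notation n2 := (@n2 R E).
Local Notation ip := (@ip R E).

Lemma cauchy_real (u : nat -> R) (B : R) : 0 <= B ->
  (forall n m, (u n - u m) ^+ 2 <= B * (n.+1%:R^-1 + m.+1%:R^-1)) ->
  cvg (u n @[n --> \oo]).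
Proof.
move=> B0 hu; apply/cauchy_cvgP/cauchy_exP => e e0.
have h2 : 0 < e ^+ 2 / (2 * (B + 1)) by rewrite divr_gt0 ?exprn_gt0 // mulr_gt0 // ltr_wpDl.
have [N hN] : exists N : nat, N.+1%:R^-1 < e ^+ 2 / (2 * (B + 1)).
  exists (Num.truncn (e ^+ 2 / (2 * (B + 1)))^-1).
  rewrite -[ltRHS]invrK ltf_pV2 ?posrE ?invr_gt0 //; exact: truncnS_gt.
exists (u N); exists N => //= n /= Nn.
rewrite /ball /= -(ltr_pXn2r (ltn0Sn 1)) ?nnegrE ?(ltW e0) // real_normK ?num_real //.
apply: (le_lt_trans (hu N n)).
apply: (@le_lt_trans _ _ ((B + 1) * (N.+1%:R^-1 + N.+1%:R^-1))).
  apply: ler_pM.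
  - by [].
  - by rewrite addr_ge0 // invr_ge0.
  - by rewrite lerDl.
  - by rewrite lerD2l lef_pV2 ?posrE // ler_nat.
have B1 : 0 < B + 1 by rewrite ltr_wpDl.
move: hN; rewrite ltr_pdivlMr ?mulr_gt0 //; move: (N.+1%:R^-1) => y.
by rewrite (_ : (B + 1) * (y + y) = y * (2 * (B + 1))) //; ring.
Qed.

Lemma cvg_le (u : nat -> R) (l k : R) : u n @[n --> \oo] --> l ->
  (forall n, u n <= k) -> l <= k.
Proof.
move=> ul uk; rewrite leNgt; apply/negP => kl.
have [N _ hN] := cvgr_gt _ ul _ kl.
by have := hN N (leqnn N); rewrite /= ltNge uk.
Qed.

Lemma L2norm_bm f : bm f -> L2norm E f = (Num.sqrt (n2 f))%:E.
Proof.
move=> hf; rewrite /L2norm unlock /=.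
have -> : (\int[mu]_x (`|((fun t => (nm (f t))%:E) \_ E) x| `^ 2) = (n2 f)%:E)%E.
  have -> : ((n2 f)%:E = \int[mu]_(x in E) (nm (f x) ^+ 2)%:E)%E.
    rewrite /n2 /IR /Rintegral fineK //; apply: integrable_fin_num => //.
    by apply: bmr_integrable => //; exact: bmr_sqr.
  rewrite [RHS]integral_mkcond; apply: eq_integral => t _.
  rewrite /patch; case: ifP => _ /=.
    by rewrite ger0_norm ?nm_ge0 // powR_mulrn ?nm_ge0.
  by rewrite normr0 powR0.
by rewrite poweR_EFin powR12_sqrt // n2_ge0.
Qed.

Lemma L2_bm f : bm f -> L2 E f.
Proof.
move=> hf; split; last by rewrite L2norm_bm // ltry.
- by case: hf => [[h _] _]; exact: measurable_funS h.
- by case: hf => [_ [h _]]; exact: measurable_funS h.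
Qed.

Variables (S : (R -> C) -> Prop) (e0 : R -> C) (d : R).
Hypotheses (S_bm : forall g, S g -> bm g) (S0 : S (fun=> 0))
  (SD : forall f g, S f -> S g -> S (fun t => f t + g t))
  (SZ : forall c g, S g -> S (fun t => c * g t))
  (e0_bm : bm e0) (d0 : 0 < d)
  (hd : forall g, S g -> d <= n2 (fun t => e0 t - g t)).

Let D : R := inf [set n2 (fun t => e0 t - g t) | g in [set g | S g]].

Let has_inf_D : has_inf [set n2 (fun t => e0 t - g t) | g in [set g | S g]].
Proof.
split; first by exists (n2 (fun t => e0 t - 0)); exists (fun=> 0).
by exists d => _ [g Sg <-]; exact: hd.
Qed.

Let D_le g : S g -> D <= n2 (fun t => e0 t - g t).
Proof. by move=> Sg; apply: ge_inf; [case: has_inf_D | exists g]. Qed.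

Let D_gt0 : 0 < D.
Proof.
apply: (lt_le_trans d0); apply: lb_le_inf; first by case: has_inf_D.
by move=> _ [g Sg <-]; exact: hd.
Qed.

Let min_seq : exists k : nat -> R -> C, forall n,
  [/\ S (fun t => e0 t - k n t), bm (k n) & n2 (k n) <= D + n.+1%:R^-1].
Proof.
suff /choice[k hk] : forall n : nat, exists k : R -> C,
  [/\ S (fun t => e0 t - k t), bm k & n2 k <= D + n.+1%:R^-1] by exists k.
move=> n; have n0 : 0 < n.+1%:R^-1 :> R by rewrite invr_gt0.
have [_ [g Sg <-] hg] := inf_adherent n0 has_inf_D.
exists (fun t => e0 t - g t); split; last exact: ltW.
  by have -> : (fun t => e0 t - (e0 t - g t)) = g by apply/funext => t; ring.
by apply: bmB => //; exact: S_bm.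
Qed.

(** The projection theorem without completeness. Let k_n run through e0 - S with
    squared norms tending to the infimum D. Near-minimality makes k_n almost
    orthogonal to S, and the parallelogram law makes the k_n a Cauchy sequence.
    Hence the inner products of any f with k_n converge, and their limit is the
    required functional: only numbers pass to the limit, never the functions
    k_n. *)
Lemma annihilating_functional : exists (l : (R -> C) -> C) (A : R),
  [/\ 0 <= A, forall f g, bm f -> bm g -> l (fun t => f t + g t) = l f + l g,
    forall c f, bm f -> l (fun t => c * f t) = c * l f,
    forall f, bm f -> nm (l f) ^+ 2 <= A * n2 f &
    (forall g, S g -> l g = 0) /\ l e0 <> 0].
Proof.
have [k hk] := min_seq.
have Sk n : S (fun t => e0 t - k n t) by case: (hk n).
have bk n : bm (k n) by case: (hk n).
have nk n : n2 (k n) <= D + n.+1%:R^-1 by case: (hk n).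
have kD n g : S g -> D <= n2 (fun t => k n t - g t).
  move=> Sg; have := D_le (SD (Sk n) Sg).
  suff -> : (fun t => e0 t - (e0 t - k n t + g t)) = (fun t => k n t - g t) by [].
  by apply/funext => t; ring.
have orth n g : S g -> nm (ip g (k n)) ^+ 2 <= n2 g * n.+1%:R^-1.
  move=> Sg; have bg := S_bm Sg.
  rewrite ipC // nm_conj; have [g0|g0] := eqVneq (n2 g) 0.
    by rewrite g0 mul0r -[leRHS](mulr0 (n2 (k n))) -g0; exact: cauchy_schwarz.
  have := kD n _ (SZ (ip (k n) g / (n2 g)%:C%C) Sg).
  rewrite n2_sub_opt // => h.
  have g1 : 0 < n2 g by rewrite lt_def g0 n2_ge0.
  rewrite mulrC -ler_pdivrMr //; have := nk n; move: h.
  by move: (_ / n2 g) (n2 (k n)) (n.+1%:R^-1) => x y z; lra.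
have near_k n m : n2 (fun t => k n t - k m t) <= 2 * (n.+1%:R^-1 + m.+1%:R^-1).
  have h1 := n2_sub1 mE finE (bk n) (bk m).
  pose c : C := (2^-1)%:C%C.
  have := D_le (SZ c (SD (Sk n) (Sk m))).
  have -> : (fun t => e0 t - c * (e0 t - k n t + (e0 t - k m t))) =
     (fun t => c * (k n t + k m t)).
    apply/funext => t; have -> : c = 2^-1 by rewrite /c fmorphV rmorphMn rmorph1.
    by field.
  rewrite n2Z //; last exact: bmD.
  rewrite nm_real ger0_norm ?invr_ge0 // => h2.
  have := nk n; have := nk m; move: h1 h2.
  move: (n2 _) (n2 (fun t => k n t + k m t)) (n2 (k n)) (n2 (k m)) => x1 x2 x3 x4.
  move: (n.+1%:R^-1) (m.+1%:R^-1) => y1 y2.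
  rewrite exprVn => h1 h2 h3 h4.
  have : 4 * D <= x2 by move: h2; rewrite mulrC -[2 ^+ 2]/(2 * 2); lra.
  by lra.
have ip_cauchy f : bm f -> forall n m,
  nm (ip f (k n) - ip f (k m)) ^+ 2 <= n2 f * 2 * (n.+1%:R^-1 + m.+1%:R^-1).
  move=> bf n m; rewrite -ipBr // -mulrA.
  apply: (le_trans (cauchy_schwarz mE finE bf (bmB (bk n) (bk m)))).
  by rewrite ler_wpM2l ?n2_ge0.
have cvgRe f : bm f -> cvg (complex.Re (ip f (k n)) @[n --> \oo]).
  move=> bf; apply: (@cauchy_real _ (n2 f * 2)) => [|n m]; first by rewrite mulr_ge0 ?n2_ge0.
  apply: le_trans (ip_cauchy f bf n m); rewrite nm_sqr.
  by case: (ip f (k n)) (ip f (k m)) => a b [a' b'] /=; rewrite lerDl sqr_ge0.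
have cvgIm f : bm f -> cvg (complex.Im (ip f (k n)) @[n --> \oo]).
  move=> bf; apply: (@cauchy_real _ (n2 f * 2)) => [|n m]; first by rewrite mulr_ge0 ?n2_ge0.
  apply: le_trans (ip_cauchy f bf n m); rewrite nm_sqr.
  by case: (ip f (k n)) (ip f (k m)) => a b [a' b'] /=; rewrite lerDr sqr_ge0.
pose l f := Complex (lim (complex.Re (ip f (k n)) @[n --> \oo]))
                    (lim (complex.Im (ip f (k n)) @[n --> \oo])).
have cvg_sqr f : bm f -> nm (ip f (k n)) ^+ 2 @[n --> \oo] --> nm (l f) ^+ 2.
  move=> bf; rewrite nm_sqr !expr2; under eq_fun do rewrite nm_sqr !expr2.
  apply: cvgD; apply: cvgM; [exact: cvgRe | exact: cvgRe | exact: cvgIm | exact: cvgIm].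
have harm0 : (n.+1%:R^-1 : R) @[n --> \oo] --> (0 : R) by exact: cvg_harmonic.
have lS g : S g -> l g = 0.
  move=> Sg; have bg := S_bm Sg.
  have h : nm (ip g (k n)) ^+ 2 - n2 g * n.+1%:R^-1 @[n --> \oo] --> nm (l g) ^+ 2 - n2 g * 0.
    apply: cvgB; first exact: cvg_sqr.
    by apply: cvgM => //; exact: cvg_cst.
  have := cvg_le h (k := 0); rewrite mulr0 subr0 => H.
  have : nm (l g) ^+ 2 <= 0 by apply: H => n; rewrite subr_le0 orth.
  rewrite le_eqVlt ltNge sqr_ge0 orbF sqrf_eq0 nm_eq0.
  by move/eqP.
have l_lim f z : complex.Re (ip f (k n)) @[n --> \oo] --> complex.Re z ->
    complex.Im (ip f (k n)) @[n --> \oo] --> complex.Im z -> l f = z.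
  by case: z => a b h1 h2; rewrite /l; congr Complex; exact/cvg_lim.
have lD f g : bm f -> bm g -> l (fun t => f t + g t) = l f + l g.
  move=> bf bg; apply: l_lim.
    have -> : complex.Re (l f + l g) = complex.Re (l f) + complex.Re (l g).
      by case: (l f) (l g) => ? ? [].
    under eq_fun do rewrite ipDl //.
    have -> : (fun n => complex.Re (ip f (k n) + ip g (k n))) =
      (fun n => complex.Re (ip f (k n)) + complex.Re (ip g (k n))).
      by apply/funext => n; case: (ip f _) (ip g _) => ? ? [].
    by apply: cvgD; exact: cvgRe.
  have -> : complex.Im (l f + l g) = complex.Im (l f) + complex.Im (l g).
    by case: (l f) (l g) => ? ? [].
  under eq_fun do rewrite ipDl //.
  have -> : (fun n => complex.Im (ip f (k n) + ip g (k n))) =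
    (fun n => complex.Im (ip f (k n)) + complex.Im (ip g (k n))).
    by apply/funext => n; case: (ip f _) (ip g _) => ? ? [].
  by apply: cvgD; exact: cvgIm.
have lZ c f : bm f -> l (fun t => c * f t) = c * l f.
  move=> bf; case: c => c1 c2; apply: l_lim.
    have -> : complex.Re (Complex c1 c2 * l f) = c1 * complex.Re (l f) - c2 * complex.Im (l f).
      by case: (l f).
    under eq_fun do rewrite ipZl //.
    have -> : (fun n => complex.Re (Complex c1 c2 * ip f (k n))) =
      (fun n => c1 * complex.Re (ip f (k n)) - c2 * complex.Im (ip f (k n))).
      by apply/funext => n; case: (ip f _).
    by apply: cvgB; apply: cvgM; try exact: cvg_cst; [exact: cvgRe | exact: cvgIm].
  have -> : complex.Im (Complex c1 c2 * l f) = c1 * complex.Im (l f) + c2 * complex.Re (l f).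
    by case: (l f).
  under eq_fun do rewrite ipZl //.
  have -> : (fun n => complex.Im (Complex c1 c2 * ip f (k n))) =
    (fun n => c1 * complex.Im (ip f (k n)) + c2 * complex.Re (ip f (k n))).
    by apply/funext => n; case: (ip f _).
  by apply: cvgD; apply: cvgM; try exact: cvg_cst; [exact: cvgIm | exact: cvgRe].
exists l, (D + 1); split => //; first by rewrite addr_ge0 // ltW.
  move=> f bf; apply: (cvg_le (cvg_sqr f bf)) => n.
  apply: (le_trans (cauchy_schwarz mE finE bf (bk n))).
  rewrite mulrC ler_wpM2r ?n2_ge0 // (le_trans (nk n)) // lerD2l.
  by rewrite invf_le1 // ler1n.
split => // le0.
(* if l e0 = 0 then l vanishes at every k_m; but the inner products of k_m and k_n
   are at least about D - 1 / (m + 1), since both have squared norm near D and are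
   close to each other *)
have [m hm] : exists m : nat, m.+1%:R^-1 < D.
  exists (Num.truncn D^-1).
  rewrite -[ltRHS]invrK ltf_pV2 ?posrE ?invr_gt0 //; exact: truncnS_gt.
have lk : l (k m) = 0.
  have := lD _ _ (bk m) (S_bm (Sk m)); rewrite (lS _ (Sk m)) addr0 => <-.
  rewrite -le0; congr l; apply/funext => t; ring.
have hRe : complex.Re (ip (k m) (k n)) @[n --> \oo] --> (0 : R).
  by have := cvgRe _ (bk m); rewrite -[lim _]/(complex.Re (l (k m))) lk.
have h : (D - m.+1%:R^-1) - n.+1%:R^-1 - complex.Re (ip (k m) (k n)) @[n --> \oo]
   --> (D - m.+1%:R^-1) - 0 - 0.
  by apply: cvgB => //; apply: cvgB => //; exact: cvg_cst.
have : (D - m.+1%:R^-1) - 0 - 0 <= 0; last by rewrite !subr0 leNgt subr_gt0 hm.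
apply: (cvg_le h) => n; have := near_k m n.
have := n2_sub mE finE 1 (bk m) (bk n).
have -> : (fun t => k m t - 1 * k n t) = (fun t => k m t - k n t).
  by apply/funext => t; rewrite mul1r.
rewrite rmorph1 !mul1r => /(congr1 (@complex.Re R)).
have := D_le (Sk m); have := D_le (Sk n).
have kE j : (fun t => e0 t - (e0 t - k j t)) = k j by apply/funext => t; ring.
rewrite !kE; case: (ip (k m) (k n)) => a b /=.
move: (n2 (k m)) (n2 (k n)) (n2 _) (n.+1%:R^-1) (m.+1%:R^-1) => x1 x2 x3 y1 y2.
lra.
Qed.

End Projection.

(** * Functionals dual to the exponentials *)

Section Exponentials.
Variable R : realType.
Local Notation C := R[i].
Local Notation nm := (@Normc.normc R).
Local Notation mu := (@lebesgue_measure R).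
Variable E : set R.
Variable B : R.
Hypotheses (mE : measurable E) (finE : (mu E < +oo)%E).
Hypothesis E_bounded : forall t, E t -> `|t| <= B.
Implicit Types (f g h : R -> C) (c s : C) (v : seq (C * C)).
Local Notation bm := (@bm R E).
Local Notation n2 := (@n2 R E).

Lemma bm_cexp s : bm (fun t => cexp (- (s * t%:C%C))).
Proof.
have hB t : E t -> nm (cexp (- (s * t%:C%C))) <= expR (nm s * B).
  move=> Et; rewrite nm_cexp ler_expR.
  have -> : complex.Re (- (s * t%:C%C)) = - (complex.Re s * t).
    by case: (s) => a b /=; rewrite mulr0 subr0.
  apply: (le_trans (ler_norm _)); rewrite normrN normrM ler_pM //; last exact: E_bounded.
  exact: Re_le_nm.
split; split; try by exists (expR (nm s * B)) => t /hB; apply: le_trans;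
   [exact: Re_le_nm + exact: nm_Im_le].
- apply: measurable_realfun.continuous_measurable_fun; apply: derivable_continuous => t.
  have := is_derive_Re_cexp 1 (- s) 1 0 t.
  by under eq_fun do rewrite mul1r mul1r addr0 mulNr; exact.
- apply: measurable_realfun.continuous_measurable_fun; apply: derivable_continuous => t.
  have := is_derive_Re_cexp (- 'i%C) (- s) 1 0 t.
  have -> : (fun t : R => complex.Im (cexp (- (s * t%:C%C)))) =
    (fun t0 => complex.Re (- 'i%C * cexp (- s * (1 * t0 + 0)%:C%C))).
    apply/funext => x; rewrite mul1r addr0 [- s * _]mulNr; case: (cexp _) => a b /=; ring.
  exact.
Qed.

(** The change of variable that turns the real frequencies into points of the
    imaginary axis, the boundary of the half-planes of the Hardy space. *)
Definition rot (l : C) : C := - ('i%C * l).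

Lemma expfun_rot l : expfun l = (fun t => cexp (- (rot l * t%:C%C))).
Proof. by apply/funext => t; rewrite /expfun /rot mulNr opprK. Qed.

Definition expcomb (A : set C) g := exists v, {in v, forall p, A p.2} /\
  g = (fun t => \sum_(p <- v) p.1 * expfun p.2 t).

Lemma expcomb_linear_span A g : expcomb A g -> linear_span A (@expfun R) g.
Proof.
move=> [v [hv ->]].
exists (undup (map snd v)), (fun k => \sum_(p <- v | p.2 == k) p.1); split.
  move=> k /=; rewrite mem_undup => /mapP[p pv ->]; exact: hv.
apply/funext => t.
under [RHS]eq_bigr do rewrite mulr_suml.
rewrite (exchange_big_dep xpredT) //= big_seq [RHS]big_seq.
apply: eq_bigr => p pv; rewrite big_mkcond (bigD1_seq p.2) ?undup_uniq //=; last first.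
  by rewrite mem_undup map_f.
rewrite eqxx big1 ?addr0 // => k kp; by rewrite eq_sym (negbTE kp).
Qed.

(** Minimality says that the distance from the exponential to the span of the
    others is positive, so [annihilating_functional] applies. *)
Lemma minimal_functional (Lambda : set C) l0 : minimal_system E Lambda (@expfun R) ->
  Lambda l0 ->
  exists (l : (R -> C) -> C) (A : R),
  [/\ 0 <= A, forall f g, bm f -> bm g -> l (fun t => f t + g t) = l f + l g,
    forall c f, bm f -> l (fun t => c * f t) = c * l f,
    forall f, bm f -> nm (l f) ^+ 2 <= A * n2 f &
    (forall k, Lambda k -> k <> l0 -> l (expfun k) = 0) /\ l (expfun l0) <> 0].
Proof.
move=> hmin Ll0.
have be l : bm (expfun l) by rewrite expfun_rot; exact: bm_cexp.
pose S := expcomb (Lambda `\ l0).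
have Sbm g : S g -> bm g.
  by move=> [v [_ ->]]; apply: bm_sum => p; exact: bmZ.
have [d d0 hd] : exists2 d : R, 0 < d &
    forall g, S g -> d <= n2 (fun t => expfun l0 t - g t).
  have : ~ (forall eps : R, 0 < eps -> exists2 g, linear_span (Lambda `\ l0) (@expfun R) g &
       (L2norm E (fun t => expfun l0 t - g t)%R < eps%:E)%E).
    move=> H; apply: (hmin l0 Ll0); split => //; exact: L2_bm.
  move=> H; apply: contrapT => nd; apply: H => eps eps0; apply: contrapT => ng.
  apply: nd; exists (eps ^+ 2) => [|g Sg]; first by rewrite exprn_gt0.
  rewrite leNgt; apply/negP => lt; apply: ng; exists g; first exact: expcomb_linear_span.
  rewrite L2norm_bm //; last by apply: bmB => //; exact: Sbm.
  rewrite lte_fin -(ltr_pXn2r (ltn0Sn 1)) ?nnegrE ?sqrtr_ge0 ?(ltW eps0) //.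
  by rewrite sqr_sqrtr // n2_ge0.
have S0 : S (fun=> 0) by exists [::]; split => //; apply/funext => t; rewrite big_nil.
have SD f g : S f -> S g -> S (fun t => f t + g t).
  move=> [v1 [h1 ->]] [v2 [h2 ->]]; exists (v1 ++ v2); split.
    by move=> p; rewrite mem_cat => /orP[/h1|/h2].
  by apply/funext => t; rewrite big_cat.
have SZ c g : S g -> S (fun t => c * g t).
  move=> [v [h ->]]; exists [seq (c * p.1, p.2) | p <- v]; split.
    by move=> p /mapP[q /h hq ->].
  apply/funext => t; rewrite big_map mulr_sumr; apply: eq_bigr => p _ /=.
  by rewrite mulrA.
have [l [A [A0 lD lZ lB [lS le0]]]] :=
  annihilating_functional mE finE Sbm S0 SD SZ (be l0) d0 hd.
exists l, A; split => //; split => // k Lk kl; apply: lS.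
exists [:: (1, k)]; split; first by move=> p; rewrite inE => /eqP ->.
by apply/funext => t; rewrite big_seq1 mul1r.
Qed.

Section Cells.
Variables (l : (R -> C) -> C) (A d : R).
Hypotheses (A0 : 0 <= A) (d0 : 0 < d)
  (lD : forall f g, bm f -> bm g -> l (fun t => f t + g t) = l f + l g)
  (lZ : forall c f, bm f -> l (fun t => c * f t) = c * l f)
  (lB : forall f, bm f -> nm (l f) ^+ 2 <= A * n2 f).

Definition cell (x t : R) : R := \1_(`[x, x + d[ : set R) t.

Lemma bm_cell x : bm (fun t => (cell x t)%:C%C).
Proof.
split; last exact: bmr_cst.
split; first by apply: measurable_realfun.measurable_indic.
by exists 1 => t _; rewrite /= /cell indicE; case: (_ \in _); rewrite ?normr1 ?normr0.
Qed.

Lemma bm_cexp_sub s x : bm (fun t => cexp (- (s * (t - x)%:C%C))).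
Proof.
have -> : (fun t => cexp (- (s * (t - x)%:C%C))) =
   (fun t => cexp (s * x%:C%C) * cexp (- (s * t%:C%C))).
  by apply/funext => t; rewrite -cexpD rmorphB /=; congr cexp; ring.
by apply: bmZ; exact: bm_cexp.
Qed.

(** The transform of the part of l that lives on a cell. The cell is moved to
    the origin, so that the type depends on its length only. *)
Definition cell_transform x s : C := l (fun t => (cell x t)%:C%C * cexp (- (s * (t - x)%:C%C))).

Lemma l_sum (J : Type) (r : seq J) (F : J -> R -> C) : (forall j, bm (F j)) ->
  l (fun t => \sum_(j <- r) F j t) = \sum_(j <- r) l (F j).
Proof.
move=> hF; elim: r => [|j r IH].
  rewrite big_nil -[RHS](mul0r (l (fun=> 0))) -lZ; last exact: bm_cst.
  by congr l; apply/funext => t; rewrite big_nil mul0r.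
rewrite big_cons -IH -lD //; last exact: bm_sum.
by congr l; apply/funext => t; rewrite big_cons.
Qed.

Lemma l_eq f g : bm f -> bm g -> (forall t, E t -> f t = g t) -> l f = l g.
Proof.
move=> bf bg fg; have bN := bmZ (-1) bg.
have : nm (l (fun t => f t + (-1) * g t)) ^+ 2 <= 0.
  apply: (le_trans (lB (bmD bf bN))).
  rewrite /n2 /IR (@eq_Rintegral _ _ _ _ _ (fun=> 0)) ?Rintegral_cst ?mul0r ?mulr0 //.
  move=> t /set_mem Et; rewrite fg // mulN1r subrr.
  by rewrite Normc.normc0 expr0n.
rewrite le_eqVlt ltNge sqr_ge0 orbF sqrf_eq0 nm_eq0 lD // lZ // mulN1r subr_eq0.
by move/eqP.
Qed.

Lemma piece_cell x : piece d (cell_transform x).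
Proof.
exists A, x, 1, (- x); split => //; first by rewrite expr1n.
  by move=> t t1 t2; rewrite mul1r; apply/andP; split; lra.
move=> v.
have bF (p : C * C) : bm (fun t => p.1 * ((cell x t)%:C%C * cexp (- (p.2 * (t - x)%:C%C)))).
  by apply: bmZ; apply: bmM; [exact: bm_cell | exact: bm_cexp_sub].
have -> : pairing (cell_transform x) v =
   l (fun t => (cell x t)%:C%C * expsum v (1 * t + - x)).
  have -> : (fun t => (cell x t)%:C%C * expsum v (1 * t + - x)) =
     (fun t => \sum_(p <- v) p.1 * ((cell x t)%:C%C * cexp (- (p.2 * (t - x)%:C%C)))).
    apply/funext => t; rewrite /expsum mulr_sumr mul1r; apply: eq_bigr => p _.
    by rewrite mulrCA.
  rewrite l_sum // /pairing; apply: eq_bigr => p _; rewrite lZ //.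
  by apply: bmM; [exact: bm_cell | exact: bm_cexp_sub].
have bG : bm (fun t => (cell x t)%:C%C * expsum v (1 * t + - x)).
  apply: bmM; first exact: bm_cell.
  rewrite /expsum; apply: bm_sum => p; apply: bmZ.
  by under eq_fun do rewrite mul1r; exact: bm_cexp_sub.
apply: (le_trans (lB bG)); rewrite ler_wpM2l // /n2 /IR.
pose h : R -> R := fun t => nm (expsum v (1 * t + - x)) ^+ 2.
have ch : continuous h by exact: continuous_expsum_sqr.
have -> : (fun t => nm ((cell x t)%:C%C * expsum v (1 * t + - x)) ^+ 2) =
   (h \_ (`[x, x + d[ : set R)).
  apply/funext => t; rewrite /patch.
  have -> : cell x t = if t \in `[x, x + d[%classic then 1 else 0.
    by rewrite /cell indicE; case: (_ \in _).
  case: ifP => _.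
    by rewrite rmorph1 [1 * expsum _ _]mul1r.
  by rewrite rmorph0 [0 * expsum _ _]mul0r Normc.normc0 expr0n.
rewrite -Rintegral_mkcondr /Rintegral.
have sub : E `&` `[x, x + d[ `<=` `[x, x + d].
  by move=> t [_] /=; rewrite !in_itv /= => /andP[-> /ltW ->].
apply: fine_le.
- apply: integrable_fin_num; first exact: measurableI.
  apply: (@integrableS _ _ _ mu `[x, x + d]) => //; first exact: measurableI.
  exact: integrable_expsum.
- by apply: integrable_fin_num => //; exact: integrable_expsum.
apply: ge0_subset_integral => //.
- exact: measurableI.
- apply/measurable_realfun.measurable_EFinP; apply: (measurable_funS measurableT) => //.
  exact: measurable_realfun.continuous_measurable_fun.
- by move=> t _; rewrite lee_fin sqr_ge0.
Qed.

(** Undoing the translations of the cells recovers the transform of l. *)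
Lemma cells_sum m (x : 'I_m -> R) s : (forall t, E t -> \sum_j cell (x j) t = 1) ->
  \sum_j cexp (- (s * (x j)%:C%C)) * cell_transform (x j) s =
  l (fun t => cexp (- (s * t%:C%C))).
Proof.
move=> hx; rewrite /cell_transform.
have bF j : bm (fun t => (cell (x j) t)%:C%C * cexp (- (s * (t - x j)%:C%C))).
  by apply: bmM; [exact: bm_cell | exact: bm_cexp_sub].
under eq_bigr do rewrite -lZ //.
rewrite -l_sum; last by move=> j; exact: bmZ.
apply: l_eq; [by apply: bm_sum => j; exact: bmZ | exact: bm_cexp |].
move=> t Et; transitivity ((\sum_j cell (x j) t)%:C%C * cexp (- (s * t%:C%C))).
  rewrite rmorph_sum mulr_suml; apply: eq_bigr => j _.
  have -> : cexp (- (s * t%:C%C)) = cexp (- (s * (x j)%:C%C)) * cexp (- (s * (t - x j)%:C%C)).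
    by rewrite -cexpD rmorphB /=; congr cexp; ring.
  ring.
by rewrite hx // mul1r.
Qed.

End Cells.
End Exponentials.

(** * A determinant vanishing at the frequencies *)

Section Determinant.
Variable R : realType.
Local Notation C := R[i].
Variables (M : nat) (d : R) (Lambda : set C) (f : C -> 'I_M -> C -> C)
  (e : 'I_M -> C -> C) (rho : C -> C).
Hypotheses (d0 : 0 < d)
  (f_piece : forall l j, Lambda l -> piece d (f l j))
  (f_off : forall l k, Lambda l -> Lambda k -> k <> l ->
     \sum_j e j (rho k) * f l j (rho k) = 0)
  (f_diag : forall l, Lambda l -> \sum_j e j (rho l) * f l j (rho l) <> 0).

Let rows r (ls : 'I_r -> C) (z : C) : 'M[C]_(r, M) := \matrix_(i, j) f (ls i) j z.

Let rank_reached r := exists z (ls : 'I_r -> C),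
  (forall i, Lambda (ls i)) /\ row_free (rows ls z).

Let col_e (z : C) : 'cV[C]_M := \col_j e j z.

Let rows_col_e r (ls : 'I_r -> C) z i : (rows ls z *m col_e z) i 0 =
  \sum_j e j z * f (ls i) j z.
Proof. by rewrite mxE; apply: eq_bigr => j _; rewrite !mxE mulrC. Qed.

(** By [f_off] the rows of the ls i at rho l are orthogonal to the column of the
    e j (rho l), and by [f_diag] the row of l is not: it cannot be a combination
    of them. *)
Lemma row_free_extend r (ls : 'I_r -> C) l : Lambda l -> (forall i, Lambda (ls i)) ->
  (forall i, ls i <> l) -> row_free (rows ls (rho l)) -> rank_reached r.+1.
Proof.
move=> Ll Ls Ldiff free.
pose ls' (i : 'I_(1 + r)) := match fintype.split i with inl _ => l | inr i => ls i end.
exists (rho l), ls'; split; first by move=> i; rewrite /ls'; case: fintype.split.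
apply: (@inj_row_free _ (1 + r) M (rows ls' (rho l))) => u; rewrite -[u]hsubmxK.
move: (lsubmx u) (rsubmx u) => u1 u2 hu.
have rE : rows ls' (rho l) = col_mx (rows (fun=> l) (rho l)) (rows ls (rho l)).
  apply/matrixP => i j; rewrite !mxE /ls'.
  by case: fintype.split => k; rewrite !mxE.
move: hu; rewrite rE mul_row_col => hu.
have z2 : rows ls (rho l) *m col_e (rho l) = 0.
  apply/matrixP => i j; rewrite [j]ord1 rows_col_e mxE f_off //.
  by move=> E; apply: (Ldiff i).
have u10 : u1 = 0.
  have := congr1 (mulmx^~ (col_e (rho l))) hu.
  rewrite /= mulmxDl -!mulmxA z2 mulmx0 addr0 mul0mx => /matrixP/(_ 0 0).
  rewrite mxE big_ord1 rows_col_e mxE => /eqP.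
  rewrite mulf_eq0 => /orP[/eqP h|/eqP h]; last by have := f_diag Ll.
  by apply/matrixP => i1 j1; rewrite [i1]ord1 [j1]ord1 h mxE.
move: hu; rewrite u10 mul0mx add0r => hu.
have -> : u2 = 0 by apply: (row_free_inj free); rewrite hu mul0mx.
exact: row_mx0.
Qed.

(** Let n + 1 be the largest rank that is reached. A minor of that order which
    does not vanish at rho l, for a frequency l that it does not involve, would
    give a larger rank by [row_free_extend]. *)
Lemma determinant_function : (exists l, Lambda l) ->
  exists n (F : C -> C) (exc : seq C), [/\ (n < M)%N, pw (n.+1%:R * d) F,
    pw (n.+1%:R * d) (reflect_pw (n.+1%:R * d) F), exists z, F z != 0 &
    forall l, Lambda l -> l \notin exc -> F (rho l) = 0].
Proof.
move=> [l0 Ll0].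
have P1 : rank_reached 1.
  apply: (@row_free_extend 0 (fun=> l0) l0 Ll0) => //; first by case.
  by apply: inj_row_free => u _; exact: thinmx0.
pose P := [pred r | `[< rank_reached r >]].
have bnd r : P r -> (r <= M)%N.
  by move=> /asboolP[z [ls [_ /eqP <-]]]; exact: rank_leq_col.
have ex : exists r, P r by exists 1%N; apply/asboolP.
have [[|n] /asboolP Pr rmax] := ex_maxnP ex bnd.
  by have := rmax 1%N (asboolT P1).
have [z [ls [Ls free]]] := Pr.
have full : row_full (rows ls z)^T by rewrite /row_full mxrank_tr; exact: free.
pose g := fullrankfun full.
pose F s := \det (\matrix_(i, j) f (ls i) (g j) s).
have nM : (n < M)%N by apply: bnd; apply/asboolP.
exists n, F, [seq ls i | i : 'I_n.+1]; split => //.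
- by apply: pw_det => // i j; exact: f_piece.
- by apply: pw_det_reflect => // i j; exact: f_piece.
- exists z; rewrite -unitfE -unitmxE -unitmx_tr.
  suff -> : (\matrix_(i, j) f (ls i) (g j) z)^T = rowsub g (rows ls z)^T.
    exact: fullrowsub_unit.
  by apply/matrixP => i j; rewrite !mxE.
move=> l Ll lexc; apply: contrapT => Fl.
have free' : row_free (rows ls (rho l)).
  apply: inj_row_free => u hu.
  have U : \matrix_(i, j) f (ls i) (g j) (rho l) \in unitmx.
    by rewrite unitmxE unitfE; apply/eqP.
  apply: (can_inj (mulmxK U)); rewrite mul0mx.
  apply/matrixP => i j; have /matrixP/(_ i (g j)) := hu.
  by rewrite !mxE => h; rewrite -[RHS]h; apply: eq_bigr => k _; rewrite !mxE.
have : P n.+2.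
  apply/asboolP; apply: (row_free_extend Ll Ls) => // i E.
  by move: lexc; rewrite -E map_f // mem_enum.
by move/rmax; rewrite ltnn.
Qed.

End Determinant.

(** * Covering intervals by cells of equal length *)

Section GridCover.
Variable R : realType.
Local Notation mu := (@lebesgue_measure R).

(** This bounds by two the number of cells that meet an interval without being
    contained in it: a cell lying between two cells that meet the interval is
    contained in it. *)
Lemma card_unnested_le2 K (Q : {set 'I_K}) :
  (forall i j k : 'I_K, i \in Q -> j \in Q -> k \in Q -> (i < j < k)%N -> False) ->
  (#|Q| <= 2)%N.
Proof.
move=> hQ; case: (set_0Vmem Q) => [->|[i0 Qi0]]; first by rewrite cards0.
have [a Qa amin] := arg_minnP (P := mem Q) (fun i : 'I_K => nat_of_ord i) Qi0.
have [b Qb bmax] := arg_maxnP (P := mem Q) (fun i : 'I_K => nat_of_ord i) Qi0.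
apply: (@leq_trans #|[set a; b]%SET|); last by rewrite cards2; case: (a != b).
apply: subset_leq_card; apply/fintype.subsetP => k Qk; rewrite !inE.
apply/negPn/negP; rewrite negb_or => /andP[ka kb].
apply: (hQ a k b Qa Qk Qb); apply/andP; split; rewrite ltn_neqAle.
  by rewrite eq_sym ka /= amin.
by rewrite kb /=; exact: bmax.
Qed.

Lemma measurable_bigcup_interval N (I : 'I_N -> set R) :
  (forall j, is_interval (I j)) -> measurable (\bigcup_j I j).
Proof.
move=> hI; apply: fin_bigcup_measurable => [|j _]; first exact: finite_finset.
exact: measurable_realfun.is_interval_measurable.
Qed.

Lemma bounded_lebesgue_lty (E : set R) (B : R) : measurable E ->
  (forall t, E t -> `|t| <= B) -> (mu E < +oo)%E.
Proof.
move=> mE hB; apply: (@le_lt_trans _ _ (mu `[- B, B])).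
  apply: le_measure; rewrite ?inE //.
  by move=> t /hB; rewrite ler_norml /= in_itv.
by rewrite lebesgue_measure_itv /=; case: ifP => _; rewrite ?ltry.
Qed.

(** Among the cells of a grid that meet the union, those contained in it have
    total length at most its measure, and at most two per interval are not
    ([card_unnested_le2]). *)
Lemma grid_cover (N : nat) (I : 'I_N -> set R) (B eps : R) :
  (forall j, is_interval (I j)) -> 0 < B -> 0 < eps ->
  (forall t, (\bigcup_j I j) t -> `|t| <= B) ->
  exists (M : nat) (x : 'I_M -> R) (d : R), [/\ 0 < d,
    forall t, (\bigcup_j I j) t -> \sum_j cell d (x j) t = 1 &
    M%:R * d <= fine (mu (\bigcup_j I j)) + eps].
Proof.
move=> hI B0 eps0 hB; set E := \bigcup_j I j.
have mE : measurable E by exact: measurable_bigcup_interval.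
have finE : (mu E < +oo)%E by exact: bounded_lebesgue_lty hB.
(* at most 2 N cells stick out, and they must not cost more than eps *)
pose d : R := eps / (N.*2.+1)%:R.
have d0 : 0 < d by rewrite divr_gt0.
pose K := (Num.truncn (2 * B / d)).+1.
pose a (k : 'I_K) : R := - B + k%:R * d.
pose c (k : 'I_K) : set R := `[a k, a k + d[%classic.
have cP k t : c k t <-> k%:R <= (t + B) / d < k.+1%:R.
  rewrite /c /= in_itv /= ler_pdivlMr // ltr_pdivrMr //.
  rewrite (_ : (a k <= t) = (k%:R * d <= t + B)); last first.
    by rewrite /a [- B + _]addrC lerBlDr.
  rewrite (_ : (t < a k + d) = (t + B < k.+1%:R * d)) //.
  by rewrite -natr1 mulrDl mul1r -ltrBrDr; congr (_ < _); rewrite /a; ring.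
have c_uniq k t : c k t -> Num.truncn ((t + B) / d) = k.
  by move=> /cP; exact: truncn_def.
have c_ex t : E t -> exists k, c k t.
  move=> /hB; rewrite ler_norml => /andP[tB1 tB2].
  have p0 : 0 <= (t + B) / d by rewrite divr_ge0 ?(ltW d0) // -lerBlDr sub0r.
  have kK : (Num.truncn ((t + B) / d) < K)%N.
    rewrite ltnS le_truncn // ler_pM2r ?invr_gt0 //; lra.
  by exists (Ordinal kK); apply/cP; exact: truncn_itv.
pose J := [set k : 'I_K | `[< exists2 t, c k t & E t >]]%SET.
pose Jin := [set k : 'I_K | `[< (c k `<=` E)%classic >]]%SET.
pose Q j := [set k : 'I_K | `[< (exists2 t, c k t & I j t) /\ ~ (c k `<=` I j)%classic >]]%SET.
exists #|J|, (fun j => a (enum_val j)), d; split => //.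
  move=> t Et; rewrite -(big_enum_val (fun k => cell d (a k) t)).
  have [k ck] := c_ex t Et.
  have kJ : k \in J by rewrite inE; apply/asboolP; exists t.
  rewrite (bigD1 k) //= big1 ?addr0.
    by rewrite /cell indicE mem_set.
  move=> k' /andP[_ k'k].
  have nck' : ~ c k' t.
    by move=> ck'; move/eqP: k'k; apply; apply: val_inj; rewrite -[LHS](c_uniq _ _ ck') (c_uniq _ _ ck).
  rewrite /cell indicE (_ : (t \in _) = false) //; exact: memNset.
have cardQ j : (#|Q j| <= 2)%N.
  apply: card_unnested_le2 => k1 k2 k3.
  rewrite !finset.in_set => /asboolP[[t1 c1 I1] _] /asboolP[_ n2] /asboolP[[t3 c3 I3] _].
  move=> /andP[k12 k23].
  apply: n2 => t ct; apply: (hI j t1 t3 I1 I3).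
  move: c1 c3 ct => /cP/andP[_ h1] /cP/andP[h3 _] /cP/andP[h4 h5].
  have e1 : k1.+1%:R <= k2%:R :> R by rewrite ler_nat.
  have e2 : k2.+1%:R <= k3%:R :> R by rewrite ler_nat.
  have := lt_le_trans h1 (le_trans e1 h4); have := lt_le_trans h5 (le_trans e2 h3).
  by rewrite !ltr_pM2r ?invr_gt0 // !ltrD2r => /ltW -> /ltW ->.
have JQ : J \subset (Jin :|: \bigcup_j Q j)%SET.
  apply/fintype.subsetP => k; rewrite finset.in_setU !finset.in_set => /asboolP[t ck [j _ It]].
  case: (pselect (c k `<=` E)) => [h|h]; first by rewrite asboolT.
  apply/orP; right; apply/finset.bigcupP; exists j => //; rewrite finset.in_set; apply/asboolP; split.
    by exists t.
  by move=> cI; apply: h => s /cI Is; exists j.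
have cardU : (#|(\bigcup_j Q j)%SET| <= N * 2)%N.
  apply: (@leq_trans (\sum_(j < N) #|Q j|)).
    elim/big_ind2 : _ => [|A1 n1 A2 n2 h1 h2|//]; first by rewrite cards0.
    by rewrite (leq_trans (leq_card_setU _ _)) // leq_add.
  by rewrite -[X in (_ <= X * _)%N]card_ord -sum_nat_const leq_sum.
have cardJ : (#|J| <= #|Jin| + N.*2)%N.
  apply: (leq_trans (subset_leq_card JQ)); apply: (leq_trans (leq_card_setU _ _)).
  by rewrite leq_add2l -muln2.
have Jin_le : #|Jin|%:R * d <= fine (mu E).
  have tI : trivIset (fun k : 'I_K => k \in Jin) c.
    move=> k k' _ _ [t [ck ck']].
    by apply: val_inj; rewrite -[LHS](c_uniq _ _ ck) (c_uniq _ _ ck').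
  have := measure_bigsetU_ord_cond mu (fun k _ => measurable_itv `[a k, a k + d[) tI.
  move=> H; rewrite -lee_fin fineK ?ge0_fin_numE //.
  have -> : (#|Jin|%:R * d)%:E = (\sum_(k < K | k \in Jin) mu (c k))%E.
    rewrite (eq_bigr (fun=> d%:E)) => [|k _].
      by rewrite sumEFin sumr_const mulr_natl.
    rewrite lebesgue_measure_itv /= lte_fin ltrDl d0.
    by rewrite -EFinD [a k + d]addrC addrK.
  rewrite -H; apply: le_measure; rewrite ?inE //.
    by apply: bigsetU_measurable => k _; exact: measurable_itv.
  rewrite -bigcup_pred => t [k] /=; rewrite finset.in_set => /asboolP; exact.
apply: (@le_trans _ _ ((#|Jin| + N.*2)%:R * d)).
  by rewrite ler_pM2r // ler_nat.
rewrite natrD mulrDl lerD // /d mulrA ler_pdivrMr // mulrC ler_pM2l // ler_nat.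
exact: leqnSn.
Qed.

End GridCover.

(** * Density of the frequencies *)

Section Density.
Variable R : realType.
Local Notation C := R[i].

Lemma counting_le (T : choiceType) (A : set T) (X : R) :
  (forall zs : seq T, uniq zs -> {in zs, forall z, A z} -> (size zs)%:R <= X) ->
  (counting A <= X%:E)%E.
Proof.
move=> hA; rewrite /counting; case: asboolP => [finA|infA].
  rewrite lee_fin; apply: hA; first exact: finmap.fset_uniq.
  by move=> z zA; apply/set_mem; rewrite -(in_fset_set finA).
have X0 : 0 <= X by exact: (hA [::]).
have [B BA Bsize] := infinite_set_fset (Num.truncn X).+1 infA.
have := hA (finmap.enum_fset B) (finmap.fset_uniq B) (fun z => @BA z).
rewrite leNgt (lt_le_trans (truncnS_gt X)) //.
by rewrite ler_nat.
Qed.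

Lemma upper_density_le (L : set C) (X : R) :
  (exists T0 : R, forall (T : R) (zs : seq C), T0 <= T -> uniq zs ->
     {in zs, forall z, L z /\ Normc.normc z <= T} -> (size zs)%:R <= X * T) ->
  (upper_density L <= (X / 2)%:E)%E.
Proof.
move=> [T0 hT]; rewrite /upper_density limf_esupE.
pose S : set R := [set r | Num.max T0 1 < r].
apply: (@le_trans _ _ (ereal_sup
  [set (counting (L `&` disk r) * ((2 * r)^-1)%:E)%E | r in S])).
  apply: ereal_inf_lbound; exists S => //.
  by exists (Num.max T0 1); split; rewrite ?num_real.
apply: ge_ereal_sup => _ [r Sr <-].
have [T0r r1] : T0 <= r /\ 1 < r.
  by move: Sr; rewrite /S /= gt_max => /andP[/ltW].
have r0 : 0 < r by apply: lt_trans r1.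
have -> : X / 2 = X * r * (2 * r)^-1 by field; rewrite gt_eqF.
rewrite EFinM lee_wpmul2r ?lee_fin ?invr_ge0 ?mulr_ge0 ?(ltW r0) //.
apply: counting_le => zs uzs hzs; apply: (hT r) => // z /hzs[Lz] /ltW.
by split.
Qed.

End Density.

Section FrequencyCount.
Variable R : realType.
Local Notation C := R[i].
Local Notation mu := (@lebesgue_measure R).
Local Notation nm := (@Normc.normc R).

Lemma rot_inj : injective (@rot R).
Proof.
have i0 : 'i%C != 0 :> C by rewrite eq_complex /= oner_eq0 andbF.
by move=> k l /oppr_inj/(mulfI i0).
Qed.

Lemma nm_rot (l : C) : nm (rot l) = nm l.
Proof.
by rewrite /rot nmN Normc.normcM /= expr0n expr1n add0r sqrtr1 mul1r.
Qed.

(** The zeros of the function of [determinant_function] are counted by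
    [zeros_count]; the finitely many frequencies that it may miss are absorbed
    in eps T. *)
Lemma frequency_count (N : nat) (I : 'I_N -> set R) (B : R) (Lambda : set C) (eps : R) :
  (forall j, is_interval (I j)) -> 0 < B -> (forall t, (\bigcup_j I j) t -> `|t| <= B) ->
  minimal_system (\bigcup_j I j) Lambda (@expfun R) -> 0 < eps ->
  exists T0 : R, forall (T : R) (zs : seq C), T0 <= T -> uniq zs ->
     {in zs, forall z, Lambda z /\ nm z <= T} ->
     (size zs)%:R <= ((fine (mu (\bigcup_j I j)) + eps) / pi + eps) * T.
Proof.
move=> hI B0 hB; set E := \bigcup_j I j => hmin eps0.
have mE : measurable E by exact: measurable_bigcup_interval.
have finE : (mu E < +oo)%E by exact: bounded_lebesgue_lty hB.
have muE0 : 0 <= fine (mu E) by rewrite fine_ge0.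
have pi0 : 0 < pi :> R by exact: pi_gt0.
case: (pselect (exists l, Lambda l)) => [exL|noL]; last first.
  exists 0 => T zs T0 _ hzs; have -> : zs = [::].
    case: zs hzs => // z zs /(_ z (mem_head _ _))[Lz _].
    by exfalso; apply: noL; exists z.
  apply: mulr_ge0 => //.
  apply: addr_ge0; last exact: ltW.
  apply: divr_ge0; last exact: ltW.
  by apply: addr_ge0 => //; exact: ltW.
have [M [x [d [d0 hx Md]]]] := grid_cover hI B0 eps0 hB.
have fex l0 : exists f : ('I_M -> C -> C), Lambda l0 ->
  [/\ forall j, piece d (f j),
    forall k, Lambda k -> k <> l0 ->
      \sum_j cexp (- (rot k * (x j)%:C%C)) * f j (rot k) = 0 &
    \sum_j cexp (- (rot l0 * (x j)%:C%C)) * f j (rot l0) <> 0].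
  case: (pselect (Lambda l0)) => [Ll0|nL]; last by exists (fun _ _ => 0).
  have [l [A [A0 lD lZ lB [l_off l_diag]]]] := minimal_functional mE finE hB hmin Ll0.
  exists (fun j => cell_transform l d (x j)) => _.
  have sumE k : \sum_j cexp (- (rot k * (x j)%:C%C)) * cell_transform l d (x j) (rot k)
      = l (expfun k).
    by rewrite expfun_rot; exact: (cells_sum mE hB lD lZ lB).
  split.
  - by move=> j; exact: (piece_cell mE hB d A0 lD lZ lB).
  - by move=> k Lk kl0; rewrite sumE l_off.
  - by rewrite sumE.
have [f hf] := choice fex.
have [n [F [exc [nM pwF pwFr [s0 Fs0] F0]]]] := @determinant_function R M d Lambda f
  (fun j s => cexp (- (s * (x j)%:C%C))) (@rot R) d0
  (fun l j Ll => let: And3 h _ _ := hf l Ll in h j)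
  (fun l k Ll Lk kl => let: And3 _ h _ := hf l Ll in h k Lk kl)
  (fun l Ll => let: And3 _ _ h := hf l Ll in h) exL.
have eps2 : 0 < eps / 2 by rewrite divr_gt0.
have [T0 hT] := zeros_count eps2 Fs0 pwF pwFr.
have wle : n.+1%:R * d <= fine (mu E) + eps.
  by apply: le_trans Md; rewrite ler_wpM2r ?(ltW d0) // ler_nat.
exists (Num.max T0 (Num.max 0 ((size exc)%:R / (eps / 2)))) => T zs.
rewrite !ge_max => /andP[T0T /andP[Tge0 Texc]] uzs hzs.
pose ys := [seq rot z | z <- zs & z \notin exc].
have size_ys : (size ys)%:R <= ((fine (mu E) + eps) / pi + eps / 2) * T.
  apply: (@le_trans _ _ ((n.+1%:R * d / pi + eps / 2) * T)).
    apply: hT => //; first by rewrite map_inj_uniq ?filter_uniq //; exact: rot_inj.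
    move=> y /mapP[z]; rewrite mem_filter => /andP[zexc /hzs[Lz zT]] ->.
    by rewrite nm_rot; split => //; exact: F0.
  by rewrite ler_wpM2r // lerD2r ler_pM2r ?invr_gt0.
have size_exc : (size [seq z <- zs | z \in exc] <= size exc)%N.
  apply: uniq_leq_size; first exact: filter_uniq.
  by move=> z; rewrite mem_filter => /andP[].
have size_zs : size zs = (size [seq z <- zs | z \in exc] + size ys)%N.
  by rewrite size_map !size_filter -(count_predC (fun z => z \in exc)).
have excT : (size exc)%:R <= eps / 2 * T by rewrite mulrC -ler_pdivrMr.
rewrite size_zs natrD.
have -> : ((fine (mu E) + eps) / pi + eps) * T =
  eps / 2 * T + ((fine (mu E) + eps) / pi + eps / 2) * T by move: (_ / pi) => a; field.
by rewrite lerD // (le_trans _ excT) // ler_nat.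
Qed.

End FrequencyCount.

(** * The density bound *)

Local Open Scope complex_scope.

Theorem corollary3p5 (R : realType) (N : nat) (I : 'I_N -> set R)
    (I_interval : forall j, is_interval (I j))
    (I_bounded : forall j, bounded_set (I j))
    (E : set R) (E_def : E = \bigcup_j I j)
    (Lambda : set R[i])
    (Lambda_complete : complete_system E Lambda (@expfun R))
    (Lambda_minimal : minimal_system E Lambda (@expfun R)) :
  (upper_density Lambda <= lebesgue_measure E * ((2 * pi)^-1)%:E)%E.
Proof.
have [b hb] : exists b : 'I_N -> R, forall j t, I j t -> `|t| <= b j.
  suff H j : exists b : R, forall t, I j t -> `|t| <= b.
    by have [b hb] := choice H; exists b.
  have [M [_ hM]] := I_bounded j; exists (M + 1) => t It.
  by apply: (hM (M + 1)) => //; rewrite ltrDl.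
pose B : R := \sum_j `|b j| + 1.
have B0 : 0 < B by rewrite ltr_wpDl // sumr_ge0.
have hB t : (\bigcup_j I j) t -> `|t| <= B.
  move=> [j _ /hb htb]; apply: (le_trans htb); apply: (le_trans (ler_norm _)).
  rewrite /B (bigD1 j) //= -addrA lerDl addr_ge0 // sumr_ge0 //.
have finE : (lebesgue_measure E < +oo)%E.
  rewrite E_def; apply: bounded_lebesgue_lty hB.
  exact: measurable_bigcup_interval.
have pi0 : 0 < pi :> R by exact: pi_gt0.
rewrite -[lebesgue_measure E]fineK; last by rewrite ge0_fin_numE.
rewrite -EFinM; apply/lee_addgt0Pr => eps eps0.
pose eps' := eps / (pi^-1 + 1).
have p1 : 0 < pi^-1 + 1 :> R by rewrite ltr_wpDl ?invr_ge0 ?ltW.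
have eps'0 : 0 < eps' by rewrite divr_gt0.
have := Lambda_minimal; rewrite E_def => hmin.
have /upper_density_le := frequency_count I_interval B0 hB hmin eps'0.
move=> /le_trans; apply.
rewrite -EFinD lee_fin -E_def.
have -> : ((fine (lebesgue_measure E) + eps') / pi + eps') / 2 =
  fine (lebesgue_measure E) * (2 * pi)^-1 + eps' * (pi^-1 + 1) / 2.
  rewrite invfM; move: (fine _) (pi^-1) => m p; by field.
rewrite lerD2l /eps' divfK ?gt_eqF // ler_pdivrMr //; lra.
Qed.
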